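(* Let $(T(t))_{t\ge0}$ be a uniformly bounded $C_0$-semigroup on a Banach space $X$, $\|T(t)\|\le M$, with infinitesimal generator $-A$, and let $\alpha>-1$. (i) For $p\in\mathbb N$, $x\in D(A^p)$ and $n\ge p$, $$\|A^n(A+1)^{-n-\alpha-1}x\|\le\frac{C}{n^{(\alpha+p)/2}}\|A^px\|,$$ with $C>0$ depending only on $\alpha$, $p$ and $M$. (ii) For each $t>0$ there is $m_0\in\mathbb N$ such that for all integers $m\ge m_0$ and $p$ with $2<p\le m+1$, and all $x\in D(A^p)$, $$\|T(t)x-T_{m,\alpha}(t)x\|\le\frac{C_{t,p}\,\|A^px\|}{m^{p/2-1}},$$ where $C_{t,p}$ is a constant independent of $m$ and $x$, and $T_{m,\alpha}(t)x:=\sum_{n=0}^mA^n(A+1)^{-n-\alpha-1}x\,L_n^{(\alpha)}(t)$.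
   Context: $L_n^{(\alpha)}(t)=\sum_{k=0}^n(-1)^k\binom{n+\alpha}{n-k}\frac{t^k}{k!}$ is the generalized Laguerre polynomial. The generator is defined by $-Ax=\lim_{t\to0^+}\frac{T(t)x-x}{t}$. For $\gamma>0$, $(A+1)^{-\gamma}x:=\frac{1}{\Gamma(\gamma)}\int_0^\infty s^{\gamma-1}e^{-s}T(s)x\,ds$. *)

(* Defs.v *)
From Stdlib Require Import Reals Lra Lia Arith Factorial.
Open Scope R_scope.

Record BanachSpace := {
  carrier :> Type;
  vzero : carrier;
  vadd : carrier -> carrier -> carrier;
  vopp : carrier -> carrier;
  vscal : R -> carrier -> carrier;
  vnorm : carrier -> R;
  vadd_assoc : forall x y z, vadd x (vadd y z) = vadd (vadd x y) z;
  vadd_comm : forall x y, vadd x y = vadd y x;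
  vadd_0 : forall x, vadd x vzero = x;
  vadd_opp : forall x, vadd x (vopp x) = vzero;
  vscal_1 : forall x, vscal 1 x = x;
  vscal_assoc : forall a b x, vscal a (vscal b x) = vscal (a * b) x;
  vscal_distr_l : forall a x y, vscal a (vadd x y) = vadd (vscal a x) (vscal a y);
  vscal_distr_r : forall a b x, vscal (a + b) x = vadd (vscal a x) (vscal b x);
  vnorm_eq0 : forall x, vnorm x = 0 -> x = vzero;
  vnorm_triangle : forall x y, vnorm (vadd x y) <= vnorm x + vnorm y;
  vnorm_scal : forall a x, vnorm (vscal a x) = Rabs a * vnorm x;
  vcomplete : forall u : nat -> carrier,
    (forall eps, 0 < eps -> exists N, forall m n, (N <= m)%nat -> (N <= n)%nat ->
        vnorm (vadd (u m) (vopp (u n))) < eps) ->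
    exists l, forall eps, 0 < eps -> exists N, forall n, (N <= n)%nat ->
        vnorm (vadd (u n) (vopp l)) < eps
}.

Arguments vzero {_}. Arguments vadd {_}. Arguments vopp {_}.
Arguments vscal {_}. Arguments vnorm {_}.

Definition vsub {X : BanachSpace} (x y : X) : X := vadd x (vopp y).

Fixpoint vsum {X : BanachSpace} (f : nat -> X) (m : nat) : X :=
  match m with 0 => f 0%nat | S k => vadd (vsum f k) (f (S k)) end.

Fixpoint vsum_lt {X : BanachSpace} (g : nat -> X) (N : nat) : X :=
  match N with 0 => vzero | S k => vadd (vsum_lt g k) (g k) end.

Definition vriemann {X : BanachSpace} (f : R -> X) (a b : R) (N : nat) : X :=
  vscal ((b - a) / INR N) (vsum_lt (fun i => f (a + INR i * (b - a) / INR N)) N).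

Definition rriemann (f : R -> R) (a b : R) (N : nat) : R :=
  (b - a) / INR N * sum_f_R0 (fun i => f (a + INR i * (b - a) / INR N)) (Nat.pred N).

(* v is the Riemann integral of f over [a,b] (limit of Riemann sums; the
   integrands used below are continuous on [a,b], where this is the
   Riemann/Bochner integral). *)
Definition vint_ab {X : BanachSpace} (f : R -> X) (a b : R) (v : X) : Prop :=
  forall eps, 0 < eps -> exists N0, forall N, (N0 <= N)%nat -> (1 <= N)%nat ->
    vnorm (vsub (vriemann f a b N) v) < eps.

Definition rint_ab (f : R -> R) (a b : R) (v : R) : Prop :=
  forall eps, 0 < eps -> exists N0, forall N, (N0 <= N)%nat -> (1 <= N)%nat ->
    Rabs (rriemann f a b N - v) < eps.

Definition vint_0inf {X : BanachSpace} (f : R -> X) (v : X) : Prop :=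
  forall eps, 0 < eps -> exists delta, 0 < delta /\ exists R0,
    forall a b, 0 < a -> a < delta -> R0 < b ->
      exists w, vint_ab f a b w /\ vnorm (vsub w v) < eps.

Definition rint_0inf (f : R -> R) (v : R) : Prop :=
  forall eps, 0 < eps -> exists delta, 0 < delta /\ exists R0,
    forall a b, 0 < a -> a < delta -> R0 < b ->
      exists w, rint_ab f a b w /\ Rabs (w - v) < eps.

Definition Gamma_val (gam g : R) : Prop :=
  rint_0inf (fun s => Rpower s (gam - 1) * exp (- s)) g.

Definition C0_semigroup (X : BanachSpace) (T : R -> X -> X) : Prop :=
  (forall t, 0 <= t -> (forall x y, T t (vadd x y) = vadd (T t x) (T t y)) /\
                       (forall a x, T t (vscal a x) = vscal a (T t x)) /\
                       (exists K, forall x, vnorm (T t x) <= K * vnorm x)) /\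
  (forall x, T 0 x = x) /\
  (forall t s x, 0 <= t -> 0 <= s -> T (t + s) x = T t (T s x)) /\
  (forall x eps, 0 < eps -> exists delta, 0 < delta /\
      forall h, 0 < h -> h < delta -> vnorm (vsub (T h x) x) < eps).

Definition unif_bounded (X : BanachSpace) (T : R -> X -> X) (M : R) : Prop :=
  forall t x, 0 <= t -> vnorm (T t x) <= M * vnorm x.

(* -A is the generator: x in D(A) and A x = y  iff  (T(h)x - x)/h -> -y as h->0+ *)
Definition genA (X : BanachSpace) (T : R -> X -> X) (x y : X) : Prop :=
  forall eps, 0 < eps -> exists delta, 0 < delta /\
    forall h, 0 < h -> h < delta ->
      vnorm (vadd (vscal (/ h) (vsub (T h x) x)) y) < eps.

Fixpoint Apow (X : BanachSpace) (T : R -> X -> X) (p : nat) (x y : X) : Prop :=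
  match p with
  | 0 => y = x
  | S q => exists z, genA X T x z /\ Apow X T q z y
  end.

(* y = (A+1)^(-gam) x = Gamma(gam)^(-1) int_0^oo s^(gam-1) e^(-s) T(s)x ds *)
Definition resolvent_pow (X : BanachSpace) (T : R -> X -> X) (gam : R) (x y : X) : Prop :=
  exists g, Gamma_val gam g /\
    vint_0inf (fun s => vscal (Rpower s (gam - 1) * exp (- s) / g) (T s x)) y.

Fixpoint gbinom (a : R) (k : nat) : R :=
  match k with 0 => 1 | S j => gbinom a j * (a - INR j) / INR (S j) end.

Definition Laguerre (n : nat) (alpha t : R) : R :=
  sum_f_R0 (fun k => (-1) ^ k * gbinom (INR n + alpha) (n - k) * t ^ k / INR (fact k)) n.

(* Main.v *)
Require Import Defs.
From Stdlib Require Import Reals Lra Lia List Factorial.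
From Stdlib Require Import ClassicalEpsilon FunctionalExtensionality PropExtensionality.
From Coquelicot Require Import Coquelicot.
Open Scope R_scope.

(** Integrating by parts, [A^n (A+1)^(-n-a-1) x = int_0^oo kappa_n(s) T(s)x ds], where
    [kappa_n] is the normalised Laguerre function [s^a e^(-s) L_n^a(s) / h_n] and
    [h_n = Gamma(n+a+1)/n!] is its squared norm. Trading [p] of the derivatives in
    Rodrigues' formula for powers of [A] on [x] replaces [kappa_n] by a multiple of
    [s^(a+p) e^(-s) L_(n-p)^(a+p)], and Cauchy-Schwarz for the weight [s^(a+p) e^(-s)]
    gives (i).

    For (ii), an energy estimate for the Laguerre equation gives [L_n^a(t)^2 <= C h_n],
    so (i) makes the series absolutely convergent on [D(A^p)], [p > 2], with the stated
    tail; it remains to identify its sum. With [K_m] the kernel of the [m]-th partial sum,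
    [Phi(u) = int K_m(s) T(t + u (s-t)) x ds] joins [Phi(0) = T(t) x] to the partial
    sum [Phi(1)], and by the Christoffel-Darboux formula
    [Phi'(u) = T(t(1-u)) int (t-s) K_m(s) T(us) A x ds] consists of two Laguerre
    coefficients of the rescaled semigroup [T(u .)], which (i) bounds by [O(m^(-1/2))]
    if [x] is in [D(A^4)]. Averaging [x] over [T(s) x], [0 <= s <= h], removes the extra
    regularity. *)

(** * Improper integrals of vector-valued functions *)

(** The partial-sum kernels K_m change sign in general and no uniform bound on their L1 norms is at
    hand, so they are not treated as an approximate identity at t. The path Phi reduces the question
    to the single moment (t - s) K_m(s), in which all but two terms cancel. Rescaling costs nothing:
    for 0 <= u <= 1 the family T(u s) obeys the same bound and its generator corresponds to u A, so
    the coefficient estimates are uniform in u. The orders match as follows. The two surviving terms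
    carry factors of size m sqrt(h_m); three powers of A on A x contribute m^(-3/2) / sqrt(h_m),
    which leaves m^(-1/2). Hence four powers of A on x. This slow rate only identifies the limit: it
    is used at an index N tending to infinity, so its dependence on A^4 x disappears, and the stated
    rate comes from the tail alone, with a constant that sees only A^p x. This is also why the
    averaging can be undone: averages are uniformly bounded and commute with A. For alpha < 0 the
    weight is singular at 0, so all integrals are taken as improper at both ends. *)

Definition is_int {V : NormedModule R_AbsRing} (f : R -> V) (v : V) : Prop :=
  is_RInt_gen f (at_right 0) (Rbar_locally p_infty) v.

(** The quantifier pattern is that of [vint_0inf] and [rint_0inf], which lets filter statements
    transfer to the integrals of the theorem without reshuffling limits. *)
Definition at_ends (P : R -> R -> Prop) : Prop :=
  exists d, 0 < d /\ exists r, forall a b, 0 < a -> a < d -> r < b -> P a b.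

Lemma at_ends_filter (P : R * R -> Prop) :
  filter_prod (at_right 0) (Rbar_locally p_infty) P <-> at_ends (fun a b => P (a, b)).
Proof.
  split.
  - intros [Q S [d HQ] [r HS] H].
    exists d. split; [apply cond_pos|]. exists r. intros a b Ha Hd Hb.
    apply H.
    + apply HQ; auto. unfold ball; simpl; unfold AbsRing_ball, abs, minus, plus, opp; simpl.
      rewrite Rabs_pos_eq; lra.
    + apply HS; auto.
  - intros (d & Hd & r & H).
    apply (Filter_prod _ _ _ (fun a => 0 < a < d) (fun b => r < b)).
    + exists (mkposreal d Hd). intros y Hy Hy0. split; auto.
      unfold ball in Hy; simpl in Hy; unfold AbsRing_ball, abs, minus, plus, opp in Hy; simpl in Hy.
      rewrite Rabs_pos_eq in Hy; lra.
    + exists r. auto.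
    + intros; apply H; tauto.
Qed.

Lemma at_ends_pos (P : R -> R -> Prop) :
  (forall a b, 0 < a -> a < b -> P a b) -> at_ends P.
Proof.
  intros H. exists 1. split; [lra|]. exists 1. intros a b ? ? ?. apply H; lra.
Qed.

Lemma locally_norm_lt {V : NormedModule R_AbsRing} (v : V) (eps : R) :
  0 < eps -> locally v (fun w => norm (minus w v) < eps).
Proof.
  intros He. apply (locally_le_locally_norm v). exists (mkposreal eps He). intros y Hy. exact Hy.
Qed.

Lemma is_int_iff {V : NormedModule R_AbsRing} (f : R -> V) (v : V) :
  is_int f v <-> forall eps, 0 < eps ->
    at_ends (fun a b => exists w, is_RInt f a b w /\ norm (minus w v) < eps).
Proof.
  split.
  - intros H eps He.
    apply (at_ends_filter (fun ab => exists w, is_RInt f (fst ab) (snd ab) w /\ norm (minus w v) < eps)).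
    apply (H (fun w => norm (minus w v) < eps)).
    apply (locally_norm_lt v); auto.
  - intros H P HP.
    apply locally_norm_le_locally in HP. destruct HP as [eps HP].
    generalize (H eps (cond_pos eps)); intros H1.
    apply at_ends_filter. destruct H1 as (d & Hd & r & H1).
    exists d. split; auto. exists r. intros a b Ha Hb Hr.
    destruct (H1 a b Ha Hb Hr) as (w & Hw & Hw2).
    exists w. split; [exact Hw|]. apply HP. exact Hw2.
Qed.

Lemma is_int_unique {V : CompleteNormedModule R_AbsRing} (f : R -> V) (v w : V) :
  is_int f v -> is_int f w -> v = w.
Proof.
  intros H1 H2.
  rewrite <- (is_RInt_gen_unique _ _ H1), <- (is_RInt_gen_unique _ _ H2). reflexivity.
Qed.

Lemma is_int_ext {V : NormedModule R_AbsRing} (f g : R -> V) (v : V) :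
  (forall s, 0 < s -> f s = g s) -> is_int f v -> is_int g v.
Proof.
  intros H. apply is_RInt_gen_ext; try typeclasses eauto.
  apply at_ends_filter. simpl. apply at_ends_pos. intros a b Ha Hab x.
  rewrite Rmin_left by lra. intros. apply H. lra.
Qed.

Lemma is_int_plus {V : NormedModule R_AbsRing} (f g : R -> V) (v w : V) :
  is_int f v -> is_int g w -> is_int (fun s => plus (f s) (g s)) (plus v w).
Proof. apply is_RInt_gen_plus; typeclasses eauto. Qed.

Lemma is_int_minus {V : NormedModule R_AbsRing} (f g : R -> V) (v w : V) :
  is_int f v -> is_int g w -> is_int (fun s => minus (f s) (g s)) (minus v w).
Proof. apply is_RInt_gen_minus; typeclasses eauto. Qed.

Lemma is_int_scal {V : NormedModule R_AbsRing} (f : R -> V) (c : R) (v : V) :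
  is_int f v -> is_int (fun s => scal c (f s)) (scal c v).
Proof. apply is_RInt_gen_scal; typeclasses eauto. Qed.

Lemma is_int_norm_le {V : CompleteNormedModule R_AbsRing} (f : R -> V) (g : R -> R) v w :
  (forall s, 0 < s -> norm (f s) <= g s) -> is_int f v -> is_int g w -> norm v <= w.
Proof.
  intros H. apply RInt_gen_norm; try typeclasses eauto.
  - apply at_ends_filter; simpl. apply at_ends_pos. intros; lra.
  - apply at_ends_filter; simpl. apply at_ends_pos. intros a b Ha Hb x Hx. apply H. lra.
Qed.

(** Since [g - f] is nonnegative on the half-line, it dominates its own norm; the norm inequality
    then yields |w - v| <= w - v, which forces the sign. *)
Lemma is_int_le (f g : R -> R) (v w : R) :
  (forall s, 0 < s -> f s <= g s) -> is_int f v -> is_int g w -> v <= w.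
Proof.
  intros H Hf Hg.
  assert (Hd := is_int_minus (V := R_NormedModule) g f w v Hg Hf).
  assert (H0 : Rabs (w - v) <= w - v).
  { refine (is_int_norm_le (V := R_CompleteNormedModule) _ _ _ _ _ Hd Hd).
    intros s Hs. change (Rabs (g s - f s) <= g s - f s).
    generalize (H s Hs); intros. rewrite Rabs_pos_eq; lra. }
  generalize (Rabs_pos (w - v)). lra.
Qed.

Lemma is_int_FTC {V : CompleteNormedModule R_AbsRing} (F f : R -> V) (l0 l1 : V) :
  (forall s, 0 < s -> is_derive F s (f s)) -> (forall s, 0 < s -> continuous f s) ->
  filterlim F (at_right 0) (locally l0) -> filterlim F (Rbar_locally p_infty) (locally l1) ->
  is_int f (minus l1 l0).
Proof.
  intros HF Hf H0 H1.
  apply is_int_iff. intros eps He.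
  assert (Hl : filterlim (fun ab => minus (F (snd ab)) (F (fst ab)))
    (filter_prod (at_right 0) (Rbar_locally p_infty)) (locally (minus l1 l0))).
  { unfold minus. apply (filterlim_comp_2 (G := locally l1) (H := locally (opp l0))).
    - apply filterlim_comp with (2 := H1). apply filterlim_snd.
    - apply filterlim_comp with (G := locally l0).
      + apply filterlim_comp with (2 := H0). apply filterlim_fst.
      + apply (filterlim_opp l0).
    - apply (filterlim_plus l1 (opp l0)). }
  assert (Hb := locally_norm_lt (minus l1 l0) eps He).
  specialize (Hl _ Hb). apply at_ends_filter in Hl. simpl in Hl.
  destruct Hl as (d & Hd & r & Hl).
  exists d. split; auto. exists (Rmax r d). intros a b Ha Hda Hrb.
  generalize (Rmax_l r d), (Rmax_r r d); intros.
  exists (minus (F b) (F a)). split; [|apply Hl; lra].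
  apply is_RInt_derive; rewrite Rmin_left, Rmax_right by lra; intros; [apply HF|apply Hf]; lra.
Qed.

Lemma minus_plus_cancel {G : AbelianGroup} (x y z : G) :
  minus (plus x y) (plus z x) = minus y z.
Proof.
  unfold minus. rewrite opp_plus, (plus_comm x y), (plus_comm (opp z) (opp x)), <- plus_assoc.
  rewrite (plus_assoc x (opp x)), plus_opp_r, plus_zero_l. reflexivity.
Qed.

(** Cauchy criterion along the two-ended filter: moving an end point changes the integral of [f] by
    at most the integral of [g] over the swept interval. *)
Lemma ex_int_dominated {V : CompleteNormedModule R_AbsRing} (f : R -> V) (g : R -> R) (G : R) :
  (forall s, 0 < s -> continuous f s) -> (forall s, 0 < s -> continuous g s) ->
  (forall s, 0 < s -> norm (f s) <= g s) -> is_int g G ->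
  exists v, is_int f v.
Proof.
  intros Hf Hg Hfg HG.
  assert (Ef : forall a b, 0 < a -> 0 < b -> ex_RInt f a b).
  { intros a b Ha Hb. apply ex_RInt_continuous. intros z Hz. apply Hf.
    generalize (Rmin_glb_lt a b 0 Ha Hb). lra. }
  assert (Eg : forall a b, 0 < a -> 0 < b -> ex_RInt g a b).
  { intros a b Ha Hb. apply (ex_RInt_continuous (V := R_CompleteNormedModule)). intros z Hz. apply Hg.
    generalize (Rmin_glb_lt a b 0 Ha Hb). lra. }
  assert (Hle : forall a b, 0 < a -> a <= b -> norm (RInt f a b) <= RInt g a b).
  { intros a b Ha Hab. apply (norm_RInt_le f g a b); auto.
    - intros; apply Hfg; lra.
    - apply (RInt_correct f); apply Ef; lra.
    - apply (RInt_correct (V := R_CompleteNormedModule) g); apply Eg; lra. }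
  set (Fl := filter_prod (at_right 0) (Rbar_locally p_infty)).
  destruct (proj1 (filterlim_locally_cauchy (F := Fl) (fun ab => RInt f (fst ab) (snd ab)))) as [l Hl].
  2:{ exists l. apply is_int_iff. intros eps He.
      assert (Hb := locally_norm_lt l eps He).
      specialize (Hl _ Hb). apply at_ends_filter in Hl. simpl in Hl.
      destruct Hl as (d & Hd & r & Hl).
      exists d. split; auto. exists (Rmax r 0). intros a b Ha Hda Hrb.
      generalize (Rmax_l r 0), (Rmax_r r 0); intros.
      exists (RInt f a b). split; [apply (RInt_correct f); apply Ef; lra | apply Hl; lra]. }
  intros eps.
  destruct (proj1 (is_int_iff g G) HG (eps / 4)) as (d & Hd & r & H).
  { generalize (cond_pos eps); lra. }
  exists (fun ab => 0 < fst ab < Rmin d 1 /\ Rmax r 1 < snd ab). split.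
  { apply at_ends_filter. exists (Rmin d 1). split; [apply Rmin_glb_lt; lra|].
    exists (Rmax r 1). intros; simpl; auto. }
  generalize (Rmin_l d 1), (Rmin_r d 1), (Rmax_l r 1), (Rmax_r r 1); intros Hm1 Hm2 Hm3 Hm4.
  intros [a b] [a' b'] [[Ha1 Ha2] Hb] [[Ha'1 Ha'2] Hb']; simpl in *.
  assert (HI : forall a b, 0 < a -> a < Rmin d 1 -> Rmax r 1 < b -> Rabs (RInt g a b - G) < eps / 4).
  { intros u v Hu Hu2 Hv. destruct (H u v) as (w & Hw1 & Hw2); try lra.
    rewrite (is_RInt_unique _ _ _ _ Hw1). exact Hw2. }
  (* Two truncations with the same right end [b] are both within [eps / 4] of [G], so the slice
     between their left ends costs less than [eps / 2]. The upper end is symmetric. *)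
  assert (Hend : forall u v, 0 < u -> u <= v -> v < Rmin d 1 -> RInt g u v < eps / 2).
  { intros u v Hu Huv Hv.
    generalize (HI u b Hu ltac:(lra) Hb), (HI v b ltac:(lra) Hv Hb).
    assert (E : RInt g u b = RInt g u v + RInt g v b).
    { symmetry. apply (RInt_Chasles (V := R_CompleteNormedModule) g u v b); apply Eg; lra. }
    rewrite E. intros E1 E2. apply Rabs_def2 in E1. apply Rabs_def2 in E2. lra. }
  assert (Hend2 : forall u v, Rmax r 1 < u -> u <= v -> RInt g u v < eps / 2).
  { intros u v Hu Huv.
    generalize (HI a u Ha1 ltac:(lra) Hu), (HI a v Ha1 Ha2 ltac:(lra)).
    assert (E : RInt g a v = RInt g a u + RInt g u v).
    { symmetry. apply (RInt_Chasles (V := R_CompleteNormedModule) g a u v); apply Eg; lra. }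
    rewrite E. intros E1 E2. apply Rabs_def2 in E1. apply Rabs_def2 in E2. lra. }
  assert (B1 : norm (RInt f a a') < eps / 2).
  { destruct (Rle_dec a a').
    - eapply Rle_lt_trans; [apply Hle; lra|]. apply Hend; lra.
    - apply Rle_lt_trans with (norm (RInt f a' a)); [|eapply Rle_lt_trans; [apply Hle; lra|]; apply Hend; lra].
      rewrite <- (opp_RInt_swap f a' a) by (apply Ef; lra). apply Req_le. exact (norm_opp (RInt f a' a)). }
  assert (B2 : norm (RInt f b b') < eps / 2).
  { destruct (Rle_dec b b').
    - eapply Rle_lt_trans; [apply Hle; lra|]. apply Hend2; lra.
    - apply Rle_lt_trans with (norm (RInt f b' b)); [|eapply Rle_lt_trans; [apply Hle; lra|]; apply Hend2; lra].
      rewrite <- (opp_RInt_swap f b' b) by (apply Ef; lra). apply Req_le. exact (norm_opp (RInt f b' b)). }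
  apply (norm_compat1 (V := V) (RInt f a b) (RInt f a' b') eps).
  rewrite <- (RInt_Chasles f a a' b) by (apply Ef; lra).
  rewrite <- (RInt_Chasles f a' b b') by (apply Ef; lra).
  eapply Rle_lt_trans; [apply Req_le; exact (f_equal norm (minus_plus_cancel (RInt f a' b) (RInt f b b') (RInt f a a')))|].
  eapply Rle_lt_trans; [exact (norm_triangle (RInt f b b') (opp (RInt f a a')))|].
  apply Rlt_le_trans with (eps / 2 + eps / 2); [|lra].
  apply Rplus_lt_compat; [exact B2|].
  eapply Rle_lt_trans; [apply Req_le; exact (norm_opp (RInt f a a')) | exact B1].
Qed.

Lemma is_RInt_linear {U V : NormedModule R_AbsRing} (L : U -> V) (f : R -> U) a b v :
  is_linear L -> is_RInt f a b v -> is_RInt (fun s => L (f s)) a b (L v).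
Proof.
  intros HL H. unfold is_RInt in *.
  apply filterlim_ext with (fun ptd => L (scal (sign (b - a)) (Riemann_sum f ptd))).
  - intros ptd. etransitivity; [exact (linear_scal L HL _ _)|]. f_equal.
    unfold Riemann_sum. generalize (SF_t ptd).
    match goal with |- context [seq.pairmap _ ?p _] => generalize p end.
    intros p l; revert p.
    induction l as [|c l IH]; intros p; simpl.
    + exact (linear_zero L HL).
    + etransitivity; [exact (linear_plus L HL _ _)|]. f_equal; [exact (linear_scal L HL _ _)|apply IH].
  - apply filterlim_comp with (1 := H). apply (linear_cont L v HL).
Qed.

Lemma is_int_linear {U V : NormedModule R_AbsRing} (L : U -> V) (f : R -> U) v :
  is_linear L -> is_int f v -> is_int (fun s => L (f s)) (L v).
Proof.
  intros HL H. apply is_int_iff. intros eps He.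
  destruct (linear_norm L HL) as (K & HK & HN).
  destruct (proj1 (is_int_iff f v) H (eps / K)) as (d & Hd & r & H1).
  { apply Rdiv_lt_0_compat; auto. }
  exists d. split; auto. exists r. intros a b Ha Hb Hr.
  destruct (H1 a b Ha Hb Hr) as (w & Hw1 & Hw2).
  exists (L w). split; [apply is_RInt_linear; auto|].
  unfold minus. rewrite <- (linear_opp L v HL), <- (linear_plus L HL).
  eapply Rle_lt_trans; [apply HN|].
  apply Rmult_lt_compat_l with (r := K) in Hw2; auto.
  replace (K * (eps / K)) with eps in Hw2 by (field; lra). exact Hw2.
Qed.

(** * Banach spaces as complete normed modules *)

Section BanachAsNormedModule.
Variable X : BanachSpace.

Definition banach_AbelianMonoid_mixin : AbelianMonoid.mixin_of X :=
  AbelianMonoid.Mixin X vadd vzero (vadd_comm X) (vadd_assoc X) (vadd_0 X).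
Canonical banach_AbelianMonoid := AbelianMonoid.Pack X banach_AbelianMonoid_mixin X.
Definition banach_AbelianGroup_mixin :=
  AbelianGroup.Mixin banach_AbelianMonoid vopp (vadd_opp X).
Canonical banach_AbelianGroup :=
  AbelianGroup.Pack X (AbelianGroup.Class X _ banach_AbelianGroup_mixin) X.
Definition banach_ModuleSpace_mixin : ModuleSpace.mixin_of R_Ring banach_AbelianGroup :=
  ModuleSpace.Mixin R_Ring banach_AbelianGroup vscal (vscal_assoc X) (vscal_1 X) (vscal_distr_l X)
    (vscal_distr_r X).
Canonical banach_ModuleSpace :=
  ModuleSpace.Pack R_Ring X (ModuleSpace.Class R_Ring X _ banach_ModuleSpace_mixin) X.

Lemma vnorm_opp (x : X) : vnorm (vopp x) = vnorm x.
Proof.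
  generalize (scal_opp_one (V := banach_ModuleSpace) x). intros E.
  change (vscal (- (1)) x = vopp x) in E. rewrite <- E, vnorm_scal.
  rewrite Rabs_Ropp, Rabs_R1. ring.
Qed.

Lemma vnorm_zero : vnorm (vzero : X) = 0.
Proof.
  generalize (scal_zero_l (V := banach_ModuleSpace) (vzero : X)). intros E.
  change (vscal 0 (vzero : X) = vzero) in E. rewrite <- E, vnorm_scal, Rabs_R0. ring.
Qed.

Lemma vsub_self (x : X) : vsub x x = vzero.
Proof. apply vadd_opp. Qed.

Lemma vsub_anti (x y : X) : vnorm (vsub x y) = vnorm (vsub y x).
Proof.
  rewrite <- vnorm_opp. f_equal. exact (opp_minus (G := banach_AbelianGroup) x y).
Qed.

Lemma vsub_triangle (x y z : X) : vnorm (vsub x z) <= vnorm (vsub x y) + vnorm (vsub y z).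
Proof.
  replace (vsub x z) with (vadd (vsub x y) (vsub y z)); [apply vnorm_triangle|].
  symmetry; exact (minus_trans (G := banach_AbelianGroup) y x z).
Qed.

Definition banach_ball (x : X) (eps : R) (y : X) : Prop := vnorm (vsub y x) < eps.

Lemma banach_ball_center (x : X) (e : posreal) : banach_ball x e x.
Proof. unfold banach_ball. rewrite vsub_self, vnorm_zero. apply cond_pos. Qed.

Lemma banach_ball_sym (x y : X) (e : R) : banach_ball x e y -> banach_ball y e x.
Proof. unfold banach_ball. rewrite vsub_anti. auto. Qed.

Lemma banach_ball_triangle (x y z : X) (e1 e2 : R) :
  banach_ball x e1 y -> banach_ball y e2 z -> banach_ball x (e1 + e2) z.
Proof. unfold banach_ball. generalize (vsub_triangle z y x). lra. Qed.

Definition banach_UniformSpace_mixin : UniformSpace.mixin_of X :=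
  UniformSpace.Mixin X vzero banach_ball banach_ball_center banach_ball_sym banach_ball_triangle.
Canonical banach_UniformSpace := UniformSpace.Pack X banach_UniformSpace_mixin X.

Canonical banach_NormedModuleAux :=
  NormedModuleAux.Pack R_AbsRing X
    (NormedModuleAux.Class R_AbsRing X (ModuleSpace.class _ banach_ModuleSpace) banach_UniformSpace_mixin) X.

Lemma banach_norm_scal (l : R) (x : X) : vnorm (vscal l x) <= Rabs l * vnorm x.
Proof. rewrite vnorm_scal. lra. Qed.

Lemma banach_norm_ball1 (x y : X) (eps : R) : vnorm (vsub y x) < eps -> banach_ball x eps y.
Proof. auto. Qed.

Lemma banach_norm_ball2 (x y : X) (eps : posreal) :
  banach_ball x eps y -> vnorm (vsub y x) < 1 * eps.
Proof. rewrite Rmult_1_l. auto. Qed.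

Definition banach_NormedModule_mixin : NormedModule.mixin_of R_AbsRing banach_NormedModuleAux :=
  NormedModule.Mixin R_AbsRing banach_NormedModuleAux vnorm 1 (vnorm_triangle X) banach_norm_scal
    banach_norm_ball1 banach_norm_ball2 (vnorm_eq0 X).
Canonical banach_NormedModule :=
  NormedModule.Pack R_AbsRing X (NormedModule.Class R_AbsRing X _ banach_NormedModule_mixin) X.

(** A complete space of the canonical hierarchy carries a total limit operator on filters, whereas
    [vcomplete] only asserts existence, and only for sequences. Hence the choice operator, with
    [vzero] as witness of inhabitation. *)
Definition banach_lim (F : (X -> Prop) -> Prop) : X :=
  epsilon (inhabits vzero) (fun l => forall eps : posreal, F (banach_ball l eps)).

Lemma banach_lim_correct (F : (X -> Prop) -> Prop) :
  ProperFilter F -> cauchy (T := banach_UniformSpace) F ->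
  forall eps : posreal, F (banach_ball (banach_lim F) eps).
Proof.
  intros PF HF. unfold banach_lim. apply epsilon_spec.
  (* One centre is chosen for each radius 1/(n+1). Any two of these balls meet, a proper filter
     having no empty member, so the centres form a Cauchy sequence. *)
  assert (Hex : forall n : nat, exists x : X, F (banach_ball x (/ (INR n + 1)))).
  { intros n. assert (Hn : 0 < / (INR n + 1)) by (apply Rinv_0_lt_compat; generalize (pos_INR n); lra).
    exact (HF (mkposreal _ Hn)). }
  pose (u := fun n => proj1_sig (constructive_indefinite_description _ (Hex n))).
  assert (Hu : forall n, F (banach_ball (u n) (/ (INR n + 1)))).
  { intros n. apply (proj2_sig (constructive_indefinite_description _ (Hex n))). }
  assert (Hsmall : forall eps, 0 < eps -> exists N, forall n, (N <= n)%nat -> / (INR n + 1) < eps).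
  { intros eps He. destruct (nfloor_ex (/ eps)) as [N [_ HN]].
    { apply Rlt_le, Rinv_0_lt_compat; auto. }
    exists N. intros n Hn. apply le_INR in Hn.
    rewrite <- (Rinv_inv eps). apply Rinv_lt_contravar; [|lra].
    apply Rmult_lt_0_compat; [apply Rinv_0_lt_compat; auto|]. generalize (pos_INR n); lra. }
  destruct (vcomplete X u) as [l Hl].
  { intros eps He. destruct (Hsmall (eps / 2)) as [N HN]; [lra|].
    exists N. intros m n Hm Hn.
    destruct (filter_ex _ (filter_and _ _ (Hu m) (Hu n))) as [y [H1 H2]].
    change (vnorm (vsub (u m) (u n)) < eps).
    generalize (vsub_triangle (u m) y (u n)), (HN m Hm), (HN n Hn).
    unfold banach_ball in H1, H2. rewrite (vsub_anti (u m) y). lra. }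
  exists l. intros eps.
  assert (He2 : 0 < eps / 2) by (generalize (cond_pos eps); lra).
  destruct (Hsmall (eps / 2) He2) as [N1 HN1].
  destruct (Hl (eps / 2) He2) as [N2 HN2].
  specialize (HN1 (max N1 N2) (Nat.le_max_l _ _)). specialize (HN2 (max N1 N2) (Nat.le_max_r _ _)).
  generalize (Hu (max N1 N2)). apply filter_imp. intros y Hy. unfold banach_ball in *.
  generalize (vsub_triangle y (u (max N1 N2)) l).
  change (vnorm (vsub (u (max N1 N2)) l) < eps / 2) in HN2. lra.
Qed.

(** Mutually finer filters are equal by extensionality, so the chosen limits coincide outright. *)
Lemma banach_lim_close (F1 F2 : (X -> Prop) -> Prop) :
  filter_le F1 F2 -> filter_le F2 F1 ->
  close (M := banach_UniformSpace) (banach_lim F1) (banach_lim F2).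
Proof.
  intros H1 H2. replace F2 with F1; [intros eps; apply ball_center|].
  apply functional_extensionality. intros P. apply propositional_extensionality. split; auto.
Qed.

Definition banach_CompleteSpace_mixin : CompleteSpace.mixin_of banach_UniformSpace :=
  CompleteSpace.Mixin banach_UniformSpace banach_lim banach_lim_correct banach_lim_close.
Canonical banach_CompleteSpace :=
  CompleteSpace.Pack X (CompleteSpace.Class X _ banach_CompleteSpace_mixin) X.
Canonical banach_CompleteNormedModule :=
  CompleteNormedModule.Pack R_AbsRing X
    (CompleteNormedModule.Class R_AbsRing X (NormedModule.class _ banach_NormedModule)
       banach_CompleteSpace_mixin) X.

End BanachAsNormedModule.

(** * From filter-based integrals to the Riemann sums of the statement *)

Lemma sum_n_shift {G : AbelianMonoid} (u : nat -> G) (n : nat) :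
  sum_n u (S n) = plus (u 0%nat) (sum_n (fun j => u (S j)) n).
Proof.
  induction n as [|n IH].
  - rewrite sum_Sn, !sum_O. reflexivity.
  - rewrite sum_Sn, IH, sum_Sn, plus_assoc. reflexivity.
Qed.

(** [unif_part a b n] has n + 1 cells, whence [S n], and the tag rule [fun x _ => x] selects left
    end points: these are the sample points of [vriemann] and [rriemann]. *)
Lemma Riemann_sum_unif_part {V : ModuleSpace R_Ring} (f : R -> V) (a b : R) (n : nat) :
  Riemann_sum f (SF_seq_f2 (fun x _ => x) (unif_part a b n)) =
  scal ((b - a) / INR (S n)) (sum_n (fun i => f (a + INR i * (b - a) / INR (S n))) n).
Proof.
  unfold SF_seq_f2, unif_part, Riemann_sum, seq.mkseq. rewrite S_INR. cbn [seq.map seq.iota SF_h SF_t seq.head seq.behead].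
  set (g := fun i : nat => a + INR i * (b - a) / (INR n + 1)).
  change (a + INR 0 * (b - a) / (INR n + 1)) with (g 0%nat).
  match goal with |- context [seq.pairmap _ (_, ?z) _] => generalize z end.
  assert (Hg : forall i, g (S i) - g i = (b - a) / (INR n + 1)).
  { intros i. unfold g. rewrite S_INR. field. generalize (pos_INR n); lra. }
  (* [seq.pairmap] threads the previous element along the list, so the induction must let both the
     starting index and the tag of the seed pair vary. *)
  assert (H : forall k i z, seq.foldr plus zero
     (seq.pairmap (fun x y : R * R => scal (fst y - fst x) (f (snd y))) (g i, z)
     (seq.pairmap (fun x y : R => (y, x)) (g i) (seq.map g (seq.iota (S i) (S k))))) =
     scal ((b - a) / (INR n + 1)) (sum_n (fun j => f (g (i + j)%nat)) k)).
  { induction k as [|k IH]; intros i z.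
    - cbn [seq.iota seq.map seq.pairmap seq.foldr fst snd]. rewrite Hg, sum_O, plus_zero_r, Nat.add_0_r. reflexivity.
    - change (seq.iota (S i) (S (S k))) with (cons (S i) (seq.iota (S (S i)) (S k))).
      cbn [seq.map seq.pairmap seq.foldr fst snd]. rewrite (IH (S i)), Hg, sum_n_shift, scal_distr_l, Nat.add_0_r.
      f_equal. f_equal. apply sum_n_ext. intros j. f_equal. f_equal. lia. }
  intros z. exact (H n 0%nat z).
Qed.

Lemma is_RInt_unif_part {V : NormedModule R_AbsRing} (f : R -> V) (a b : R) (v : V) :
  a < b -> is_RInt f a b v -> forall eps, 0 < eps -> exists N0, forall n, (N0 <= n)%nat ->
    norm (minus (scal ((b - a) / INR (S n)) (sum_n (fun i => f (a + INR i * (b - a) / INR (S n))) n)) v) < eps.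
Proof.
  intros Hab H eps He.
  destruct (H _ (locally_norm_lt v eps He)) as [d Hd].
  destruct (nfloor_ex ((b - a) / d)) as [N [_ HN]].
  { apply Rlt_le, Rdiv_lt_0_compat; [lra|apply cond_pos]. }
  exists N. intros n Hn.
  refine (eq_ind _ (fun w : V => norm (minus w v) < eps) _ _ (Riemann_sum_unif_part f a b n)).
  destruct (Riemann_fine_unif_part (fun x _ => x) a b n) as (H1 & H2 & H3 & H4); [intros; lra | lra |].
  specialize (Hd (SF_seq_f2 (fun x _ => x) (unif_part a b n))).
  rewrite sign_eq_1 in Hd by lra.
  refine (eq_ind _ (fun w : V => norm (minus w v) < eps) _ _ (scal_one _)).
  apply Hd.
  - eapply Rle_lt_trans; [apply H1|].
    apply le_INR in Hn. generalize (cond_pos d); intros Hdp. generalize (pos_INR n); intros.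
    apply Rmult_lt_reg_r with (INR n + 1); [lra|].
    unfold Rdiv. rewrite Rmult_assoc, Rinv_l, Rmult_1_r by lra.
    apply Rmult_lt_compat_r with (r := d) in HN; auto.
    unfold Rdiv in HN. rewrite Rmult_assoc, Rinv_l, Rmult_1_r in HN by lra.
    eapply Rlt_le_trans; [exact HN|]. rewrite Rmult_comm. apply Rmult_le_compat_l; lra.
  - rewrite Rmin_left, Rmax_right by lra. auto.
Qed.

Lemma vsum_lt_sum_n {X : BanachSpace} (g : nat -> X) (n : nat) : vsum_lt g (S n) = sum_n g n.
Proof.
  induction n as [|n IH].
  - simpl. rewrite sum_O. exact (plus_zero_l (g 0%nat)).
  - rewrite sum_Sn, <- IH. reflexivity.
Qed.

Lemma is_RInt_vint_ab {X : BanachSpace} (f : R -> X) (a b : R) (v : X) :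
  a < b -> is_RInt f a b v -> vint_ab f a b v.
Proof.
  intros Hab H eps He.
  destruct (is_RInt_unif_part f a b v Hab H eps He) as [N0 HN].
  exists (S N0). intros [|n] Hn Hn1; [lia|].
  unfold vriemann. rewrite vsum_lt_sum_n. apply HN. lia.
Qed.

Lemma is_RInt_rint_ab (f : R -> R) (a b : R) (v : R) :
  a < b -> is_RInt f a b v -> rint_ab f a b v.
Proof.
  intros Hab H eps He.
  destruct (is_RInt_unif_part (V := R_NormedModule) f a b v Hab H eps He) as [N0 HN].
  exists (S N0). intros [|n] Hn Hn1; [lia|].
  unfold rriemann. cbn [Nat.pred]. rewrite <- sum_n_Reals. apply HN. lia.
Qed.

Lemma is_int_vint_0inf {X : BanachSpace} (f : R -> X) (v : X) : is_int f v -> vint_0inf f v.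
Proof.
  intros H eps He. destruct (proj1 (is_int_iff f v) H eps He) as (d & Hd & r & H1).
  exists d. split; auto. exists (Rmax r d). intros a b Ha Hda Hb.
  generalize (Rmax_l r d), (Rmax_r r d); intros.
  destruct (H1 a b) as (w & Hw1 & Hw2); try lra.
  exists w. split; [apply is_RInt_vint_ab; auto; lra | exact Hw2].
Qed.

Lemma is_int_rint_0inf (f : R -> R) (v : R) : is_int f v -> rint_0inf f v.
Proof.
  intros H eps He. destruct (proj1 (is_int_iff f v) H eps He) as (d & Hd & r & H1).
  exists d. split; auto. exists (Rmax r d). intros a b Ha Hda Hb.
  generalize (Rmax_l r d), (Rmax_r r d); intros.
  destruct (H1 a b) as (w & Hw1 & Hw2); try lra.
  exists w. split; [apply is_RInt_rint_ab; auto; lra | exact Hw2].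
Qed.

(** * Reflection for linear identities between vectors *)

Inductive vexp : Type :=
| VAtom (n : nat) | VZero | VAdd (e f : vexp) | VOpp (e : vexp) | VSub (e f : vexp) | VScal (r : R) (e : vexp).

Section VectorReflection.
Variable X : BanachSpace.

Fixpoint veval (env : list X) (e : vexp) : X :=
  match e with
  | VAtom n => nth n env vzero
  | VZero => vzero
  | VAdd e f => vadd (veval env e) (veval env f)
  | VOpp e => vopp (veval env e)
  | VSub e f => vsub (veval env e) (veval env f)
  | VScal r e => vscal r (veval env e)
  end.

Fixpoint vcoef (e : vexp) (i : nat) : R :=
  match e with
  | VAtom n => if Nat.eqb n i then 1 else 0
  | VZero => 0
  | VAdd e f => vcoef e i + vcoef f i
  | VOpp e => - vcoef e i
  | VSub e f => vcoef e i - vcoef f i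
  | VScal r e => r * vcoef e i
  end.

Fixpoint vcomb (c : nat -> R) (env : list X) : X :=
  match env with
  | nil => vzero
  | x :: l => vadd (vscal (c 0%nat) x) (vcomb (fun i => c (S i)) l)
  end.

Lemma vscal_0 (x : X) : vscal 0 x = vzero.
Proof. exact (scal_zero_l (V := banach_ModuleSpace X) x). Qed.

Lemma vscal_vzero (r : R) : vscal r (vzero : X) = vzero.
Proof. exact (scal_zero_r (V := banach_ModuleSpace X) r). Qed.

Lemma vscal_opp1 (x : X) : vscal (-1) x = vopp x.
Proof. exact (scal_opp_one (V := banach_ModuleSpace X) x). Qed.

Lemma vcomb_ext (c d : nat -> R) (env : list X) :
  (forall i, (i < length env)%nat -> c i = d i) -> vcomb c env = vcomb d env.
Proof.
  revert c d. induction env as [|x l IH]; intros c d H; simpl; auto.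
  rewrite (H 0%nat) by (simpl; lia). f_equal. apply IH. intros i Hi. apply H. simpl. lia.
Qed.

Lemma vcomb_add (c d : nat -> R) (env : list X) :
  vcomb (fun i => c i + d i) env = vadd (vcomb c env) (vcomb d env).
Proof.
  revert c d. induction env as [|x l IH]; intros c d; simpl.
  - symmetry. apply vadd_0.
  - rewrite (IH (fun i => c (S i)) (fun i => d (S i))), vscal_distr_r, !vadd_assoc. f_equal.
    rewrite <- !vadd_assoc. f_equal. apply vadd_comm.
Qed.

Lemma vcomb_scal (r : R) (c : nat -> R) (env : list X) :
  vcomb (fun i => r * c i) env = vscal r (vcomb c env).
Proof.
  revert c. induction env as [|x l IH]; intros c; simpl.
  - symmetry. apply vscal_vzero.
  - rewrite (IH (fun i => c (S i))), vscal_distr_l, vscal_assoc. reflexivity.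
Qed.

Lemma vcomb_zero (env : list X) : vcomb (fun _ => 0) env = vzero.
Proof. induction env as [|x l IH]; simpl; auto. rewrite IH, vscal_0. apply vadd_0. Qed.

Lemma vcomb_atom (n : nat) (env : list X) :
  vcomb (fun i => if Nat.eqb n i then 1 else 0) env = nth n env vzero.
Proof.
  revert n. induction env as [|x l IH]; intros n; simpl.
  - destruct n; reflexivity.
  - destruct n as [|n]; simpl.
    + rewrite vcomb_zero, vscal_1. apply vadd_0.
    + rewrite IH, vscal_0, vadd_comm. apply vadd_0.
Qed.

Lemma veval_comb (env : list X) (e : vexp) : veval env e = vcomb (vcoef e) env.
Proof.
  induction e as [n | | e1 IH1 e2 IH2 | e IH | e1 IH1 e2 IH2 | r e IH]; simpl.
  - symmetry. apply vcomb_atom.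
  - symmetry. apply vcomb_zero.
  - rewrite IH1, IH2. symmetry. apply vcomb_add.
  - rewrite IH, <- vscal_opp1, <- vcomb_scal. apply vcomb_ext. intros; ring.
  - unfold vsub. rewrite IH1, IH2, <- vscal_opp1, <- vcomb_scal, <- vcomb_add. apply vcomb_ext. intros; ring.
  - rewrite IH. symmetry. apply vcomb_scal.
Qed.

Fixpoint all_lt (P : nat -> Prop) (n : nat) : Prop :=
  match n with 0%nat => True | S k => P k /\ all_lt P k end.

(** Scalars are kept as real terms and not as syntax, so after computation one real equation per
    atom remains, ready for [ring] or [field]. *)
Lemma veval_eq (env : list X) (e f : vexp) :
  all_lt (fun i => vcoef e i = vcoef f i) (length env) -> veval env e = veval env f.
Proof.
  intros H. rewrite !veval_comb. apply vcomb_ext.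
  induction (length env) as [|n IH]; intros i Hi; [lia|].
  destruct H as [H1 H2]. destruct (Nat.eq_dec i n) as [->|]; auto. apply IH; auto. lia.
Qed.
End VectorReflection.

Ltac vindex x l :=
  match l with
  | x :: _ => constr:(0%nat)
  | _ :: ?l' => let n := vindex x l' in constr:(S n)
  end.
Ltac vadd_atom x l :=
  match l with
  | context [x :: _] => l
  | _ => constr:(x :: l)
  end.
Ltac vatoms e l :=
  lazymatch e with
  | vadd ?a ?b => let l1 := vatoms a l in vatoms b l1
  | vsub ?a ?b => let l1 := vatoms a l in vatoms b l1
  | vopp ?a => vatoms a l
  | vscal _ ?a => vatoms a l
  | vzero => l
  | _ => vadd_atom e l
  end.
Ltac vreify e l :=
  lazymatch e with
  | vadd ?a ?b => let x := vreify a l in let y := vreify b l in constr:(VAdd x y)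
  | vsub ?a ?b => let x := vreify a l in let y := vreify b l in constr:(VSub x y)
  | vopp ?a => let x := vreify a l in constr:(VOpp x)
  | vscal ?r ?a => let x := vreify a l in constr:(VScal r x)
  | vzero => constr:(VZero)
  | _ => let n := vindex e l in constr:(VAtom n)
  end.
(* Reduces an equation between linear combinations of vectors to the equality of coefficients. *)
Ltac vec_coeffs :=
  match goal with
  | |- @eq ?T ?a ?b =>
    let X := match T with carrier ?X => X end in
    let l0 := vatoms a (@nil (carrier X)) in
    let l := vatoms b l0 in
    let ea := vreify a l in let eb := vreify b l in
    change (veval X l ea = veval X l eb); apply veval_eq; simpl; repeat split
  end.
Ltac vec := vec_coeffs; try ring.

(** * Laguerre polynomials *)

Lemma gbinom_absorb (a : R) (m : nat) : gbinom (a + 1) (S m) = (a + 1) / INR (S m) * gbinom a m.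
Proof.
  induction m as [|m IH].
  - simpl. field.
  - change (gbinom (a + 1) (S (S m))) with (gbinom (a + 1) (S m) * (a + 1 - INR (S m)) / INR (S (S m))).
    rewrite IH.
    change (gbinom a (S m)) with (gbinom a m * (a - INR m) / INR (S m)).
    rewrite !S_INR. generalize (pos_INR m); intros. field. lra.
Qed.

Lemma gbinom_pascal (a : R) (m : nat) : gbinom (a + 1) (S m) = gbinom a (S m) + gbinom a m.
Proof.
  rewrite gbinom_absorb.
  change (gbinom a (S m)) with (gbinom a m * (a - INR m) / INR (S m)).
  rewrite !S_INR. generalize (pos_INR m); intros. field. lra.
Qed.

Definition lag_coef (n : nat) (b : R) (k : nat) : R :=
  (-1) ^ k * gbinom (INR n + b) (n - k) / INR (fact k).

Lemma Laguerre_coef (n : nat) (b t : R) :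
  Laguerre n b t = sum_f_R0 (fun k => lag_coef n b k * t ^ k) n.
Proof.
  unfold Laguerre. apply sum_eq. intros k Hk. unfold lag_coef. field. apply INR_fact_neq_0.
Qed.

Definition Laguerre' (n : nat) (b t : R) : R :=
  match n with 0%nat => 0 | S j => - Laguerre j (b + 1) t end.

Lemma lag_coef_S (n : nat) (b : R) (k : nat) :
  INR (S k) * lag_coef (S n) b (S k) = - lag_coef n (b + 1) k.
Proof.
  unfold lag_coef. rewrite fact_simpl, mult_INR, !S_INR.
  replace (INR n + 1 + b) with (INR n + (b + 1)) by ring.
  change (S n - S k)%nat with (n - k)%nat. simpl pow.
  generalize (INR_fact_neq_0 k), (pos_INR k); intros. field. split; auto; lra.
Qed.

Lemma is_derive_poly (a : nat -> R) (n : nat) (t : R) :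
  is_derive (fun t => sum_f_R0 (fun k => a k * t ^ k) n) t
    (sum_f_R0 (fun k => INR k * a k * t ^ (pred k)) n).
Proof.
  assert (H : forall k, is_derive (fun t => a k * t ^ k) t (INR k * a k * t ^ (pred k))).
  { intros k. auto_derive; auto. ring. }
  induction n as [|n IH]; cbn [sum_f_R0]; [apply H|].
  apply (is_derive_plus (V := R_NormedModule)); [exact IH | apply H].
Qed.

Lemma sum_f_R0_shift (u : nat -> R) (n : nat) :
  sum_f_R0 u (S n) = u 0%nat + sum_f_R0 (fun k => u (S k)) n.
Proof. rewrite decomp_sum by lia. reflexivity. Qed.

Lemma Laguerre'_sum (n : nat) (b t : R) :
  Laguerre' n b t = sum_f_R0 (fun k => INR k * lag_coef n b k * t ^ (pred k)) n.
Proof.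
  destruct n as [|n].
  - simpl. ring.
  - rewrite sum_f_R0_shift. cbn [INR Nat.pred]. unfold Laguerre'. rewrite Laguerre_coef.
    rewrite <- (Rmult_1_l (sum_f_R0 (fun k => lag_coef n (b + 1) k * t ^ k) n)), Ropp_mult_distr_l.
    rewrite scal_sum. rewrite !Rmult_0_l, Rplus_0_l.
    apply sum_eq. intros k Hk. change (match k with 0%nat => 1 | S _ => INR k + 1 end) with (INR (S k)).
    rewrite lag_coef_S. ring.
Qed.

Lemma is_derive_Laguerre (n : nat) (b t : R) : is_derive (Laguerre n b) t (Laguerre' n b t).
Proof.
  rewrite Laguerre'_sum.
  apply is_derive_ext with (fun t => sum_f_R0 (fun k => lag_coef n b k * t ^ k) n).
  - intros; symmetry; apply Laguerre_coef.
  - apply is_derive_poly.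
Qed.

Lemma lag_coef_rodrigues (k : nat) (b : R) (j : nat) : (j <= k)%nat ->
  INR (S k) * lag_coef (S k) b j =
  (b + 1 + INR j) * lag_coef k (b + 1) j - match j with 0%nat => 0 | S i => lag_coef k (b + 1) i end.
Proof.
  intros Hj.
  assert (E : (INR (S k) - INR j) * lag_coef (S k) b j = (b + 1 + INR j) * lag_coef k (b + 1) j).
  { unfold lag_coef. replace (S k - j)%nat with (S (k - j))%nat by lia.
    cbn [gbinom]. rewrite !S_INR, minus_INR by lia.
    replace (INR k + 1 + b) with (INR k + (b + 1)) by ring.
    apply le_INR in Hj. generalize (INR_fact_neq_0 j); intros. field. split; auto; lra. }
  destruct j as [|i].
  - simpl INR in *. lra.
  - generalize (lag_coef_S k b i). lra.
Qed.

(** Multiplied by t^b e^(-t), the left side is the derivative of t^(b+1) e^(-t) L_k^(b+1)(t): one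
    step of Rodrigues' formula, raising the degree and lowering the parameter. *)
Lemma Laguerre_rodrigues (k : nat) (b t : R) :
  (b + 1 - t) * Laguerre k (b + 1) t + t * Laguerre' k (b + 1) t = INR (S k) * Laguerre (S k) b t.
Proof.
  rewrite Laguerre'_sum, !Laguerre_coef.
  (* Truncating all sums at degree [N] leaves a single boundary term; at N = k it is matched by the
     leading coefficient of L_(k+1)^b, through [lag_coef_S]. *)
  assert (H : forall N, (N <= k)%nat ->
    (b + 1 - t) * sum_f_R0 (fun j => lag_coef k (b + 1) j * t ^ j) N +
    t * sum_f_R0 (fun j => INR j * lag_coef k (b + 1) j * t ^ (pred j)) N =
    INR (S k) * sum_f_R0 (fun j => lag_coef (S k) b j * t ^ j) N - lag_coef k (b + 1) N * t ^ (S N)).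
  { induction N as [|N IH]; intros HN.
    - cbn [sum_f_R0 pow Nat.pred]. generalize (lag_coef_rodrigues k b 0 HN). simpl (INR 0). lra.
    - cbn [sum_f_R0]. specialize (IH ltac:(lia)).
      generalize (lag_coef_rodrigues k b (S N) HN). intros E.
      replace (INR (S k) * (sum_f_R0 (fun j => lag_coef (S k) b j * t ^ j) N +
        lag_coef (S k) b (S N) * t ^ S N)) with
        (INR (S k) * sum_f_R0 (fun j => lag_coef (S k) b j * t ^ j) N +
         (INR (S k) * lag_coef (S k) b (S N)) * t ^ S N) by ring.
      rewrite E. cbn [Nat.pred]. simpl pow in *. lra. }
  rewrite (H k) by lia. cbn [sum_f_R0].
  replace (INR (S k) * (sum_f_R0 (fun j => lag_coef (S k) b j * t ^ j) k +
        lag_coef (S k) b (S k) * t ^ S k)) with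
        (INR (S k) * sum_f_R0 (fun j => lag_coef (S k) b j * t ^ j) k +
         (INR (S k) * lag_coef (S k) b (S k)) * t ^ S k) by ring.
  rewrite lag_coef_S. ring.
Qed.

Lemma Laguerre_0 (b t : R) : Laguerre 0 b t = 1.
Proof. unfold Laguerre; simpl. field. Qed.

Lemma Laguerre_pascal (n : nat) (b t : R) :
  Laguerre (S n) b t = Laguerre (S n) (b + 1) t - Laguerre n (b + 1) t.
Proof.
  rewrite !Laguerre_coef. cbn [sum_f_R0].
  replace (lag_coef (S n) (b + 1) (S n)) with (lag_coef (S n) b (S n))
    by (unfold lag_coef; rewrite Nat.sub_diag; reflexivity).
  replace (sum_f_R0 (fun k => lag_coef (S n) b k * t ^ k) n) with
    (sum_f_R0 (fun k => lag_coef (S n) (b + 1) k * t ^ k) n - sum_f_R0 (fun k => lag_coef n (b + 1) k * t ^ k) n);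
    [ring|].
  rewrite <- minus_sum. apply sum_eq. intros k Hk.
  replace (lag_coef (S n) (b + 1) k) with (lag_coef (S n) b k + lag_coef n (b + 1) k); [ring|].
  unfold lag_coef. replace (S n - k)%nat with (S (n - k)) by lia.
  replace (INR (S n) + (b + 1)) with (INR (S n) + b + 1) by ring. rewrite gbinom_pascal.
  replace (INR n + (b + 1)) with (INR (S n) + b) by (rewrite S_INR; ring).
  field. apply INR_fact_neq_0.
Qed.

(** Rodrigues' identity at [b] contains the derivative -L_n^(b+2), and t times this is the induction
    hypothesis at [b + 1]; [b] is therefore quantified inside the induction. *)
Lemma Laguerre_raise (n : nat) : forall (b t : R),
  t * Laguerre n (b + 1) t = (INR n + 1 + b) * Laguerre n b t - INR (S n) * Laguerre (S n) b t.
Proof.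
  induction n as [|n IH]; intros b t.
  - rewrite <- Laguerre_rodrigues. rewrite !Laguerre_0. simpl. ring.
  - rewrite <- Laguerre_rodrigues. cbn [Laguerre'].
    generalize (IH (b + 1) t). intros E. rewrite (Laguerre_pascal n b t). rewrite !S_INR in *. lra.
Qed.

(** The parameter [b + 1] is eliminated between two consecutive raising identities and the Pascal
    identity. *)
Lemma Laguerre_recurrence (n : nat) (b t : R) :
  INR (S (S n)) * Laguerre (S (S n)) b t =
  (2 * INR n + 3 + b - t) * Laguerre (S n) b t - (INR n + 1 + b) * Laguerre n b t.
Proof.
  generalize (Laguerre_raise (S n) b t), (Laguerre_raise n b t), (Laguerre_pascal n b t).
  rewrite !S_INR. intros E1 E2 E3.
  replace (Laguerre (S n) (b + 1) t) with (Laguerre (S n) b t + Laguerre n (b + 1) t) in E1 by lra.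
  lra.
Qed.

Lemma Laguerre_1 (b t : R) : Laguerre 1 b t = 1 + b - t.
Proof. generalize (Laguerre_raise 0 b t). rewrite !Laguerre_0. simpl. lra. Qed.

(** * Weights and the Gamma function *)

Definition W (b s : R) : R := Rpower s b * exp (- s).

Lemma W_pos (b s : R) : 0 < W b s.
Proof. unfold W, Rpower. apply Rmult_lt_0_compat; apply exp_pos. Qed.

Lemma W_succ (b s : R) : 0 < s -> W (b + 1) s = s * W b s.
Proof. intros Hs. unfold W. rewrite Rpower_plus, Rpower_1 by auto. ring. Qed.

Lemma is_derive_W (b s : R) : 0 < s -> is_derive (W (b + 1)) s (W b s * (b + 1 - s)).
Proof.
  intros Hs. replace (W b s) with (W (b + 1) s / s) by (rewrite W_succ by auto; field; lra).
  unfold W, Rpower. auto_derive; auto. field. lra.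
Qed.

Lemma continuous_W (b s : R) : 0 < s -> continuous (W b) s.
Proof.
  intros Hs. apply (ex_derive_continuous (V := R_NormedModule)).
  unfold W, Rpower. auto_derive. auto.
Qed.

(** A class closed under sums and products, so that integrability against the weight and vanishing
    boundary terms are settled once for all polynomial factors. *)
Definition poly_growth (P : R -> R) : Prop :=
  (forall s, continuous P s) /\
  exists C N, 0 <= C /\ forall s, 0 <= s -> Rabs (P s) <= C * (1 + s) ^ N.

Lemma poly_growth_const (c : R) : poly_growth (fun _ => c).
Proof.
  split; [intros; apply continuous_const|]. exists (Rabs c), 0%nat.
  split; [apply Rabs_pos|]. intros; simpl; lra.
Qed.

Lemma poly_growth_id : poly_growth (fun s => s).
Proof.
  split; [intros; apply continuous_id|]. exists 1, 1%nat. split; [lra|].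
  intros. rewrite Rabs_pos_eq by auto. simpl. lra.
Qed.

Lemma poly_growth_mult (P Q : R -> R) :
  poly_growth P -> poly_growth Q -> poly_growth (fun s => P s * Q s).
Proof.
  intros [H1 (C1 & N1 & HC1 & HN1)] [H2 (C2 & N2 & HC2 & HN2)]. split.
  - intros s. apply (continuous_mult (K := R_AbsRing)); auto.
  - exists (C1 * C2), (N1 + N2)%nat. split; [apply Rmult_le_pos; auto|].
    intros s Hs. rewrite Rabs_mult, pow_add.
    replace (C1 * C2 * ((1 + s) ^ N1 * (1 + s) ^ N2)) with ((C1 * (1 + s) ^ N1) * (C2 * (1 + s) ^ N2)) by ring.
    apply Rmult_le_compat; auto using Rabs_pos.
Qed.

Lemma poly_growth_plus (P Q : R -> R) :
  poly_growth P -> poly_growth Q -> poly_growth (fun s => P s + Q s).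
Proof.
  intros [H1 (C1 & N1 & HC1 & HN1)] [H2 (C2 & N2 & HC2 & HN2)]. split.
  - intros s. apply (continuous_plus (V := R_NormedModule)); auto.
  - exists (C1 + C2), (N1 + N2)%nat. split; [lra|].
    intros s Hs. eapply Rle_trans; [apply Rabs_triang|]. rewrite Rmult_plus_distr_r.
    apply Rplus_le_compat; (eapply Rle_trans; [apply HN1 || apply HN2; auto|]);
      apply Rmult_le_compat_l; auto; apply Rle_pow; lia || lra.
Qed.

Lemma poly_growth_ext (P Q : R -> R) :
  (forall s, P s = Q s) -> poly_growth P -> poly_growth Q.
Proof.
  intros E [H1 (C1 & N1 & HC1 & HN1)]. split.
  - intros s. apply continuous_ext with P; auto.
  - exists C1, N1. split; auto. intros s Hs. rewrite <- E; auto.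
Qed.

Lemma poly_growth_pow (n : nat) : poly_growth (fun s => s ^ n).
Proof.
  induction n as [|n IH]; simpl.
  - apply poly_growth_const.
  - apply poly_growth_mult; auto. apply poly_growth_id.
Qed.

Lemma poly_growth_poly (a : nat -> R) (n : nat) :
  poly_growth (fun s => sum_f_R0 (fun k => a k * s ^ k) n).
Proof.
  induction n as [|n IH]; cbn [sum_f_R0].
  - apply poly_growth_mult; [apply poly_growth_const|apply poly_growth_pow].
  - apply poly_growth_plus; auto. apply poly_growth_mult; [apply poly_growth_const|apply poly_growth_pow].
Qed.

Lemma poly_growth_Laguerre (n : nat) (b : R) : poly_growth (Laguerre n b).
Proof.
  eapply poly_growth_ext; [|apply (poly_growth_poly (lag_coef n b) n)].
  intros; symmetry; apply Laguerre_coef.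
Qed.

Lemma poly_growth_Laguerre' (n : nat) (b : R) : poly_growth (Laguerre' n b).
Proof.
  destruct n as [|n]; unfold Laguerre'; [apply poly_growth_const|].
  apply poly_growth_ext with (fun t => (-1) * Laguerre n (b + 1) t); [intros; ring|].
  apply poly_growth_mult; [apply poly_growth_const|apply poly_growth_Laguerre].
Qed.

Lemma Rpower_le_1 (x a : R) : 1 <= x -> a <= 0 -> Rpower x a <= 1.
Proof.
  intros Hx Ha. apply Rle_trans with (Rpower x 0); [apply Rle_Rpower; auto|].
  rewrite Rpower_O by lra. lra.
Qed.

(** From 1 + y <= e^y comes x <= c e^(x/c) for x = 1 + s; raising to the power c gives x^c <= c^c
    e^x. The exponent [a] is first enlarged to c >= 1. *)
Lemma Rpower_exp_bounded (a : R) :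
  exists C, 0 < C /\ forall s, 0 < s -> Rpower (1 + s) a * exp (- s) <= C.
Proof.
  set (c := Rmax a 1).
  assert (Hc : 1 <= c) by apply Rmax_r. assert (Hac : a <= c) by apply Rmax_l.
  exists (Rpower c c * exp 1). split; [apply Rmult_lt_0_compat; apply exp_pos|].
  intros s Hs.
  apply Rle_trans with (Rpower c c * exp (1 + s) * exp (- s)).
  2:{ rewrite Rmult_assoc, <- exp_plus. apply Req_le. f_equal. f_equal. ring. }
  apply Rmult_le_compat_r; [apply Rlt_le, exp_pos|].
  apply Rle_trans with (Rpower (1 + s) c); [apply Rle_Rpower; lra|].
  apply Rle_trans with (Rpower (c * exp ((1 + s) / c)) c).
  - apply Rle_Rpower_l; [lra|]. split; [lra|].
    generalize (exp_ineq1_le ((1 + s) / c)); intros E.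
    apply Rmult_le_compat_l with (r := c) in E; [|lra].
    replace (c * (1 + (1 + s) / c)) with (c + (1 + s)) in E by (field; lra). lra.
  - rewrite <- Rpower_mult_distr by (try apply exp_pos; lra).
    apply Req_le. f_equal. unfold Rpower. rewrite ln_exp. f_equal. field. lra.
Qed.

Lemma is_int_extR (f g : R -> R) (v : R) :
  (forall s, 0 < s -> f s = g s) -> is_int f v -> is_int g v.
Proof. apply (is_int_ext (V := R_NormedModule)). Qed.

(** This majorant has the explicit primitive (s/(1+s))^(b+1) / (b+1). Its improper integral at both
    ends is thus a matter of two limits, and every other integral of the development is obtained by
    comparison with it. *)
Definition dominator (b s : R) : R := Rpower s b * Rpower (1 + s) (- (b + 2)).

Lemma W_poly_le_dominator (b : R) (P : R -> R) : poly_growth P ->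
  exists C, 0 < C /\ forall s, 0 < s -> Rabs (W b s * P s) <= C * dominator b s.
Proof.
  intros [_ (C & N & HC & HP)].
  destruct (Rpower_exp_bounded (INR N + (b + 2))) as (D & HD & HB).
  exists (C * D + 1). split; [generalize (Rmult_le_pos C D HC (Rlt_le _ _ HD)); lra|].
  intros s Hs. rewrite Rabs_mult. rewrite (Rabs_pos_eq (W b s)) by (apply Rlt_le, W_pos).
  apply Rle_trans with (W b s * (C * (1 + s) ^ N)).
  { apply Rmult_le_compat_l; [apply Rlt_le, W_pos|]. apply HP; lra. }
  rewrite <- Rpower_pow by lra. unfold W, dominator.
  specialize (HB s Hs).
  set (q := Rpower (1 + s) (- (b + 2))).
  assert (Hq : 0 < q) by apply exp_pos.
  assert (E : Rpower (1 + s) (INR N) = Rpower (1 + s) (INR N + (b + 2)) * q).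
  { unfold q. rewrite <- Rpower_plus. f_equal. ring. }
  rewrite E. set (z := Rpower (1 + s) (INR N + (b + 2))) in *.
  assert (Hs0 : 0 < Rpower s b) by apply exp_pos.
  replace (Rpower s b * exp (- s) * (C * (z * q))) with ((Rpower s b * q) * (C * (z * exp (- s)))) by ring.
  rewrite (Rmult_comm (C * D + 1)).
  apply Rmult_le_compat_l; [apply Rlt_le, Rmult_lt_0_compat; auto|].
  assert (C * (z * exp (- s)) <= C * D) by (apply Rmult_le_compat_l; auto). lra.
Qed.

Lemma Rpower_small (c eps : R) : 0 < c -> 0 < eps ->
  exists d, 0 < d /\ forall s, 0 < s -> s < d -> Rpower s c < eps.
Proof.
  intros Hc He. exists (Rpower eps (/ c)). split; [apply exp_pos|].
  intros s Hs Hsd. replace eps with (Rpower (Rpower eps (/ c)) c).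
  - apply Rlt_Rpower_l; auto.
  - rewrite Rpower_mult, Rinv_l, Rpower_1; auto; lra.
Qed.

Definition vanishing (k : R -> R) : Prop :=
  forall eps, 0 < eps -> at_ends (fun a b => Rabs (k a) < eps /\ Rabs (k b) < eps).

Lemma vanishing_scal {V : NormedModule R_AbsRing} (k : R -> R) (v : R -> V) (K : R) :
  (forall s, 0 < s -> norm (v s) <= K) -> vanishing k ->
  filterlim (fun s => scal (k s) (v s)) (at_right 0) (locally (zero : V)) /\
  filterlim (fun s => scal (k s) (v s)) (Rbar_locally p_infty) (locally (zero : V)).
Proof.
  intros Hv Hk.
  assert (HK : 0 < Rabs K + 1) by (generalize (Rabs_pos K); lra).
  assert (Hs : forall s eps, 0 < s -> Rabs (k s) < eps / (Rabs K + 1) ->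
    norm (minus (scal (k s) (v s)) zero) < eps).
  { intros s eps Hs H. unfold minus. rewrite opp_zero, plus_zero_r.
    eapply Rle_lt_trans; [apply (norm_scal (k s) (v s))|].
    change (Rabs (k s) * norm (v s) < eps).
    apply Rle_lt_trans with (Rabs (k s) * (Rabs K + 1)).
    - apply Rmult_le_compat_l; [apply Rabs_pos|]. generalize (Hv s Hs), (Rle_abs K). lra.
    - apply Rmult_lt_compat_r with (r := Rabs K + 1) in H; auto.
      replace (eps / (Rabs K + 1) * (Rabs K + 1)) with eps in H by (field; lra). exact H. }
  split; intros P HP; apply locally_norm_le_locally in HP; destruct HP as [eps HP];
    (destruct (Hk (eps / (Rabs K + 1))) as (d & Hd & r & H);
     [apply Rdiv_lt_0_compat; auto; apply cond_pos|]).
  - exists (mkposreal d Hd). intros s Hsd Hs0. apply HP. apply Hs; auto.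
    apply (H s (Rabs r + 1)); auto.
    + unfold ball in Hsd; simpl in Hsd; unfold AbsRing_ball, abs, minus, plus, opp in Hsd; simpl in Hsd.
      rewrite Rabs_pos_eq in Hsd; lra.
    + generalize (Rle_abs r); lra.
  - exists (Rmax r 0). intros s Hsr. generalize (Rmax_l r 0), (Rmax_r r 0); intros.
    apply HP. apply Hs; [lra|]. apply (H (d / 2) s); lra.
Qed.

(** The extra factor s turns the dominator into s^(b+1) (1+s)^(-(b+2)): it is at most s^(b+1) near
    0, small because b + 1 > 0, and at most 1/(1+s) at infinity. *)
Lemma vanishing_W (b : R) (P : R -> R) : -1 < b -> poly_growth P ->
  vanishing (fun s => W (b + 1) s * P s).
Proof.
  intros Hb HP eps He.
  destruct (W_poly_le_dominator b P HP) as (C & HC & HD).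
  assert (HL : forall s, 0 < s -> Rabs (W (b + 1) s * P s) <= C * (Rpower s (b + 1) * Rpower (1 + s) (- (b + 2)))).
  { intros s Hs. rewrite W_succ by auto. rewrite Rmult_assoc, Rabs_mult, (Rabs_pos_eq s) by lra.
    rewrite Rpower_plus, Rpower_1 by auto.
    apply Rle_trans with (s * (C * dominator b s)); [apply Rmult_le_compat_l; [lra|auto]|].
    unfold dominator. apply Req_le. ring. }
  destruct (Rpower_small (b + 1) (eps / C)) as (d & Hd & Hd2); [lra | apply Rdiv_lt_0_compat; auto |].
  exists d. split; auto. exists (Rmax (C / eps) 0). intros s r Hs Hsd Hr.
  generalize (Rmax_l (C / eps) 0), (Rmax_r (C / eps) 0); intros Hr1 Hr2.
  split.
  - eapply Rle_lt_trans; [apply HL; auto|].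
    apply Rle_lt_trans with (C * (Rpower s (b + 1) * 1)).
    + apply Rmult_le_compat_l; [lra|]. apply Rmult_le_compat_l; [apply Rlt_le, exp_pos|].
      apply Rpower_le_1; lra.
    + specialize (Hd2 s Hs Hsd). apply Rmult_lt_compat_l with (r := C) in Hd2; auto.
      replace (C * (eps / C)) with eps in Hd2 by (field; lra). lra.
  - eapply Rle_lt_trans; [apply HL; lra|].
    apply Rle_lt_trans with (C * (Rpower (1 + r) (b + 1) * Rpower (1 + r) (- (b + 2)))).
    + apply Rmult_le_compat_l; [lra|]. apply Rmult_le_compat_r; [apply Rlt_le, exp_pos|].
      apply Rle_Rpower_l; lra.
    + rewrite <- Rpower_plus. replace (b + 1 + - (b + 2)) with (- (1)) by ring.
      rewrite Rpower_Ropp, Rpower_1 by lra.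
      apply Rmult_lt_reg_r with (1 + r); [lra|]. rewrite Rmult_assoc, Rinv_l, Rmult_1_r by lra.
      assert (C / eps < 1 + r) by lra. apply Rmult_lt_compat_l with (r := eps) in H; auto.
      replace (eps * (C / eps)) with C in H by (field; lra). lra.
Qed.

Lemma continuous_dominator (b s : R) : 0 < s -> continuous (dominator b) s.
Proof.
  intros Hs. apply (ex_derive_continuous (V := R_NormedModule)).
  unfold dominator, Rpower. auto_derive. lra.
Qed.

Lemma is_int_dominator (b : R) : -1 < b -> is_int (dominator b) (/ (b + 1)).
Proof.
  intros Hb.
  set (F := fun s => / (b + 1) * (Rpower s (b + 1) * Rpower (1 + s) (- (b + 1)))).
  assert (HF : is_int (dominator b) (minus (/ (b + 1)) 0)).
  { apply (is_int_FTC (V := R_CompleteNormedModule) F).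
    - intros s Hs.
      assert (E1 : Rpower s (b + 1) = s * Rpower s b) by (rewrite Rpower_plus, Rpower_1 by auto; ring).
      assert (E2 : Rpower (1 + s) (- (b + 1)) = (1 + s) * Rpower (1 + s) (- (b + 2))).
      { replace (- (b + 1)) with (- (b + 2) + 1) by ring. rewrite Rpower_plus, (Rpower_1 (1 + s)) by lra. ring. }
      unfold F. evar_last.
      { unfold Rpower. auto_derive; [lra|]. reflexivity. }
      fold (Rpower s (b + 1)). fold (Rpower (1 + s) (- (b + 1))).
      rewrite E1, E2. unfold dominator. field. lra.
    - intros; apply continuous_dominator; auto.
    - intros P [eps HP]. destruct (Rpower_small (b + 1) (eps * (b + 1))) as (d & Hd & Hd2); [lra| |].
      { apply Rmult_lt_0_compat; [apply cond_pos|lra]. }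
      exists (mkposreal d Hd). intros s Hsd Hs0. apply HP.
      unfold ball in Hsd; simpl in Hsd; unfold AbsRing_ball, abs, minus, plus, opp in Hsd; simpl in Hsd.
      rewrite Rabs_pos_eq in Hsd by lra.
      change (Rabs (F s - 0) < eps). rewrite Rminus_0_r. unfold F.
      specialize (Hd2 s Hs0 ltac:(lra)).
      assert (Hle : Rpower (1 + s) (- (b + 1)) <= 1).
      { apply Rpower_le_1; lra. }
      assert (H1 : 0 < Rpower s (b + 1)) by apply exp_pos.
      assert (H2 : 0 < Rpower (1 + s) (- (b + 1))) by apply exp_pos.
      assert (H3 : 0 < / (b + 1)) by (apply Rinv_0_lt_compat; lra).
      rewrite Rabs_pos_eq.
      + apply Rle_lt_trans with (/ (b + 1) * (Rpower s (b + 1) * 1)).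
        * apply Rmult_le_compat_l; [lra|]. apply Rmult_le_compat_l; lra.
        * rewrite Rmult_1_r. apply Rmult_lt_reg_l with (b + 1); [lra|].
          rewrite <- Rmult_assoc, Rinv_r by lra. lra.
      + apply Rmult_le_pos; [lra|]. apply Rmult_le_pos; lra.
    (* Written as a power of 1 - 1/(1+s), the limit at infinity is continuity of the power function
       at 1. *)
    - apply filterlim_ext_loc with (fun s => / (b + 1) * Rpower (1 - / (1 + s)) (b + 1)).
      { exists 0. intros s Hs. unfold F. f_equal. rewrite Rpower_Ropp.
        replace (1 - / (1 + s)) with (s * / (1 + s)) by (field; lra).
        rewrite <- Rpower_mult_distr by (try apply Rinv_0_lt_compat; lra). f_equal.
        unfold Rpower. rewrite ln_Rinv by lra. rewrite <- exp_Ropp. f_equal. ring. }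
      assert (E : / (b + 1) = / (b + 1) * Rpower 1 (b + 1)).
      { unfold Rpower. rewrite ln_1, Rmult_0_r, exp_0. ring. }
      rewrite E at 1.
      apply (filterlim_comp _ _ _ (fun s => 1 - / (1 + s)) (fun y => / (b + 1) * Rpower y (b + 1)) _ (locally 1)).
      + evar (l : Rbar). assert (Hl : is_lim (fun s => 1 - / (1 + s)) p_infty l).
        { unfold l. apply is_lim_minus'; [apply is_lim_const|].
          apply (is_lim_inv (fun s => 1 + s) p_infty p_infty); [|discriminate].
          apply (is_lim_plus (fun _ => 1) (fun s => s) p_infty 1 p_infty p_infty);
            [apply is_lim_const|apply is_lim_id|reflexivity]. }
        unfold l in Hl. rewrite Rminus_0_r in Hl. exact Hl.
      + assert (H : continuous (fun y => / (b + 1) * Rpower y (b + 1)) 1).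
        { apply (ex_derive_continuous (V := R_NormedModule)). unfold Rpower. auto_derive. lra. }
        exact H. }
  replace (/ (b + 1)) with (minus (/ (b + 1)) 0); [exact HF|].
  unfold minus, plus, opp; simpl. ring.
Qed.

Definition integrable (k : R -> R) : Prop :=
  (forall s, 0 < s -> continuous k s) /\ exists v, is_int (fun s => Rabs (k s)) v.

Lemma integrable_dominated (k g : R -> R) :
  (forall s, 0 < s -> continuous k s) -> integrable g ->
  (forall s, 0 < s -> Rabs (k s) <= Rabs (g s)) -> integrable k.
Proof.
  intros Hk [Hg [v Hv]] Hle. split; auto.
  apply (ex_int_dominated (V := R_CompleteNormedModule) (fun s => Rabs (k s)) (fun s => Rabs (g s)) v); auto.
  - intros s Hs. apply (continuous_comp k Rabs); [auto | apply continuous_Rabs].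
  - intros s Hs. apply (continuous_comp g Rabs); [auto | apply continuous_Rabs].
  - intros s Hs. change (Rabs (Rabs (k s)) <= Rabs (g s)). rewrite Rabs_Rabsolu. auto.
Qed.

Lemma integrable_ext (k g : R -> R) :
  (forall s, 0 < s -> k s = g s) -> integrable k -> integrable g.
Proof.
  intros E Hk. apply integrable_dominated with k; auto.
  - intros s Hs. apply continuous_ext_loc with k; [|apply Hk; auto].
    exists (mkposreal s Hs). intros y Hy. apply E.
    unfold ball in Hy; simpl in Hy; unfold AbsRing_ball, abs, minus, plus, opp in Hy; simpl in Hy.
    apply Rabs_def2 in Hy. lra.
  - intros s Hs. rewrite E by auto. lra.
Qed.

Lemma integrable_scal (c : R) (k : R -> R) : integrable k -> integrable (fun s => c * k s).
Proof.
  intros [Hk [v Hv]]. split.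
  - intros s Hs. apply (continuous_mult (K := R_AbsRing)); [apply continuous_const|auto].
  - exists (Rabs c * v). apply is_int_ext with (fun s => Rabs c * Rabs (k s)).
    + intros; rewrite Rabs_mult; auto.
    + apply (is_int_scal (V := R_NormedModule)); auto.
Qed.

Lemma integrable_plus (k g : R -> R) :
  integrable k -> integrable g -> integrable (fun s => k s + g s).
Proof.
  intros [Hk [v Hv]] [Hg [w Hw]].
  assert (Hc : forall s, 0 < s -> continuous (fun s => k s + g s) s).
  { intros s Hs. apply (continuous_plus (V := R_NormedModule)); auto. }
  apply integrable_dominated with (fun s => Rabs (k s) + Rabs (g s)); auto.
  - assert (forall s, 0 <= Rabs (k s) + Rabs (g s)).
    { intros s; generalize (Rabs_pos (k s)), (Rabs_pos (g s)); lra. }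
    split.
    + intros s Hs. apply (continuous_plus (V := R_NormedModule) (fun s => Rabs (k s)) (fun s => Rabs (g s))).
      * apply (continuous_comp k Rabs); [auto | apply continuous_Rabs].
      * apply (continuous_comp g Rabs); [auto | apply continuous_Rabs].
    + exists (v + w). apply is_int_ext with (fun s => Rabs (k s) + Rabs (g s)).
      * intros; symmetry; apply Rabs_pos_eq; auto.
      * apply (is_int_plus (V := R_NormedModule)); auto.
  - intros s Hs. rewrite (Rabs_pos_eq (Rabs (k s) + Rabs (g s))); [apply Rabs_triang|].
    generalize (Rabs_pos (k s)), (Rabs_pos (g s)); lra.
Qed.

Lemma integrable_is_int (k : R -> R) : integrable k -> exists v : R, is_int k v.
Proof.
  intros [Hk [v Hv]].
  apply (ex_int_dominated (V := R_CompleteNormedModule) k (fun s => Rabs (k s)) v); auto.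
  - intros s Hs. apply (continuous_comp k Rabs); [auto | apply continuous_Rabs].
  - intros s Hs. apply Rle_refl.
Qed.

Lemma continuous_W_poly (b : R) (P : R -> R) (s : R) :
  poly_growth P -> 0 < s -> continuous (fun s => W b s * P s) s.
Proof.
  intros [HP _] Hs. apply (continuous_mult (K := R_AbsRing)); [apply continuous_W; auto|apply HP].
Qed.

Lemma integrable_W (b : R) (P : R -> R) : -1 < b -> poly_growth P -> integrable (fun s => W b s * P s).
Proof.
  intros Hb HP. destruct (W_poly_le_dominator b P HP) as (C & HC & HD).
  assert (Hp : forall s, 0 <= dominator b s).
  { intros s. unfold dominator, Rpower. apply Rlt_le, Rmult_lt_0_compat; apply exp_pos. }
  apply integrable_dominated with (fun s => C * dominator b s).
  - intros; apply continuous_W_poly; auto.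
  - apply integrable_scal. split; [intros; apply continuous_dominator; auto|].
    exists (/ (b + 1)). apply is_int_ext with (dominator b); [|apply is_int_dominator; auto].
    intros s Hs. rewrite Rabs_pos_eq; auto.
  - intros s Hs. rewrite (Rabs_pos_eq (C * _)); auto. apply Rmult_le_pos; auto; lra.
Qed.

(** The integrand is the derivative of s^(b+1) e^(-s) P(s), whose boundary values vanish. The
    choices P = 1, a product of two Laguerre polynomials, and a single one give the functional
    equation of Gamma, the norms, and the vanishing mean of the higher kernels. *)
Lemma is_int_W_deriv (b : R) (P P' : R -> R) : -1 < b -> poly_growth P -> poly_growth P' ->
  (forall s, is_derive P s (P' s)) ->
  is_int (fun s => W b s * ((b + 1 - s) * P s + s * P' s)) 0.
Proof.
  intros Hb HP HP' HD.
  assert (Hq : poly_growth (fun s => (b + 1 - s) * P s + s * P' s)).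
  { apply poly_growth_plus.
    - apply (poly_growth_ext (fun s => ((b + 1) + (-1) * s) * P s)); [intros; ring|].
      apply poly_growth_mult; auto.
      apply (poly_growth_plus (fun _ => b + 1) (fun s => (-1) * s)); [apply poly_growth_const|].
      apply poly_growth_mult; [apply poly_growth_const | apply poly_growth_id].
    - apply poly_growth_mult; auto. apply poly_growth_id. }
  destruct (vanishing_scal (V := R_NormedModule) (fun s => W (b + 1) s * P s) (fun _ => 1) 1) as [H0 H1].
  { intros. change (Rabs 1 <= 1). rewrite Rabs_R1; lra. }
  { apply vanishing_W; auto. }
  replace 0 with (minus 0 0) by (unfold minus, plus, opp; simpl; ring).
  (* The scalar primitive is written as acting on the constant vector 1, the form in which
     [vanishing_scal] supplies its limits. *)
  apply (is_int_FTC (V := R_CompleteNormedModule) (fun s => scal (W (b + 1) s * P s) 1)); auto.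
  - intros s Hs. apply is_derive_ext with (fun s => W (b + 1) s * P s).
    { intros; unfold scal; simpl; unfold mult; simpl. ring. }
    evar_last.
    + apply (is_derive_mult (W (b + 1)) P); [apply is_derive_W; auto|apply HD|]. intros; apply Rmult_comm.
    + unfold plus, mult; simpl. rewrite W_succ by auto. ring.
  - intros s Hs. apply continuous_W_poly; auto.
Qed.

(** * The Gamma function and the weighted norms of Laguerre polynomials *)

Definition Gam (g : R) : R := RInt_gen (W (g - 1)) (at_right 0) (Rbar_locally p_infty).

Lemma is_int_Gam (g : R) : 0 < g -> is_int (W (g - 1)) (Gam g).
Proof.
  intros Hg. unfold Gam. apply (RInt_gen_correct (V := R_CompleteNormedModule)).
  destruct (integrable_is_int (fun s => W (g - 1) s * 1)) as [v Hv].
  { apply integrable_W; [lra|apply poly_growth_const]. }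
  exists v. apply (is_int_extR) with (2 := Hv).
  intros s Hs. change (W (g - 1) s * 1 = W (g - 1) s). ring.
Qed.

Lemma is_int_ge_RInt (f : R -> R) (v a b : R) :
  (forall s, 0 < s -> continuous f s) -> (forall s, 0 < s -> 0 <= f s) -> is_int f v ->
  0 < a -> a <= b -> RInt f a b <= v.
Proof.
  intros Hc Hp Hv Ha Hab. apply Rnot_lt_le. intros Hlt.
  destruct (proj1 (is_int_iff (V := R_NormedModule) f v) Hv (RInt f a b - v)) as (d & Hd & r & H); [lra|].
  set (a' := Rmin a (d / 2)). set (b' := Rmax b (r + 1)).
  assert (Ha' : 0 < a') by (apply Rmin_glb_lt; lra).
  assert (a' <= a) by apply Rmin_l. assert (a' <= d / 2) by apply Rmin_r.
  assert (b <= b') by apply Rmax_l. assert (r + 1 <= b') by apply Rmax_r.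
  destruct (H a' b') as (w & Hw1 & Hw2); try lra.
  assert (E : forall x y, 0 < x -> x <= y -> ex_RInt f x y).
  { intros x y Hx Hy. apply (ex_RInt_continuous (V := R_CompleteNormedModule)).
    intros z Hz. rewrite Rmin_left in Hz by lra. apply Hc; lra. }
  assert (P : forall x y, 0 < x -> x <= y -> 0 <= RInt f x y).
  { intros x y Hx Hy. apply RInt_ge_0; auto. intros; apply Hp; lra. }
  apply (is_RInt_unique (V := R_CompleteNormedModule)) in Hw1.
  rewrite <- (RInt_Chasles (V := R_CompleteNormedModule) f a' a b') in Hw1 by (apply E; lra).
  rewrite <- (RInt_Chasles (V := R_CompleteNormedModule) f a b b') in Hw1 by (apply E; lra).
  change (RInt f a' a + (RInt f a b + RInt f b b') = w) in Hw1.
  change (Rabs (w - v) < RInt f a b - v) in Hw2. apply Rabs_def2 in Hw2.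
  generalize (P a' a), (P b b'). lra.
Qed.

Lemma RInt_W_pos (b x y : R) : 0 < x -> x < y -> 0 < RInt (W b) x y.
Proof.
  intros Hx Hy. apply RInt_gt_0; auto.
  - intros; apply W_pos.
  - intros z Hz. apply continuous_W; lra.
Qed.

Lemma Gam_pos (g : R) : 0 < g -> 0 < Gam g.
Proof.
  intros Hg. apply Rlt_le_trans with (RInt (W (g - 1)) 1 2).
  - apply RInt_W_pos; lra.
  - apply is_int_ge_RInt; try lra.
    + intros; apply continuous_W; auto.
    + intros; apply Rlt_le, W_pos.
    + apply is_int_Gam; auto.
Qed.

Lemma Gam_succ (g : R) : 0 < g -> Gam (g + 1) = g * Gam g.
Proof.
  intros Hg.
  assert (H1 := is_int_W_deriv (g - 1) (fun _ => 1) (fun _ => 0) ltac:(lra) (poly_growth_const 1) (poly_growth_const 0)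
    ltac:(intros; apply (is_derive_const (V := R_NormedModule)))).
  assert (H2 := is_int_minus (V := R_NormedModule) _ _ _ _
    (is_int_scal (V := R_NormedModule) _ g _ (is_int_Gam g Hg)) (is_int_Gam (g + 1) ltac:(lra))).
  assert (E : 0 = g * Gam g - Gam (g + 1)).
  { apply (is_int_unique (V := R_CompleteNormedModule) _ _ _ H1).
    refine (is_int_extR _ _ _ _ H2).
    intros s Hs. unfold minus, plus, opp, scal; simpl; unfold mult; simpl.
    replace (g + 1 - 1) with (g - 1 + 1) by ring. rewrite W_succ by auto. ring. }
  lra.
Qed.

(** Integrating the derivative of s^(b+1) e^(-s) L_m^(b+1) L_(m+1)^b shows that the squared norm of
    L_(m+1)^b is that of L_m^(b+1) divided by m + 1. Hence an induction in which the parameter moves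
    up as the degree moves down. *)
Lemma is_int_Laguerre_sqr (m : nat) : forall b, -1 < b ->
  is_int (fun s => W b s * (Laguerre m b s * Laguerre m b s)) (Gam (INR m + b + 1) / INR (fact m)).
Proof.
  induction m as [|m IH]; intros b Hb.
  - simpl (INR _). replace (Gam (0 + b + 1) / 1) with (Gam (b + 1)) by (rewrite Rplus_0_l; field).
    apply (is_int_extR) with (W (b + 1 - 1)); [|apply is_int_Gam; lra].
    intros s Hs. rewrite !Laguerre_0. replace (b + 1 - 1) with b by ring. ring.
  - specialize (IH (b + 1) ltac:(lra)).
    assert (H1 := is_int_W_deriv b (fun s => Laguerre m (b + 1) s * Laguerre (S m) b s)
      (fun s => Laguerre' m (b + 1) s * Laguerre (S m) b s + Laguerre m (b + 1) s * Laguerre' (S m) b s) Hb).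
    assert (H2 : is_int (fun s => W b s * (INR (S m) * (Laguerre (S m) b s * Laguerre (S m) b s)) -
       W (b + 1) s * (Laguerre m (b + 1) s * Laguerre m (b + 1) s)) 0).
    { refine (is_int_extR _ _ _ _ (H1 _ _ _)).
      - intros s Hs. rewrite W_succ by auto. rewrite <- (Rmult_assoc (INR (S m))), <- Laguerre_rodrigues.
        cbn [Laguerre']. ring.
      - apply poly_growth_mult; apply poly_growth_Laguerre.
      - apply poly_growth_plus; apply poly_growth_mult; apply poly_growth_Laguerre || apply poly_growth_Laguerre'.
      - intros s. apply (is_derive_mult (Laguerre m (b + 1)) (Laguerre (S m) b)); try apply is_derive_Laguerre.
        intros; apply Rmult_comm. }
    assert (H3 := is_int_scal (V := R_NormedModule) _ (/ INR (S m)) _ (is_int_plus (V := R_NormedModule) _ _ _ _ H2 IH)).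
    assert (Hm : INR (S m) <> 0) by (apply not_0_INR; lia).
    replace (Gam (INR (S m) + b + 1) / INR (fact (S m))) with
      (scal (/ INR (S m)) (plus 0 (Gam (INR m + (b + 1) + 1) / INR (fact m)))).
    + refine (is_int_extR _ _ _ _ H3).
      intros s Hs. unfold plus, scal; simpl; unfold mult; simpl. field. exact Hm.
    + rewrite fact_simpl, mult_INR.
      change (/ INR (S m) * (0 + Gam (INR m + (b + 1) + 1) / INR (fact m)) =
        Gam (INR (S m) + b + 1) / (INR (S m) * INR (fact m))).
      rewrite Rplus_0_l. replace (INR m + (b + 1) + 1) with (INR (S m) + b + 1) by (rewrite S_INR; ring).
      field. split; auto. apply INR_fact_neq_0.
Qed.

(** Cauchy-Schwarz against the constant 1, in additive form: 2 |L| <= eps L^2 + 1/eps holds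
    pointwise and integrates linearly, so no products of integrals are needed. The parameter is
    balanced by the caller. *)
Lemma is_int_Laguerre_abs_le (m : nat) (b eps v : R) : -1 < b -> 0 < eps ->
  is_int (fun s => Rabs (W b s * Laguerre m b s)) v ->
  v <= (eps * (Gam (INR m + b + 1) / INR (fact m)) + / eps * Gam (b + 1)) / 2.
Proof.
  intros Hb He Hv.
  assert (H := is_int_scal (V := R_NormedModule) _ (/ 2) _ (is_int_plus (V := R_NormedModule) _ _ _ _
    (is_int_scal (V := R_NormedModule) _ eps _ (is_int_Laguerre_sqr m b Hb))
    (is_int_scal (V := R_NormedModule) _ (/ eps) _ (is_int_Gam (b + 1) ltac:(lra))))).
  replace ((eps * (Gam (INR m + b + 1) / INR (fact m)) + / eps * Gam (b + 1)) / 2) with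
    (/ 2 * (eps * (Gam (INR m + b + 1) / INR (fact m)) + / eps * Gam (b + 1))) by lra.
  refine (is_int_le _ _ _ _ _ Hv H).
  intros s Hs. replace (b + 1 - 1) with b by ring.
  change (Rabs (W b s * Laguerre m b s) <=
    / 2 * (eps * (W b s * (Laguerre m b s * Laguerre m b s)) + / eps * W b s)).
  rewrite Rabs_mult, (Rabs_pos_eq (W b s)) by (apply Rlt_le, W_pos).
  replace (/ 2 * (eps * (W b s * (Laguerre m b s * Laguerre m b s)) + / eps * W b s)) with
    (W b s * (/ 2 * (eps * (Laguerre m b s * Laguerre m b s) + / eps))) by ring.
  apply Rmult_le_compat_l; [apply Rlt_le, W_pos|].
  set (y := Rabs (Laguerre m b s)).
  replace (Laguerre m b s * Laguerre m b s) with (y * y).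
  2:{ unfold y. rewrite <- Rabs_mult, Rabs_pos_eq; auto. apply Rle_0_sqr. }
  (* AM-GM *)
  assert (Hq : 0 <= / eps * ((eps * y - 1) * (eps * y - 1))).
  { apply Rmult_le_pos; [apply Rlt_le, Rinv_0_lt_compat; auto|apply Rle_0_sqr]. }
  replace (/ eps * ((eps * y - 1) * (eps * y - 1))) with (eps * (y * y) + / eps - 2 * y) in Hq by (field; lra).
  lra.
Qed.

(** * Growth of the norms and pointwise bounds *)

Definition lag_norm (n : nat) (a : R) : R := Gam (INR n + a + 1) / INR (fact n).

Lemma INR_fact_pos (n : nat) : 0 < INR (fact n).
Proof. apply lt_0_INR, lt_O_fact. Qed.

Lemma lag_norm_pos (n : nat) (a : R) : -1 < a -> 0 < lag_norm n a.
Proof.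
  intros Ha. apply Rdiv_lt_0_compat; [apply Gam_pos | apply INR_fact_pos].
  generalize (pos_INR n); lra.
Qed.

Lemma lag_norm_S (n : nat) (a : R) : -1 < a ->
  lag_norm (S n) a = lag_norm n a * (INR n + 1 + a) / (INR n + 1).
Proof.
  intros Ha. unfold lag_norm. generalize (pos_INR n), (INR_fact_pos n); intros.
  rewrite fact_simpl, mult_INR, S_INR.
  replace (INR n + 1 + a + 1) with (INR n + a + 1 + 1) by ring.
  rewrite Gam_succ by lra. field. split; lra.
Qed.

Lemma ln_1p_le (y : R) : -1 < y -> ln (1 + y) <= y.
Proof.
  intros Hy. rewrite <- (ln_exp y) at 2. apply ln_le; [lra|].
  generalize (exp_ineq1_le y); lra.
Qed.

Lemma ln_1p_ge (y : R) : -1 < y -> y / (1 + y) <= ln (1 + y).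
Proof.
  intros Hy. assert (H : ln (/ (1 + y)) <= / (1 + y) - 1).
  { replace (/ (1 + y)) with (1 + (/ (1 + y) - 1)) at 1 by ring. apply ln_1p_le.
    assert (0 < / (1 + y)) by (apply Rinv_0_lt_compat; lra). lra. }
  rewrite ln_Rinv in H by lra.
  replace (y / (1 + y)) with (- (/ (1 + y) - 1)) by (field; lra). lra.
Qed.

(** With x = 1/(n+1) the ratio h_(n+1)/h_n is 1 + a x and (n/(n+1))^a is (1-x)^a; the quantity
    bounded is the increment of ln(h_n / n^a). For a > -1 and x <= 1/2 both arguments of the
    logarithm stay above 1/2. *)
Lemma ln_quadratic_error (a x : R) : -1 < a -> 0 < x -> x <= / 2 ->
  Rabs (ln (1 + a * x) + a * ln (1 + - x)) <= (2 * a * a + 2 * Rabs a) * (x * x).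
Proof.
  intros Ha Hx Hx2.
  assert (Hax : - / 2 <= a * x) by nra.
  assert (Hi : 0 < / (1 + a * x)) by (apply Rinv_0_lt_compat; lra).
  assert (Hi2 : / (1 + a * x) <= 2).
  { rewrite <- (Rinv_inv 2). apply Rinv_le_contravar; lra. }
  assert (Hj2 : / (1 + - x) <= 2).
  { rewrite <- (Rinv_inv 2). apply Rinv_le_contravar; lra. }
  generalize (ln_1p_le (a * x) ltac:(lra)), (ln_1p_ge (a * x) ltac:(lra)); intros U1 L1.
  generalize (ln_1p_le (- x) ltac:(lra)), (ln_1p_ge (- x) ltac:(lra)); intros U2 L2.
  assert (L1' : a * x - 2 * (a * x) * (a * x) <= ln (1 + a * x)).
  { eapply Rle_trans; [|exact L1].
    replace (a * x / (1 + a * x)) with (a * x - (a * x) * (a * x) * / (1 + a * x)) by (field; lra).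
    assert (0 <= (a * x) * (a * x)) by apply Rle_0_sqr. nra. }
  assert (L2' : - x - 2 * (x * x) <= ln (1 + - x)).
  { eapply Rle_trans; [|exact L2].
    replace (- x / (1 + - x)) with (- x - (x * x) * / (1 + - x)) by (field; lra).
    assert (0 <= x * x) by apply Rle_0_sqr. nra. }
  set (l1 := ln (1 + a * x)) in *. set (l2 := ln (1 + - x)) in *.
  assert (Hxx : 0 <= x * x) by apply Rle_0_sqr.
  assert (Haa : 0 <= a * a * (x * x)) by (apply Rmult_le_pos; [apply Rle_0_sqr|auto]).
  assert (H3 : Rabs (l1 - a * x) <= 2 * a * a * (x * x)) by (apply Rabs_le; lra).
  assert (H4 : Rabs (a * (l2 + x)) <= 2 * Rabs a * (x * x)).
  { rewrite Rabs_mult. generalize (Rabs_pos a); intros.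
    assert (Rabs (l2 + x) <= 2 * (x * x)) by (apply Rabs_le; lra). nra. }
  replace (l1 + a * l2) with ((l1 - a * x) + a * (l2 + x)) by ring.
  eapply Rle_trans; [apply Rabs_triang|]. lra.
Qed.

(** Replaces Stirling's formula: the increments of [v] are O(1/n^2), bounded by a telescoping
    multiple of 1/n - 1/(n+1), so [v] is bounded. A bound on its absolute value gives both
    inequalities with the same constant. *)
Lemma lag_norm_asymp (a : R) : -1 < a ->
  exists c, 0 < c /\ forall n, (1 <= n)%nat ->
    lag_norm n a <= c * Rpower (INR n) a /\ Rpower (INR n) a <= c * lag_norm n a.
Proof.
  intros Ha. set (v := fun n => ln (lag_norm n a) - a * ln (INR n)).
  set (c0 := 2 * a * a + 2 * Rabs a).
  assert (Hc0 : 0 <= c0).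
  { unfold c0. generalize (Rabs_pos a), (Rle_0_sqr a). unfold Rsqr. lra. }
  assert (Hstep : forall n, Rabs (v (S (S n)) - v (S n)) <= c0 * (/ INR (S n) - / INR (S (S n)))).
  { intros n. generalize (pos_INR n); intros Hn. generalize (lag_norm_pos (S n) a Ha); intros Hp.
    set (x := / INR (S (S n))).
    assert (Hx : 0 < x) by (apply Rinv_0_lt_compat; rewrite !S_INR; lra).
    assert (Hx2 : x <= / 2) by (apply Rinv_le_contravar; rewrite ?S_INR; lra).
    eapply Rle_trans; [|eapply Rle_trans; [apply (ln_quadratic_error a x Ha Hx Hx2)|]].
    - apply Req_le. f_equal. unfold v. rewrite (lag_norm_S (S n)) by auto.
      replace (lag_norm (S n) a * (INR (S n) + 1 + a) / (INR (S n) + 1)) with (lag_norm (S n) a * (1 + a * x)).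
      2:{ unfold x. rewrite !S_INR. field. lra. }
      assert (0 < 1 + a * x) by nra.
      rewrite ln_mult by auto.
      replace (1 + - x) with (INR (S n) * / INR (S (S n))) by (unfold x; rewrite !S_INR; field; lra).
      rewrite ln_mult, ln_Rinv; try ring; try apply Rinv_0_lt_compat; rewrite !S_INR; lra.
    - apply Rmult_le_compat_l; auto. unfold x. rewrite !S_INR.
      replace (/ (INR n + 1) - / (INR n + 1 + 1)) with (/ (INR n + 1) * / (INR n + 1 + 1)) by (field; lra).
      apply Rmult_le_compat_r; [apply Rlt_le, Rinv_0_lt_compat; lra|]. apply Rinv_le_contravar; lra. }
  assert (Hv : forall n, Rabs (v (S n) - v 1%nat) <= c0 * (1 - / INR (S n))).
  { induction n as [|n IH].
    - rewrite Rminus_diag, Rabs_R0. simpl. rewrite Rinv_1. lra.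
    - replace (v (S (S n)) - v 1%nat) with ((v (S (S n)) - v (S n)) + (v (S n) - v 1%nat)) by ring.
      eapply Rle_trans; [apply Rabs_triang|]. generalize (Hstep n). lra. }
  assert (Hb : forall n, Rabs (v (S n)) <= Rabs (v 1%nat) + c0).
  { intros n. replace (v (S n)) with ((v (S n) - v 1%nat) + v 1%nat) by ring.
    eapply Rle_trans; [apply Rabs_triang|]. generalize (Hv n).
    assert (0 < / INR (S n)) by (apply Rinv_0_lt_compat, lt_0_INR; lia). nra. }
  exists (exp (Rabs (v 1%nat) + c0)). split; [apply exp_pos|].
  intros [|n] Hn; [lia|]. specialize (Hb n).
  assert (E : lag_norm (S n) a = exp (v (S n)) * Rpower (INR (S n)) a).
  { unfold Rpower. rewrite <- exp_plus. unfold v.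
    replace (ln (lag_norm (S n) a) - a * ln (INR (S n)) + a * ln (INR (S n))) with (ln (lag_norm (S n) a)) by ring.
    rewrite exp_ln; auto. apply lag_norm_pos; auto. }
  assert (Hr : 0 < Rpower (INR (S n)) a) by apply exp_pos.
  rewrite E. split.
  - apply Rmult_le_compat_r; [lra|].
    destruct (Rle_lt_or_eq_dec (v (S n)) (Rabs (v 1%nat) + c0)) as [Hl|Hl].
    + generalize (Rle_abs (v (S n))); lra.
    + apply Rlt_le, exp_increasing; auto.
    + rewrite Hl; lra.
  - rewrite <- Rmult_assoc, <- exp_plus. rewrite <- (Rmult_1_l (Rpower (INR (S n)) a)) at 1.
    apply Rmult_le_compat_r; [lra|].
    generalize (exp_ineq1_le (Rabs (v 1%nat) + c0 + v (S n))).
    apply Rabs_le_between in Hb. lra.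
Qed.

(** Each of the p factors n - j, j < p <= n, of n!/(n-p)! is at least n/p; the induction trades one
    of them at a time. *)
Lemma fact_ratio_le (n p : nat) : (p <= n)%nat ->
  INR (fact (n - p)) * INR n ^ p <= INR p ^ p * INR (fact n).
Proof.
  intros Hp.
  assert (H : forall j, (j <= p)%nat -> (fact (n - j) * n ^ j <= p ^ j * fact n)%nat).
  { induction j as [|j IH]; intros Hj.
    - rewrite Nat.sub_0_r. simpl. lia.
    - specialize (IH ltac:(lia)).
      assert (E : (fact (n - j) = (n - j) * fact (n - S j))%nat).
      { replace (n - j)%nat with (S (n - S j)) by lia. rewrite fact_simpl. reflexivity. }
      rewrite E in IH. assert (Hn : (n <= p * (n - j))%nat) by nia.
      simpl Nat.pow.
      apply Nat.le_trans with (fact (n - S j) * (p * (n - j) * n ^ j))%nat.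
      { apply Nat.mul_le_mono_l. apply Nat.mul_le_mono_r. auto. }
      replace (fact (n - S j) * (p * (n - j) * n ^ j))%nat with (p * ((n - j) * fact (n - S j) * n ^ j))%nat by ring.
      rewrite <- (Nat.mul_assoc p (p ^ j)). apply Nat.mul_le_mono_l. auto. }
  specialize (H p (Nat.le_refl p)). apply le_INR in H.
  rewrite !mult_INR, !pow_INR in H. exact H.
Qed.

Lemma sqrt_Rpower (x y : R) : 0 < x -> sqrt (Rpower x y) = Rpower x (y / 2).
Proof.
  intros Hx. rewrite <- Rpower_sqrt by apply exp_pos. rewrite Rpower_mult. f_equal.
Qed.

Lemma fact_ratio_sqrt (n p : nat) : (p <= n)%nat -> (1 <= n)%nat ->
  sqrt (INR (fact (n - p)) / INR (fact n)) <= sqrt (INR p ^ p) * Rpower (INR n) (- (INR p / 2)).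
Proof.
  intros Hp Hn. assert (Hn0 : 0 < INR n) by (apply lt_0_INR; lia).
  replace (- (INR p / 2)) with ((- INR p) / 2) by field.
  rewrite <- sqrt_Rpower by auto.
  rewrite <- sqrt_mult; [|apply pow_le, pos_INR | apply Rlt_le, exp_pos].
  apply sqrt_le_1_alt. rewrite Rpower_Ropp, Rpower_pow by auto.
  generalize (fact_ratio_le n p Hp), (INR_fact_pos n), (pow_lt (INR n) p Hn0). intros H1 H2 H3.
  apply Rmult_le_reg_r with (INR (fact n) * INR n ^ p); [apply Rmult_lt_0_compat; auto|].
  replace (INR (fact (n - p)) / INR (fact n) * (INR (fact n) * INR n ^ p)) with (INR (fact (n - p)) * INR n ^ p)
    by (field; lra).
  replace (INR p ^ p * / INR n ^ p * (INR (fact n) * INR n ^ p)) with (INR p ^ p * INR (fact n)) by (field; lra).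
  exact H1.
Qed.

(* For fixed n the energy n y^2 + s (y')^2 of the Laguerre equation
   satisfies E' = (2 s - 2 a - 1) (y')^2, so it varies by a factor independent of n
   on [t/2, t]; its weighted mean there is controlled by the norms of y and y'. *)
Lemma Laguerre_pointwise_bound (a t : R) : -1 < a -> 0 < t ->
  exists C, 0 < C /\ forall n, (1 <= n)%nat ->
    Laguerre n a t * Laguerre n a t <= C * lag_norm n a.
Proof.
  intros Ha Ht.
  (* Chosen so that 2 s - 2 a - 1 <= c s on [t/2, t]: then E' <= c E there, and E(s) e^(-c s)
     decreases. *)
  set (c := (2 * t + 2 * Rabs a + 1) * (2 / t)).
  assert (HI := RInt_W_pos a (t / 2) t ltac:(lra) ltac:(lra)).
  set (I0 := RInt (W a) (t / 2) t) in *.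
  exists (2 * exp (c * t) / I0). split.
  { apply Rdiv_lt_0_compat; auto. generalize (exp_pos (c * t)); lra. }
  intros [|k] Hk; [lia|]. clear Hk.
  set (y := Laguerre (S k) a). set (g := Laguerre k (a + 1)).
  set (E := fun s => INR (S k) * (y s * y s) + s * (g s * g s)).
  assert (Hk : 0 < INR (S k)) by (apply lt_0_INR; lia).
  assert (Hy : forall s, is_derive y s (- g s)) by (intros; apply (is_derive_Laguerre (S k))).
  assert (Hg : forall s, is_derive g s (Laguerre' k (a + 1) s)) by (intros; apply is_derive_Laguerre).
  assert (HE : forall s, is_derive E s ((2 * s - 2 * a - 1) * (g s * g s))).
  { intros s. unfold E. evar_last.
    - apply (is_derive_plus (V := R_NormedModule)).
      + apply (is_derive_scal (fun s => y s * y s)).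
        apply (is_derive_mult y y); [apply Hy|apply Hy|intros; apply Rmult_comm].
      + apply (is_derive_mult (fun s => s) (fun s => g s * g s)); [apply (is_derive_id (K := R_AbsRing))| |intros; apply Rmult_comm].
        apply (is_derive_mult g g); [apply Hg|apply Hg|intros; apply Rmult_comm].
    (* Since y' = -g, Rodrigues' identity expresses (k+1) y through g and g': this is the Laguerre
       equation as a first-order system, and the terms in g g' cancel. *)
    - generalize (Laguerre_rodrigues k a s). fold (g s). fold (y s). intros R0.
      unfold plus, mult, one; simpl plus; simpl mult; simpl one.
      change (INR (S k) * (- g s * y s + y s * - g s) +
        (1 * (g s * g s) + s * (Laguerre' k (a + 1) s * g s + g s * Laguerre' k (a + 1) s)) =
        (2 * s - 2 * a - 1) * (g s * g s)).
      replace (INR (S k) * (- g s * y s + y s * - g s)) with (- 2 * g s * (INR (S k) * y s)) by ring.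
      rewrite <- R0. ring. }
  assert (HEs : forall s, 0 < s -> 0 <= E s).
  { intros s Hs. unfold E. generalize (Rle_0_sqr (y s)), (Rle_0_sqr (g s)). unfold Rsqr. intros.
    apply Rplus_le_le_0_compat; apply Rmult_le_pos; lra. }
  assert (HD : forall s, is_derive (fun s => E s * exp (- c * s)) s
     (((2 * s - 2 * a - 1) * (g s * g s) - c * E s) * exp (- c * s))).
  { intros s. evar_last.
    - apply (is_derive_mult E (fun s => exp (- c * s))); [apply HE| |intros; apply Rmult_comm].
      auto_derive; [auto|reflexivity].
    - change ((2 * s - 2 * a - 1) * (g s * g s) * exp (- c * s) + E s * (- c * 1 * exp (- c * s)) =
        ((2 * s - 2 * a - 1) * (g s * g s) - c * E s) * exp (- c * s)). ring. }
  assert (Hc : 0 < c).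
  { unfold c. apply Rmult_lt_0_compat; [generalize (Rabs_pos a); lra|]. apply Rdiv_lt_0_compat; lra. }
  assert (Hmono : forall s, t / 2 <= s -> s <= t -> E t * exp (- (c * t)) <= E s).
  { intros s Hs1 Hs2.
    destruct (MVT_gen (fun s => E s * exp (- c * s)) s t
      (fun s => ((2 * s - 2 * a - 1) * (g s * g s) - c * E s) * exp (- c * s))) as (xi & Hxi & HM).
    { intros; apply HD. }
    { intros x _. apply continuity_pt_filterlim.
      apply (ex_derive_continuous (V := R_NormedModule) (fun s => E s * exp (- c * s))).
      eexists; apply HD. }
    rewrite Rmin_left, Rmax_right in Hxi by lra. cbv beta in HM.
    assert (Hneg : (2 * xi - 2 * a - 1) * (g xi * g xi) - c * E xi <= 0).
    { generalize (Rle_0_sqr (y xi)), (Rle_0_sqr (g xi)). unfold Rsqr. intros Y2 G2.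
      assert (H1 : 2 * xi - 2 * a - 1 <= c * xi).
      { apply Rle_trans with (2 * t + 2 * Rabs a + 1).
        - generalize (Rle_abs (- a)). rewrite Rabs_Ropp. lra.
        - unfold c. rewrite Rmult_assoc. rewrite <- (Rmult_1_r (2 * t + 2 * Rabs a + 1)) at 1.
          apply Rmult_le_compat_l; [generalize (Rabs_pos a); lra|].
          apply Rmult_le_reg_r with t; auto. field_simplify; lra. }
      assert (H2 : (2 * xi - 2 * a - 1) * (g xi * g xi) <= c * xi * (g xi * g xi)) by (apply Rmult_le_compat_r; auto).
      assert (H3 : 0 <= c * (INR (S k) * (y xi * y xi))) by (apply Rmult_le_pos; [lra|apply Rmult_le_pos; lra]).
      unfold E. lra. }
    assert (Hle : E t * exp (- c * t) <= E s * exp (- c * s)).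
    { assert (HP : 0 <= (- ((2 * xi - 2 * a - 1) * (g xi * g xi) - c * E xi)) * exp (- c * xi) * (t - s)).
      { apply Rmult_le_pos; [apply Rmult_le_pos; [lra|apply Rlt_le, exp_pos]|lra]. }
      lra. }
    replace (- (c * t)) with (- c * t) by ring.
    eapply Rle_trans; [exact Hle|]. rewrite <- (Rmult_1_r (E s)) at 2.
    apply Rmult_le_compat_l; [apply HEs; lra|].
    rewrite <- exp_0. apply Rlt_le, exp_increasing. nra. }
  (* Both halves of the energy have the same weighted integral n h_n, for n = k + 1. This n later
     cancels against n y(t)^2 <= E(t), which makes the bound uniform in n. *)
  assert (Hint : is_int (fun s => W a s * E s) (2 * (INR (S k) * lag_norm (S k) a))).
  { assert (H := is_int_plus (V := R_NormedModule) _ _ _ _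
      (is_int_scal (V := R_NormedModule) _ (INR (S k)) _ (is_int_Laguerre_sqr (S k) a Ha))
      (is_int_Laguerre_sqr k (a + 1) ltac:(lra))).
    replace (2 * (INR (S k) * lag_norm (S k) a)) with
      (INR (S k) * (Gam (INR (S k) + a + 1) / INR (fact (S k))) + Gam (INR k + (a + 1) + 1) / INR (fact k)).
    - refine (is_int_extR _ _ _ _ H). intros s Hs.
      change (INR (S k) * (W a s * (y s * y s)) + W (a + 1) s * (g s * g s) = W a s * E s).
      rewrite W_succ by auto. unfold E. ring.
    - unfold lag_norm. replace (INR k + (a + 1) + 1) with (INR (S k) + a + 1) by (rewrite S_INR; ring).
      rewrite fact_simpl, mult_INR. field. generalize (INR_fact_pos k). split; lra. }
  assert (HcE : forall s, continuous E s).
  { intros s. apply (ex_derive_continuous (V := R_NormedModule)). eexists; apply HE. }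
  assert (Hc2 : forall s, 0 < s -> continuous (fun s => W a s * E s) s).
  { intros s Hs. apply (continuous_mult (K := R_AbsRing)); auto. apply continuous_W; auto. }
  assert (H1 : RInt (fun s => W a s * E s) (t / 2) t <= 2 * (INR (S k) * lag_norm (S k) a)).
  { apply is_int_ge_RInt; auto; try lra. intros s Hs. apply Rmult_le_pos; [apply Rlt_le, W_pos|auto]. }
  assert (H2 : RInt (fun s => (E t * exp (- (c * t))) * W a s) (t / 2) t <= RInt (fun s => W a s * E s) (t / 2) t).
  { apply RInt_le; try lra.
    - apply (ex_RInt_continuous (V := R_CompleteNormedModule)). intros z Hz.
      rewrite Rmin_left in Hz by lra.
      apply (continuous_mult (K := R_AbsRing)); [apply continuous_const|apply continuous_W; lra].
    - apply (ex_RInt_continuous (V := R_CompleteNormedModule)). intros z Hz.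
      rewrite Rmin_left in Hz by lra. apply Hc2; lra.
    - intros s Hs. rewrite Rmult_comm. apply Rmult_le_compat_l; [apply Rlt_le, W_pos|]. apply Hmono; lra. }
  assert (H3 : RInt (fun s => (E t * exp (- (c * t))) * W a s) (t / 2) t = (E t * exp (- (c * t))) * I0).
  { apply (RInt_scal (V := R_CompleteNormedModule) (W a)).
    apply (ex_RInt_continuous (V := R_CompleteNormedModule)). intros z Hz.
    rewrite Rmin_left in Hz by lra. apply continuous_W; lra. }
  assert (H4 : INR (S k) * (y t * y t) <= E t).
  { unfold E. generalize (Rle_0_sqr (g t)). unfold Rsqr. intros.
    assert (0 <= t * (g t * g t)) by (apply Rmult_le_pos; lra). lra. }
  assert (H5 : INR (S k) * (y t * y t) * (exp (- (c * t)) * I0) <= 2 * (INR (S k) * lag_norm (S k) a)).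
  { eapply Rle_trans; [apply Rmult_le_compat_r; [|exact H4]|].
    - apply Rmult_le_pos; [apply Rlt_le, exp_pos|lra].
    - lra. }
  rewrite exp_Ropp in H5. generalize (exp_pos (c * t)); intros He.
  apply Rmult_le_reg_r with (INR (S k) * (/ exp (c * t) * I0)).
  { apply Rmult_lt_0_compat; auto. apply Rmult_lt_0_compat; auto. apply Rinv_0_lt_compat; auto. }
  replace (2 * exp (c * t) / I0 * lag_norm (S k) a * (INR (S k) * (/ exp (c * t) * I0))) with
    (2 * (INR (S k) * lag_norm (S k) a)) by (field; lra).
  change (y t * y t * (INR (S k) * (/ exp (c * t) * I0)) <= 2 * (INR (S k) * lag_norm (S k) a)). lra.
Qed.

(** * The Laguerre kernels *)

Definition lag_kernel (n : nat) (a s : R) : R := W a s * Laguerre n a s / lag_norm n a.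

Lemma lag_kernel_recurrence (n : nat) (a s : R) : -1 < a ->
  (INR n + 2 + a) * lag_kernel (S (S n)) a s =
  (2 * INR n + 3 + a - s) * lag_kernel (S n) a s - (INR n + 1) * lag_kernel n a s.
Proof.
  intros Ha. unfold lag_kernel. rewrite (lag_norm_S (S n)), (lag_norm_S n) by auto.
  generalize (lag_norm_pos n a Ha), (pos_INR n), (Laguerre_recurrence n a s). intros H1 H2 E.
  assert (E2 : Laguerre (S (S n)) a s = ((2 * INR n + 3 + a - s) * Laguerre (S n) a s -
     (INR n + 1 + a) * Laguerre n a s) / (INR n + 2)).
  { rewrite <- E, !S_INR. field. lra. }
  rewrite E2, S_INR. field. repeat split; lra.
Qed.

(** Division by h_n exchanges the outer coefficients n + 1 and n + 1 + a of the three-term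
    recurrence. The recurrences in [t] and in [s] are thus adjoint, and their combination telescopes
    to the two top terms. *)
Lemma christoffel_darboux (m : nat) (a t s : R) : -1 < a ->
  (t - s) * sum_f_R0 (fun n => Laguerre n a t * lag_kernel n a s) m =
  (INR m + 1 + a) * Laguerre m a t * lag_kernel (S m) a s -
  (INR m + 1) * Laguerre (S m) a t * lag_kernel m a s.
Proof.
  intros Ha. induction m as [|m IH].
  - cbn [sum_f_R0]. rewrite Laguerre_0, Laguerre_1.
    unfold lag_kernel. rewrite lag_norm_S, Laguerre_0, Laguerre_1 by auto.
    generalize (lag_norm_pos 0 a Ha). intros. simpl. field. lra.
  - cbn [sum_f_R0]. rewrite Rmult_plus_distr_l, IH.
    generalize (lag_kernel_recurrence m a s Ha), (Laguerre_recurrence m a t). rewrite !S_INR. intros E1 E2.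
    replace ((INR m + 1 + 1 + a) * Laguerre (S m) a t * lag_kernel (S (S m)) a s) with
      (Laguerre (S m) a t * ((INR m + 2 + a) * lag_kernel (S (S m)) a s)) by ring.
    rewrite E1.
    rewrite E2. ring.
Qed.

Lemma integrable_lag_kernel_mul (n : nat) (a : R) (P : R -> R) : -1 < a -> poly_growth P ->
  integrable (fun s => lag_kernel n a s * P s).
Proof.
  intros Ha HP. apply integrable_ext with (fun s => / lag_norm n a * (W a s * (Laguerre n a s * P s))).
  - intros s Hs. unfold lag_kernel. field. generalize (lag_norm_pos n a Ha); lra.
  - apply integrable_scal, integrable_W; auto. apply poly_growth_mult; auto. apply poly_growth_Laguerre.
Qed.

(** The kernel of index 0 is the normalised Gamma density, and the others are exact derivatives by
    Rodrigues' identity. Partial-sum kernels therefore have mass 1 (as L_0 = 1), which is what fixes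
    the endpoint u = 0 of the path. *)
Lemma is_int_lag_kernel (n : nat) (a : R) : -1 < a ->
  is_int (lag_kernel n a) (match n with 0%nat => 1 | S _ => 0 end).
Proof.
  intros Ha. generalize (lag_norm_pos n a Ha). intros Hn. destruct n as [|n].
  - assert (H := is_int_scal (V := R_NormedModule) _ (/ lag_norm 0 a) _ (is_int_Gam (a + 1) ltac:(lra))).
    replace 1 with (/ lag_norm 0 a * Gam (a + 1)).
    + refine (is_int_extR _ _ _ _ H). intros s Hs.
      change (/ lag_norm 0 a * W (a + 1 - 1) s = lag_kernel 0 a s).
      unfold lag_kernel. rewrite Laguerre_0. replace (a + 1 - 1) with a by ring. field. lra.
    + assert (E : lag_norm 0 a = Gam (a + 1)) by (unfold lag_norm; simpl; rewrite Rplus_0_l; field).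
      rewrite E in *. field. lra.
  - assert (H := is_int_W_deriv a (Laguerre n (a + 1)) (Laguerre' n (a + 1)) Ha (poly_growth_Laguerre _ _)
      (poly_growth_Laguerre' _ _) (fun s => is_derive_Laguerre n (a + 1) s)).
    assert (H2 := is_int_scal (V := R_NormedModule) _ (/ (INR (S n) * lag_norm (S n) a)) _ H).
    replace 0 with (/ (INR (S n) * lag_norm (S n) a) * 0) by ring.
    refine (is_int_extR _ _ _ _ H2). intros s Hs.
    change (/ (INR (S n) * lag_norm (S n) a) * (W a s * ((a + 1 - s) * Laguerre n (a + 1) s + s * Laguerre' n (a + 1) s)) =
      lag_kernel (S n) a s).
    rewrite Laguerre_rodrigues. unfold lag_kernel. field. split; [lra|]. apply not_0_INR; lia.
Qed.

(** Discrete comparison of the sum of n^(-q) with the integral of x^(-q): the right side telescopes.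
    It follows from ln(n/(n+1)) <= -1/(n+1) and e^y >= 1 + y. *)
Lemma Rpower_tail_step (q : R) (n : nat) : 1 < q -> (1 <= n)%nat ->
  Rpower (INR (S n)) (- q) <= / (q - 1) * (Rpower (INR n) (1 - q) - Rpower (INR (S n)) (1 - q)).
Proof.
  intros Hq Hn. assert (Hn0 : 0 < INR n) by (apply lt_0_INR; lia).
  rewrite S_INR. set (x := INR n) in *.
  assert (E1 : Rpower (x + 1) (- q) = Rpower (x + 1) (1 - q) / (x + 1)).
  { replace (- q) with (1 - q + - (1)) by ring. rewrite Rpower_plus, (Rpower_Ropp _ 1), Rpower_1 by lra. reflexivity. }
  assert (E2 : Rpower x (1 - q) = Rpower (x + 1) (1 - q) * exp ((1 - q) * ln (x / (x + 1)))).
  { unfold Rpower. rewrite <- exp_plus. f_equal. unfold Rdiv. rewrite ln_mult, ln_Rinv; try lra.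
    apply Rinv_0_lt_compat; lra. }
  rewrite E1, E2.
  set (P := Rpower (x + 1) (1 - q)). assert (HP : 0 < P) by apply exp_pos.
  assert (Hi : 0 < / (x + 1)) by (apply Rinv_0_lt_compat; lra).
  assert (Hl : ln (x / (x + 1)) <= - / (x + 1)).
  { replace (x / (x + 1)) with (1 + - / (x + 1)) by (field; lra). apply ln_1p_le.
    assert (/ (x + 1) < 1) by (rewrite <- Rinv_1; apply Rinv_lt_contravar; lra). lra. }
  assert (He : 1 + (q - 1) * / (x + 1) <= exp ((1 - q) * ln (x / (x + 1)))).
  { generalize (exp_ineq1_le ((1 - q) * ln (x / (x + 1)))). nra. }
  apply Rmult_le_reg_l with (q - 1); [lra|]. rewrite <- Rmult_assoc, Rinv_r, Rmult_1_l by lra.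
  unfold Rdiv. nra.
Qed.

(** This is c times the j-th derivative of s^(b+j) e^(-s). With the factorial kept and [c] fixed,
    differentiation just moves (j, b+1) to (j+1, b). For c = 1/Gamma(n+a+1) the chain runs from the
    resolvent kernel, (0, a+n), to the Laguerre kernel, (n, a). *)
Definition rodrigues (c : R) (j : nat) (b s : R) : R := c * (INR (fact j) * (W b s * Laguerre j b s)).

Lemma integrable_rodrigues (c : R) (j : nat) (b : R) : -1 < b -> integrable (rodrigues c j b).
Proof.
  intros Hb. unfold rodrigues. do 2 apply integrable_scal. apply integrable_W; auto. apply poly_growth_Laguerre.
Qed.

Lemma vanishing_scal_l (c : R) (k : R -> R) : vanishing k -> vanishing (fun s => c * k s).
Proof.
  intros Hk eps He. assert (Hc : 0 < Rabs c + 1) by (generalize (Rabs_pos c); lra).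
  destruct (Hk (eps / (Rabs c + 1))) as (d & Hd & r & H); [apply Rdiv_lt_0_compat; auto|].
  assert (Hb : forall z, Rabs z < eps / (Rabs c + 1) -> Rabs (c * z) < eps).
  { intros z Hz. rewrite Rabs_mult.
    apply Rle_lt_trans with ((Rabs c + 1) * Rabs z); [apply Rmult_le_compat_r; [apply Rabs_pos|lra]|].
    apply Rmult_lt_compat_l with (r := Rabs c + 1) in Hz; auto.
    replace ((Rabs c + 1) * (eps / (Rabs c + 1))) with eps in Hz by (field; lra). auto. }
  exists d. split; auto. exists r. intros a b Ha Had Hr. destruct (H a b Ha Had Hr). split; auto.
Qed.

Lemma vanishing_rodrigues (c : R) (j : nat) (b : R) : -1 < b -> vanishing (rodrigues c j (b + 1)).
Proof.
  intros Hb. unfold rodrigues. do 2 apply vanishing_scal_l. apply vanishing_W; auto. apply poly_growth_Laguerre.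
Qed.

Lemma is_derive_rodrigues (c : R) (j : nat) (b s : R) : 0 < s ->
  is_derive (rodrigues c j (b + 1)) s (rodrigues c (S j) b s).
Proof.
  intros Hs. unfold rodrigues. evar_last.
  - apply (is_derive_scal (fun s => INR (fact j) * (W (b + 1) s * Laguerre j (b + 1) s))).
    apply (is_derive_scal (fun s => W (b + 1) s * Laguerre j (b + 1) s)).
    apply (is_derive_mult (W (b + 1)) (Laguerre j (b + 1))); [apply is_derive_W; auto|apply is_derive_Laguerre|].
    intros; apply Rmult_comm.
  - rewrite fact_simpl, mult_INR.
    change (c * (INR (fact j) * (W b s * (b + 1 - s) * Laguerre j (b + 1) s + W (b + 1) s * Laguerre' j (b + 1) s)) =
      c * (INR (S j) * INR (fact j) * (W b s * Laguerre (S j) b s))).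
    rewrite W_succ by auto.
    replace (INR (S j) * INR (fact j) * (W b s * Laguerre (S j) b s)) with
      (INR (fact j) * (W b s * (INR (S j) * Laguerre (S j) b s))) by ring.
    rewrite <- Laguerre_rodrigues. ring.
Qed.

Lemma rodrigues_lag_kernel (n : nat) (a s : R) : -1 < a ->
  rodrigues (/ Gam (INR n + a + 1)) n a s = lag_kernel n a s.
Proof.
  intros Ha. unfold rodrigues, lag_kernel, lag_norm.
  assert (0 < Gam (INR n + a + 1)) by (apply Gam_pos; generalize (pos_INR n); lra).
  generalize (INR_fact_pos n). intros. field. split; lra.
Qed.

Lemma rodrigues_resolvent (n : nat) (a s : R) :
  rodrigues (/ Gam (INR n + a + 1)) 0 (a + INR n) s =
  Rpower s (INR n + a + 1 - 1) * exp (- s) / Gam (INR n + a + 1).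
Proof.
  unfold rodrigues, W. rewrite Laguerre_0. replace (a + INR n) with (INR n + a + 1 - 1) by ring.
  simpl (INR (fact 0)). unfold Rdiv. ring.
Qed.

Lemma is_int_rodrigues_abs_le (n p : nat) (a v : R) : -1 < a -> (p <= n)%nat ->
  is_int (fun s => Rabs (rodrigues (/ Gam (INR n + a + 1)) (n - p) (a + INR p) s)) v ->
  v <= (1 + Gam (INR p + a + 1)) / 2 * sqrt (INR (fact (n - p)) / INR (fact n) / lag_norm n a).
Proof.
  intros Ha Hp Hv.
  assert (Hb : -1 < a + INR p) by (generalize (pos_INR p); lra).
  set (G := Gam (INR n + a + 1)) in *.
  assert (HG : 0 < G) by (apply Gam_pos; generalize (pos_INR n); lra).
  set (r := INR (fact (n - p)) / G).
  assert (Hr : 0 < r) by (apply Rdiv_lt_0_compat; auto; apply INR_fact_pos).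
  replace (INR (fact (n - p)) / INR (fact n) / lag_norm n a) with r.
  2:{ unfold r, lag_norm. fold G. generalize (INR_fact_pos n), (INR_fact_pos (n - p)). intros. field. split; lra. }
  assert (H1 : is_int (fun s => Rabs (W (a + INR p) s * Laguerre (n - p) (a + INR p) s)) (/ r * v)).
  { refine (is_int_extR _ _ _ _ (is_int_scal (V := R_NormedModule) _ (/ r) _ Hv)). intros s Hs.
    change (/ r * Rabs (rodrigues (/ G) (n - p) (a + INR p) s) = Rabs (W (a + INR p) s * Laguerre (n - p) (a + INR p) s)).
    unfold rodrigues. rewrite <- Rmult_assoc, Rabs_mult.
    replace (/ G * INR (fact (n - p))) with r by (unfold r, Rdiv; ring).
    rewrite (Rabs_pos_eq r) by lra. field. lra. }
  assert (Hq : 0 < sqrt r) by (apply sqrt_lt_R0; auto).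
  (* The choice eps = sqrt(r) makes both terms multiples of sqrt(r). Exact Cauchy-Schwarz would give
     sqrt(Gamma(p+a+1)) in place of (1 + Gamma(p+a+1))/2, a difference independent of n. *)
  apply (is_int_Laguerre_abs_le (n - p) (a + INR p) (sqrt r)) in H1; auto.
  replace (INR (n - p) + (a + INR p) + 1) with (INR n + a + 1) in H1 by (rewrite minus_INR by auto; ring).
  replace (a + INR p + 1) with (INR p + a + 1) in H1 by ring.
  fold G in H1.
  replace (G / INR (fact (n - p))) with (/ r) in H1.
  2:{ unfold r. generalize (INR_fact_pos (n - p)). intros. field. split; lra. }
  assert (Er : r = sqrt r * sqrt r) by (rewrite sqrt_sqrt; lra).
  set (q := sqrt r) in *. set (Gp := Gam (INR p + a + 1)) in *.
  apply Rmult_le_compat_l with (r := r) in H1; [|lra].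
  replace (r * (/ r * v)) with v in H1 by (field; lra).
  eapply Rle_trans; [exact H1|]. rewrite Er. apply Req_le. field. lra.
Qed.

(** * Bounded semigroups *)

Lemma vnorm_ge_0 {X : BanachSpace} (x : X) : 0 <= vnorm x.
Proof. exact (norm_ge_0 x). Qed.

Lemma vnorm_vadd_le {X : BanachSpace} (x y : X) (a b : R) :
  vnorm x <= a -> vnorm y <= b -> vnorm (vadd x y) <= a + b.
Proof. generalize (vnorm_triangle X x y). lra. Qed.

Lemma vnorm_vsub_le {X : BanachSpace} (x y : X) (a b : R) :
  vnorm x <= a -> vnorm y <= b -> vnorm (vsub x y) <= a + b.
Proof. intros. apply vnorm_vadd_le; auto. rewrite vnorm_opp. auto. Qed.

Lemma is_derive_vnorm {X : BanachSpace} (f : R -> X) (s : R) (l : X) :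
  (forall eps, 0 < eps -> exists d, 0 < d /\ forall r, Rabs (r - s) < d ->
     vnorm (vsub (vsub (f r) (f s)) (vscal (r - s) l)) <= eps * Rabs (r - s)) ->
  is_derive f s l.
Proof.
  intros H. split; [apply (is_linear_scal_l l)|].
  intros s' Hs'. assert (E := is_filter_lim_locally_unique _ _ Hs'). simpl in E. subst s'.
  intros eps. destruct (H eps (cond_pos eps)) as (d & Hd & H1).
  exists (mkposreal d Hd). intros r Hr. exact (H1 r Hr).
Qed.

Lemma continuous_vnorm {X : BanachSpace} (f : R -> X) (s : R) :
  (forall eps, 0 < eps -> exists d, 0 < d /\ forall r, Rabs (r - s) < d ->
     vnorm (vsub (f r) (f s)) < eps) -> continuous f s.
Proof.
  intros H P [eps HP]. destruct (H eps (cond_pos eps)) as (d & Hd & H1).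
  exists (mkposreal d Hd). intros r Hr. apply HP. exact (H1 r Hr).
Qed.

Lemma is_derive_vscal {X : BanachSpace} (k : R -> R) (f : R -> X) (s k' : R) (f' : X) :
  is_derive k s k' -> is_derive f s f' ->
  is_derive (fun s => vscal (k s) (f s)) s (vadd (vscal k' (f s)) (vscal (k s) f')).
Proof.
  intros Hk Hf.
  refine (filterdiff_ext_lin _ _ _ (filterdiff_scal_fct s k f _ _ Rmult_comm Hk Hf) _).
  intros r. change (vadd (vscal (r * k') (f s)) (vscal (k s) (vscal r f')) =
    vscal r (vadd (vscal k' (f s)) (vscal (k s) f'))). vec.
Qed.

Lemma Apow_snoc (X : BanachSpace) (T : R -> X -> X) (p : nat) : forall x y z,
  Apow X T p x y -> genA X T y z -> Apow X T (S p) x z.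
Proof.
  induction p as [|p IH]; intros x y z Hp Hg.
  - simpl in Hp. subst y. exists z. split; [auto|reflexivity].
  - destruct Hp as (u & Hu & Hp). exists u. split; auto. apply (IH u y z); auto.
Qed.

Lemma Apow_split (X : BanachSpace) (T : R -> X -> X) (p q : nat) : forall x z,
  Apow X T (p + q) x z -> exists y, Apow X T p x y /\ Apow X T q y z.
Proof.
  induction p as [|p IH]; intros x z H.
  - exists x. split; [reflexivity|auto].
  - destruct H as (u & Hu & H). destruct (IH u z H) as (y & H1 & H2).
    exists y. split; auto. exists u. auto.
Qed.

Lemma linear_vadd {X : BanachSpace} (L : X -> X) (x y : X) :
  is_linear L -> L (vadd x y) = vadd (L x) (L y).
Proof. intros HL. exact (linear_plus L HL x y). Qed.

Lemma linear_vsub {X : BanachSpace} (L : X -> X) (x y : X) :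
  is_linear L -> L (vsub x y) = vsub (L x) (L y).
Proof. intros HL. exact (linear_minus L x y HL). Qed.

Lemma linear_vscal {X : BanachSpace} (L : X -> X) (a : R) (x : X) :
  is_linear L -> L (vscal a x) = vscal a (L x).
Proof. intros HL. exact (linear_scal L HL a x). Qed.

Section Semigroup.
Variables (X : BanachSpace) (T : R -> X -> X) (K : R).
Hypothesis HC0 : C0_semigroup X T.
Hypothesis HK : 0 < K.
Hypothesis HT : unif_bounded X T K.

Lemma sg_linear (t : R) : 0 <= t -> is_linear (T t).
Proof.
  intros Ht. destruct HC0 as (H1 & _). destruct (H1 t Ht) as (Ha & Hs & _).
  split; auto. exists K. split; auto. intros x. apply (HT t x Ht).
Qed.

Lemma sg_add (t : R) (x y : X) : 0 <= t -> T t (vadd x y) = vadd (T t x) (T t y).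
Proof. intros Ht. apply linear_vadd, sg_linear; auto. Qed.

Lemma sg_scal (t a : R) (x : X) : 0 <= t -> T t (vscal a x) = vscal a (T t x).
Proof. intros Ht. apply linear_vscal, sg_linear; auto. Qed.

Lemma sg_sub (t : R) (x y : X) : 0 <= t -> T t (vsub x y) = vsub (T t x) (T t y).
Proof. intros Ht. apply linear_vsub, sg_linear; auto. Qed.

Lemma sg_zero (x : X) : T 0 x = x.
Proof. apply HC0. Qed.

Lemma sg_plus (t s : R) (x : X) : 0 <= t -> 0 <= s -> T (t + s) x = T t (T s x).
Proof. apply HC0. Qed.

Lemma sg_bound (t a : R) (x : X) : 0 <= t -> vnorm x <= a -> vnorm (T t x) <= K * a.
Proof.
  intros Ht Hx. eapply Rle_trans; [apply (HT t x Ht)|]. apply Rmult_le_compat_l; lra.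
Qed.

Lemma sg_diff_le (a b : R) (x : X) : 0 <= a -> 0 <= b ->
  vnorm (vsub (T b x) (T a x)) <= K * vnorm (vsub (T (Rabs (b - a)) x) x).
Proof.
  assert (H : forall a b, 0 <= a -> a <= b -> vnorm (vsub (T b x) (T a x)) <= K * vnorm (vsub (T (b - a) x) x)).
  { intros u v Hu Huv. replace (T v x) with (T u (T (v - u) x)).
    - rewrite <- sg_sub by auto. apply HT; auto.
    - rewrite <- sg_plus by lra. f_equal. ring. }
  intros Ha Hb. destruct (Rle_dec a b).
  - rewrite Rabs_pos_eq by lra. auto.
  - rewrite vsub_anti, Rabs_minus_sym, Rabs_pos_eq by lra. apply H; lra.
Qed.

Lemma sg_small (x : X) (eps : R) : 0 < eps -> exists d, 0 < d /\
  forall h, 0 <= h -> h < d -> vnorm (vsub (T h x) x) < eps.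
Proof.
  intros He. destruct HC0 as (_ & H0 & _ & H). destruct (H x eps He) as (d & Hd & H1).
  exists d. split; auto. intros h Hh Hhd. destruct (Req_dec h 0) as [->|].
  - rewrite H0, vsub_self, vnorm_zero. auto.
  - apply H1; lra.
Qed.

(** Extending orbits evenly to negative times makes them continuous on the whole line, so Riemann
    integrals over intervals touching 0 need no one-sided argument. *)
Lemma sg_continuous_abs (x : X) (s : R) : continuous (fun s => T (Rabs s) x) s.
Proof.
  apply continuous_vnorm. intros eps He.
  destruct (sg_small x (eps / K)) as (d & Hd & H); [apply Rdiv_lt_0_compat; auto|].
  exists d. split; auto. intros r Hr.
  eapply Rle_lt_trans; [apply sg_diff_le; apply Rabs_pos|].
  assert (H1 : vnorm (vsub (T (Rabs (Rabs r - Rabs s)) x) x) < eps / K).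
  { apply H; [apply Rabs_pos|]. eapply Rle_lt_trans; [apply Rabs_triang_inv2|auto]. }
  apply Rmult_lt_compat_l with (r := K) in H1; auto.
  replace (K * (eps / K)) with eps in H1 by (field; lra). auto.
Qed.

Lemma sg_continuous (x : X) (s : R) : 0 < s -> continuous (fun s => T s x) s.
Proof.
  intros Hs. apply continuous_ext_loc with (fun s => T (Rabs s) x); [|apply sg_continuous_abs].
  exists (mkposreal s Hs). intros y Hy. rewrite Rabs_pos_eq; auto.
  change (Rabs (y - s) < s) in Hy. apply Rabs_def2 in Hy. lra.
Qed.

Lemma genA_increment (x y : X) : genA X T x y -> forall eps, 0 < eps ->
  exists d, 0 < d /\ forall h, 0 < h -> h < d -> vnorm (vadd (vsub (T h x) x) (vscal h y)) <= eps * h.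
Proof.
  intros H eps He. destruct (H eps He) as (d & Hd & H1). exists d. split; auto. intros h Hh Hhd.
  specialize (H1 h Hh Hhd).
  replace (vadd (vsub (T h x) x) (vscal h y)) with (vscal h (vadd (vscal (/ h) (vsub (T h x) x)) y))
    by (vec; field; lra).
  rewrite vnorm_scal, Rabs_pos_eq by lra. rewrite Rmult_comm. apply Rmult_le_compat_r; lra.
Qed.

Lemma genA_intro (x y : X) :
  (forall eps, 0 < eps -> exists d, 0 < d /\ forall h, 0 < h -> h < d ->
    vnorm (vadd (vsub (T h x) x) (vscal h y)) <= eps * h) -> genA X T x y.
Proof.
  intros H eps He. destruct (H (eps / 2)) as (d & Hd & H1); [lra|].
  exists d. split; auto. intros h Hh Hhd. specialize (H1 h Hh Hhd).
  replace (vadd (vscal (/ h) (vsub (T h x) x)) y) with (vscal (/ h) (vadd (vsub (T h x) x) (vscal h y)))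
    by (vec; field; lra).
  assert (Hi : 0 < / h) by (apply Rinv_0_lt_compat; auto).
  rewrite vnorm_scal, Rabs_pos_eq by lra.
  apply Rle_lt_trans with (/ h * (eps / 2 * h)); [apply Rmult_le_compat_l; lra|].
  replace (/ h * (eps / 2 * h)) with (eps / 2) by (field; lra). lra.
Qed.

(** The generator only gives a right derivative at 0. For r < s the increment is expanded from the
    left point [r], and continuity of the orbit of [y] moves T(r) y to T(s) y. *)
Lemma sg_derive (x y : X) (s : R) : genA X T x y -> 0 < s ->
  is_derive (fun s => T s x) s (vopp (T s y)).
Proof.
  intros Hg Hs. apply is_derive_vnorm. intros eps He.
  destruct (genA_increment x y Hg (eps / (2 * K))) as (d1 & Hd1 & H1).
  { apply Rdiv_lt_0_compat; lra. }
  destruct (sg_small y (eps / (2 * K))) as (d2 & Hd2 & H2).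
  { apply Rdiv_lt_0_compat; lra. }
  assert (HK2 : K * (eps / (2 * K)) = eps / 2) by (field; lra).
  exists (Rmin s (Rmin d1 d2)). split; [repeat apply Rmin_glb_lt; auto|].
  intros r Hr. generalize (Rmin_l s (Rmin d1 d2)), (Rmin_r s (Rmin d1 d2)), (Rmin_l d1 d2), (Rmin_r d1 d2). intros.
  destruct (Rtotal_order r s) as [Hlt|[Heq|Hgt]].
  - assert (Ea : Rabs (r - s) = s - r) by (rewrite Rabs_minus_sym, Rabs_pos_eq; lra).
    rewrite Ea in *. assert (Hr0 : 0 < r) by lra. set (h := s - r) in *.
    assert (E : T s x = T r (T h x)) by (rewrite <- sg_plus by (unfold h in *; lra); f_equal; unfold h; ring).
    rewrite E.
    replace (vsub (vsub (T r x) (T r (T h x))) (vscal (r - s) (vopp (T s y)))) with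
      (vsub (vscal h (vsub (T r y) (T s y))) (T r (vadd (vsub (T h x) x) (vscal h y)))).
    + apply Rle_trans with (h * (eps / 2) + K * (eps / (2 * K) * h)); [|apply Req_le; field; lra].
      apply vnorm_vsub_le.
      * rewrite vnorm_scal, Rabs_pos_eq by (unfold h in *; lra).
        apply Rmult_le_compat_l; [unfold h in *; lra|]. rewrite vsub_anti.
        eapply Rle_trans; [apply sg_diff_le; lra|]. rewrite Rabs_pos_eq by lra. fold h. rewrite <- HK2.
        apply Rmult_le_compat_l; [lra|]. apply Rlt_le, H2; unfold h in *; lra.
      * apply sg_bound; [unfold h in *; lra|]. apply H1; unfold h in *; lra.
    + rewrite sg_add, sg_sub, sg_scal by (unfold h in *; lra). vec; unfold h; ring.
  - subst r. replace (vsub (vsub (T s x) (T s x)) (vscal (s - s) (vopp (T s y)))) with (vzero : X) by vec.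
    rewrite vnorm_zero. apply Rmult_le_pos; [lra|apply Rabs_pos].
  - assert (Ea : Rabs (r - s) = r - s) by (rewrite Rabs_pos_eq; lra).
    rewrite Ea in *. set (h := r - s) in *.
    assert (E : T r x = T s (T h x)) by (rewrite <- sg_plus by (unfold h in *; lra); f_equal; unfold h; ring).
    rewrite E.
    replace (vsub (vsub (T s (T h x)) (T s x)) (vscal h (vopp (T s y)))) with
      (T s (vadd (vsub (T h x) x) (vscal h y))).
    + apply Rle_trans with (K * (eps / (2 * K) * h)).
      * apply sg_bound; [lra|]. apply H1; unfold h in *; lra.
      * replace (K * (eps / (2 * K) * h)) with (eps / 2 * h) by (field; lra).
        apply Rmult_le_compat_r; unfold h in *; lra.
    + rewrite sg_add, sg_sub, sg_scal by lra. vec.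
Qed.

(** On [u, b] with u > 0 this is the integral of z - T(s) y. Two-sided derivatives are available at
    positive times only, so a = 0 is reached by letting u tend to 0. *)
Lemma sg_mean_value (x y z : X) (a b eps : R) : genA X T x y -> 0 <= a -> a <= b ->
  (forall s, a <= s -> s <= b -> vnorm (vsub (T s y) z) <= eps) ->
  vnorm (vadd (vsub (T b x) (T a x)) (vscal (b - a) z)) <= eps * (b - a).
Proof.
  intros Hg Ha Hab Hz.
  assert (Hpos : forall u, 0 < u -> a <= u -> u <= b ->
    vnorm (vadd (vsub (T b x) (T u x)) (vscal (b - u) z)) <= eps * (b - u)).
  { intros u Hu Hau Hub.
    assert (HI : is_RInt (fun s => vopp (T s y)) u b (vsub (T b x) (T u x))).
    { apply (is_RInt_derive (fun s => T s x)); rewrite Rmin_left, Rmax_right by lra; intros s Hs.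
      - apply sg_derive; auto; lra.
      - apply (continuous_opp (fun s => T s y)). apply sg_continuous; lra. }
    assert (HI2 := is_RInt_plus _ _ _ _ _ _ HI (is_RInt_const u b z)).
    rewrite Rmult_comm. refine (norm_RInt_le_const _ u b _ eps Hub _ HI2).
    intros s Hs. change (vnorm (vadd (vopp (T s y)) z) <= eps).
    replace (vadd (vopp (T s y)) z) with (vopp (vsub (T s y) z)) by vec.
    rewrite vnorm_opp. apply Hz; lra. }
  destruct (Rle_lt_or_eq_dec 0 a Ha) as [Ha'|Ha']; [apply Hpos; lra|]. subst a.
  destruct (Rle_lt_or_eq_dec 0 b Hab) as [Hb|Hb].
  2:{ subst b. rewrite Rminus_0_r, Rmult_0_r.
      replace (vadd (vsub (T 0 x) (T 0 x)) (vscal 0 z)) with (vzero : X) by vec. rewrite vnorm_zero. lra. }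
  assert (He : 0 <= eps).
  { eapply Rle_trans; [apply (vnorm_ge_0 (vsub (T b y) z))|apply Hz; lra]. }
  apply le_epsilon. intros eta Heta.
  destruct (sg_small x (eta / 2)) as (d & Hd & H); [lra|].
  set (q := vnorm z + 1). assert (Hq : 0 < q) by (unfold q; generalize (vnorm_ge_0 z); lra).
  set (u := Rmin (Rmin (d / 2) b) (eta / 2 / q)).
  assert (Hu : 0 < u).
  { repeat apply Rmin_glb_lt; try lra. apply Rdiv_lt_0_compat; lra. }
  assert (u <= d / 2) by (eapply Rle_trans; apply Rmin_l).
  assert (u <= b) by (eapply Rle_trans; [apply Rmin_l|apply Rmin_r]).
  assert (Huq : u * q <= eta / 2).
  { apply Rle_trans with (eta / 2 / q * q); [apply Rmult_le_compat_r; [lra|apply Rmin_r]|].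
    apply Req_le. field. lra. }
  replace (vadd (vsub (T b x) (T 0 x)) (vscal (b - 0) z)) with
    (vadd (vadd (vsub (T b x) (T u x)) (vscal (b - u) z)) (vadd (vsub (T u x) x) (vscal u z)))
    by (rewrite sg_zero; vec).
  apply vnorm_vadd_le.
  - eapply Rle_trans; [apply Hpos; lra|]. apply Rmult_le_compat_l; lra.
  - replace eta with (eta / 2 + eta / 2) by field. apply vnorm_vadd_le.
    + apply Rlt_le, H; lra.
    + rewrite vnorm_scal, Rabs_pos_eq by lra. eapply Rle_trans; [|exact Huq].
      apply Rmult_le_compat_l; unfold q; lra.
Qed.

Lemma sg_lipschitz (x y : X) (a b : R) : genA X T x y -> 0 <= a -> 0 <= b ->
  vnorm (vsub (T b x) (T a x)) <= K * vnorm y * Rabs (b - a).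
Proof.
  intros Hg.
  assert (H : forall u v, 0 <= u -> u <= v -> vnorm (vsub (T v x) (T u x)) <= K * vnorm y * (v - u)).
  { intros u v Hu Huv.
    replace (vsub (T v x) (T u x)) with (vadd (vsub (T v x) (T u x)) (vscal (v - u) vzero)) by vec.
    apply (sg_mean_value x y); auto. intros s Hs _.
    replace (vsub (T s y) vzero) with (T s y) by vec. apply HT; lra. }
  intros Ha Hb. destruct (Rle_dec a b).
  - rewrite Rabs_pos_eq by lra; auto.
  - rewrite vsub_anti, Rabs_minus_sym, Rabs_pos_eq by lra. apply H; lra.
Qed.

Lemma sg_taylor (x y y2 : X) (a b : R) : genA X T x y -> genA X T y y2 -> 0 <= a -> 0 <= b ->
  vnorm (vadd (vsub (T b x) (T a x)) (vscal (b - a) (T a y))) <= K * vnorm y2 * (Rabs (b - a) * Rabs (b - a)).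
Proof.
  intros Hg Hg2 Ha Hb.
  assert (HN : 0 <= K * vnorm y2) by (apply Rmult_le_pos; [lra|apply vnorm_ge_0]).
  rewrite <- Rmult_assoc. destruct (Rle_dec a b).
  - rewrite Rabs_pos_eq by lra. apply (sg_mean_value x y); auto.
    intros s Hs1 Hs2. eapply Rle_trans; [apply (sg_lipschitz y y2); auto; lra|].
    rewrite Rabs_pos_eq by lra. apply Rmult_le_compat_l; lra.
  - rewrite Rabs_minus_sym, Rabs_pos_eq by lra.
    replace (vadd (vsub (T b x) (T a x)) (vscal (b - a) (T a y))) with
      (vopp (vadd (vsub (T a x) (T b x)) (vscal (a - b) (T a y)))) by vec.
    rewrite vnorm_opp. apply (sg_mean_value x y); auto; try lra.
    intros s Hs1 Hs2. eapply Rle_trans; [apply (sg_lipschitz y y2); auto; lra|].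
    rewrite Rabs_minus_sym, Rabs_pos_eq by lra. apply Rmult_le_compat_l; lra.
Qed.

Lemma genA_closed (x y : X) :
  (forall eps, 0 < eps -> exists x' y', genA X T x' y' /\
     vnorm (vsub x' x) <= eps /\ vnorm (vsub y' y) <= eps) -> genA X T x y.
Proof.
  intros H. apply genA_intro. intros eps He.
  destruct (sg_small y (eps / 2)) as (d & Hd & H1); [lra|].
  exists d. split; auto. intros h Hh Hhd.
  apply le_epsilon. intros eta Heta.
  (* The first entry controls T(s)(y' - y) inside the mean value estimate, the second the
     replacement of x' by x. The radius [d] was fixed from [y] alone, before any approximant is
     chosen. *)
  set (e0 := Rmin (eps / 2 / K) (eta / (K + 1))).
  assert (He0 : 0 < e0) by (apply Rmin_glb_lt; repeat apply Rdiv_lt_0_compat; lra).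
  assert (HKe : K * e0 <= eps / 2).
  { apply Rle_trans with (K * (eps / 2 / K)); [apply Rmult_le_compat_l; [lra|apply Rmin_l]|].
    apply Req_le; field; lra. }
  assert (HKe2 : (K + 1) * e0 <= eta).
  { apply Rle_trans with ((K + 1) * (eta / (K + 1))); [apply Rmult_le_compat_l; [lra|apply Rmin_r]|].
    apply Req_le; field; lra. }
  destruct (H e0 He0) as (x' & y' & Hg & Hx & Hy).
  assert (Hm : vnorm (vadd (vsub (T h x') (T 0 x')) (vscal (h - 0) y)) <= eps * (h - 0)).
  { apply (sg_mean_value x' y'); auto; try lra. intros s Hs1 Hs2.
    replace (vsub (T s y') y) with (vadd (T s (vsub y' y)) (vsub (T s y) y)) by (rewrite sg_sub by auto; vec).
    replace eps with (eps / 2 + eps / 2) by field. apply vnorm_vadd_le.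
    - eapply Rle_trans; [apply sg_bound; eauto|auto].
    - apply Rlt_le, H1; lra. }
  rewrite sg_zero, Rminus_0_r in Hm.
  replace (vadd (vsub (T h x) x) (vscal h y)) with
    (vadd (vadd (vsub (T h x') x') (vscal h y)) (vsub (vsub x' x) (T h (vsub x' x))))
    by (rewrite sg_sub by lra; vec).
  apply vnorm_vadd_le; auto.
  eapply Rle_trans; [|exact HKe2]. rewrite Rmult_plus_distr_r, Rmult_1_l, Rplus_comm.
  apply vnorm_vsub_le; auto. apply sg_bound; auto; lra.
Qed.

(** Bounded operators commuting with the semigroup preserve every D(A^p) and commute with A^p. The
    time operators, averages and kernel integrals all qualify. *)
Definition commuting (L : X -> X) : Prop :=
  is_linear L /\ forall t x, 0 <= t -> L (T t x) = T t (L x).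

Lemma commuting_sg (t : R) : 0 <= t -> commuting (T t).
Proof.
  intros Ht. split; [apply sg_linear; auto|]. intros s x Hs.
  rewrite <- !sg_plus by auto. f_equal. ring.
Qed.

Lemma genA_commuting (L : X -> X) (x y : X) : commuting L -> genA X T x y -> genA X T (L x) (L y).
Proof.
  intros [HL HLT] Hg. destruct (linear_norm L HL) as (C & HC & HN).
  apply genA_intro. intros eps He.
  destruct (genA_increment x y Hg (eps / C)) as (d & Hd & H); [apply Rdiv_lt_0_compat; auto|].
  exists d. split; auto. intros h Hh Hhd.
  replace (vadd (vsub (T h (L x)) (L x)) (vscal h (L y))) with (L (vadd (vsub (T h x) x) (vscal h y))).
  - eapply Rle_trans; [apply HN|]. apply Rle_trans with (C * (eps / C * h)).
    + apply Rmult_le_compat_l; [lra|]. apply H; auto.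
    + apply Req_le. field. lra.
  - rewrite <- HLT, linear_vadd, linear_vsub, linear_vscal by (auto; lra). reflexivity.
Qed.

Lemma Apow_commuting (L : X -> X) (p : nat) : commuting L -> forall x y,
  Apow X T p x y -> Apow X T p (L x) (L y).
Proof.
  intros HL. induction p as [|p IH]; intros x y H.
  - simpl in *. subst; auto.
  - destruct H as (u & Hu & H). exists (L u). split; [apply genA_commuting; auto|auto].
Qed.

(** * Averages and Laplace-type integrals of the semigroup *)

Lemma ex_RInt_sg (x : X) (a b : R) : ex_RInt (fun s => T (Rabs s) x) a b.
Proof. apply (ex_RInt_continuous (V := banach_CompleteNormedModule X)). intros; apply sg_continuous_abs. Qed.

Definition sgRInt (a b : R) (x : X) : X := RInt (fun s => T (Rabs s) x) a b.

Lemma is_RInt_sg (x : X) (a b : R) : is_RInt (fun s => T (Rabs s) x) a b (sgRInt a b x).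
Proof. apply (RInt_correct (V := banach_CompleteNormedModule X)). apply ex_RInt_sg. Qed.

Lemma sgRInt_unique (x v : X) (a b : R) : is_RInt (fun s => T (Rabs s) x) a b v -> sgRInt a b x = v.
Proof. apply (is_RInt_unique (V := banach_CompleteNormedModule X)). Qed.

Lemma sgRInt_increment (x : X) (a d e : R) : 0 <= a -> 0 <= d ->
  (forall r, 0 <= r -> r <= d -> vnorm (vsub (T r x) x) <= e) ->
  vnorm (vsub (sgRInt a (a + d) x) (vscal d (T a x))) <= d * (K * e).
Proof.
  intros Ha Hd He.
  assert (H := is_RInt_minus _ _ _ _ _ _ (is_RInt_sg x a (a + d)) (is_RInt_const a (a + d) (T a x))).
  replace d with (a + d - a) at 2 by ring. replace d with (a + d - a) at 3 by ring.
  refine (norm_RInt_le_const _ a (a + d) _ (K * e) _ _ H); [lra|].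
  intros s Hs. change (vnorm (vsub (T (Rabs s) x) (T a x)) <= K * e).
  rewrite Rabs_pos_eq by lra. eapply Rle_trans; [apply sg_diff_le; lra|].
  apply Rmult_le_compat_l; [lra|]. rewrite Rabs_pos_eq by lra. apply He; lra.
Qed.

Definition avg (h : R) (x : X) : X := vscal (/ h) (sgRInt 0 h x).

Lemma avg_bound (h : R) (x : X) : 0 < h -> vnorm (avg h x) <= K * vnorm x.
Proof.
  intros Hh. unfold avg. rewrite vnorm_scal, Rabs_pos_eq by (apply Rlt_le, Rinv_0_lt_compat; auto).
  apply Rmult_le_reg_l with h; auto. rewrite <- Rmult_assoc, Rinv_r, Rmult_1_l by lra.
  replace h with (h - 0) at 2 by ring.
  refine (norm_RInt_le_const _ 0 h _ (K * vnorm x) _ _ (is_RInt_sg x 0 h)); [lra|].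
  intros s Hs. apply HT. apply Rabs_pos.
Qed.

Lemma avg_linear (h : R) : 0 < h -> is_linear (avg h).
Proof.
  intros Hh. split.
  - intros x y. change (avg h (vadd x y) = vadd (avg h x) (avg h y)). unfold avg.
    rewrite (sgRInt_unique (vadd x y) (vadd (sgRInt 0 h x) (sgRInt 0 h y))); [vec|].
    refine (is_RInt_ext _ _ _ _ _ _ (is_RInt_plus _ _ _ _ _ _ (is_RInt_sg x 0 h) (is_RInt_sg y 0 h))).
    intros s Hs. symmetry. apply sg_add. apply Rabs_pos.
  - intros a x. change (avg h (vscal a x) = vscal a (avg h x)). unfold avg.
    rewrite (sgRInt_unique (vscal a x) (vscal a (sgRInt 0 h x))); [vec|].
    refine (is_RInt_ext _ _ _ _ _ _ (is_RInt_scal _ _ _ a _ (is_RInt_sg x 0 h))).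
    intros s Hs. symmetry. apply sg_scal. apply Rabs_pos.
  - exists K. split; auto. intros x. apply (avg_bound h x Hh).
Qed.

Lemma sg_sgRInt (t a b : R) (x : X) : 0 <= t -> T t (sgRInt a b x) = sgRInt a b (T t x).
Proof.
  intros Ht. symmetry. apply sgRInt_unique.
  refine (is_RInt_ext _ _ _ _ _ _ (is_RInt_linear (T t) _ _ _ _ (sg_linear t Ht) (is_RInt_sg x a b))).
  intros s Hs. apply (commuting_sg t Ht). apply Rabs_pos.
Qed.

Lemma avg_commuting (h : R) : 0 < h -> commuting (avg h).
Proof.
  intros Hh. split; [apply avg_linear; auto|]. intros t x Ht. unfold avg.
  rewrite sg_scal, sg_sgRInt by auto. reflexivity.
Qed.

Lemma avg_close (x : X) (eps : R) : 0 < eps ->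
  exists d, 0 < d /\ forall h, 0 < h -> h < d -> vnorm (vsub (avg h x) x) <= eps.
Proof.
  intros He. destruct (sg_small x (eps / K)) as (d & Hd & H); [apply Rdiv_lt_0_compat; auto|].
  exists d. split; auto. intros h Hh Hhd.
  assert (H1 := sgRInt_increment x 0 h (eps / K) ltac:(lra) ltac:(lra) (fun r Hr1 Hr2 => Rlt_le _ _ (H r Hr1 ltac:(lra)))).
  rewrite sg_zero, Rplus_0_l in H1. unfold avg.
  replace (vsub (vscal (/ h) (sgRInt 0 h x)) x) with (vscal (/ h) (vsub (sgRInt 0 h x) (vscal h x)))
    by (vec; field; lra).
  rewrite vnorm_scal, Rabs_pos_eq by (apply Rlt_le, Rinv_0_lt_compat; auto).
  apply Rmult_le_reg_l with h; auto. rewrite <- Rmult_assoc, Rinv_r, Rmult_1_l by lra.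
  replace (h * eps) with (h * (K * (eps / K))) by (field; lra). exact H1.
Qed.

(** Translating [0, h] by [d] cancels the overlap and leaves one slice of length [d] at each end.
    Divided by [d] these tend to T(h) x and x, so an average lies in D(A) for every x. *)
Lemma sgRInt_shift (d h : R) (x : X) : 0 <= d -> 0 <= h ->
  vsub (T d (sgRInt 0 h x)) (sgRInt 0 h x) = vsub (sgRInt h (h + d) x) (sgRInt 0 (0 + d) x).
Proof.
  intros Hd Hh.
  assert (E1 : T d (sgRInt 0 h x) = sgRInt d (h + d) x).
  { rewrite sg_sgRInt by auto. apply sgRInt_unique.
    assert (H := is_RInt_sg x (1 * 0 + d) (1 * h + d)). apply is_RInt_comp_lin in H.
    replace (1 * 0 + d) with d in H by ring. replace (1 * h + d) with (h + d) in H by ring.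
    refine (is_RInt_ext _ _ _ _ _ _ H). rewrite Rmin_left, Rmax_right by lra.
    intros s Hs. change (vscal 1 (T (Rabs (1 * s + d)) x) = T (Rabs s) (T d x)).
    rewrite vscal_1, !Rabs_pos_eq by lra. rewrite <- sg_plus by lra. f_equal. ring. }
  assert (E2 : vadd (sgRInt 0 (0 + d) x) (sgRInt d (h + d) x) = vadd (sgRInt 0 h x) (sgRInt h (h + d) x)).
  { rewrite Rplus_0_l. transitivity (sgRInt 0 (h + d) x).
    - exact (RInt_Chasles (V := banach_CompleteNormedModule X) _ 0 d (h + d) (ex_RInt_sg x _ _) (ex_RInt_sg x _ _)).
    - symmetry.
      exact (RInt_Chasles (V := banach_CompleteNormedModule X) _ 0 h (h + d) (ex_RInt_sg x _ _) (ex_RInt_sg x _ _)). }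
  rewrite E1.
  transitivity (vsub (vadd (sgRInt 0 (0 + d) x) (sgRInt d (h + d) x)) (vadd (sgRInt 0 (0 + d) x) (sgRInt 0 h x))); [vec|].
  rewrite E2. vec.
Qed.

Lemma genA_avg (h : R) (x : X) : 0 < h -> genA X T (avg h x) (vscal (/ h) (vsub x (T h x))).
Proof.
  intros Hh. apply genA_intro. intros eps He.
  set (e := eps * h / (2 * K)).
  assert (Hpe : 0 < e) by (apply Rdiv_lt_0_compat; [apply Rmult_lt_0_compat; auto|lra]).
  destruct (sg_small x e Hpe) as (d & Hd & H). exists d. split; auto. intros r Hr Hrd.
  assert (Hs : forall q, 0 <= q -> q <= r -> vnorm (vsub (T q x) x) <= e).
  { intros q Hq1 Hq2. apply Rlt_le, H; lra. }
  assert (H1 := sgRInt_increment x h r e ltac:(lra) ltac:(lra) Hs).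
  assert (H2 := sgRInt_increment x 0 r e ltac:(lra) ltac:(lra) Hs).
  rewrite sg_zero in H2.
  replace (vadd (vsub (T r (avg h x)) (avg h x)) (vscal r (vscal (/ h) (vsub x (T h x))))) with
    (vscal (/ h) (vsub (vsub (sgRInt h (h + r) x) (vscal r (T h x))) (vsub (sgRInt 0 (0 + r) x) (vscal r x)))).
  - rewrite vnorm_scal, Rabs_pos_eq by (apply Rlt_le, Rinv_0_lt_compat; auto).
    apply Rle_trans with (/ h * (r * (K * e) + r * (K * e))).
    + apply Rmult_le_compat_l; [apply Rlt_le, Rinv_0_lt_compat; auto|]. apply vnorm_vsub_le; auto.
    + apply Req_le. unfold e. field. lra.
  - unfold avg. rewrite sg_scal by lra.
    transitivity (vscal (/ h) (vadd (vsub (sgRInt h (h + r) x) (sgRInt 0 (0 + r) x)) (vscal r (vsub x (T h x))))); [vec|].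
    rewrite <- (sgRInt_shift r h x) by lra. vec.
Qed.

(** * Integrals of orbits against scalar kernels *)

Definition sgint (k : R -> R) (x : X) : X :=
  RInt_gen (fun s => vscal (k s) (T s x)) (at_right 0) (Rbar_locally p_infty).

Lemma continuous_scal_sg (k : R -> R) (x : X) (s : R) : continuous k s -> 0 < s ->
  continuous (fun s => vscal (k s) (T s x)) s.
Proof.
  intros Hk Hs. apply (continuous_scal k (fun s => T s x)); auto. apply sg_continuous; auto.
Qed.

Lemma is_int_sgint (k : R -> R) (x : X) : integrable k ->
  is_int (fun s => vscal (k s) (T s x)) (sgint k x).
Proof.
  intros [Hk [v Hv]]. unfold sgint. apply (RInt_gen_correct (V := banach_CompleteNormedModule X)).
  apply (ex_int_dominated (V := banach_CompleteNormedModule X) _ (fun s => K * vnorm x * Rabs (k s)) (K * vnorm x * v)).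
  - intros s Hs. apply continuous_scal_sg; auto.
  - intros s Hs. apply (continuous_mult (K := R_AbsRing)); [apply continuous_const|].
    apply (continuous_comp k Rabs); [auto|apply continuous_Rabs].
  - intros s Hs. change (vnorm (vscal (k s) (T s x)) <= K * vnorm x * Rabs (k s)).
    rewrite vnorm_scal, Rmult_comm. apply Rmult_le_compat_r; [apply Rabs_pos|]. apply HT; lra.
  - apply (is_int_scal (V := R_NormedModule)); auto.
Qed.

Lemma sgint_unique (k : R -> R) (x v : X) :
  is_int (fun s => vscal (k s) (T s x)) v -> sgint k x = v.
Proof.
  intros H. unfold sgint. unfold is_int in H.
  exact (is_RInt_gen_unique (V := banach_CompleteNormedModule X) (fun s => vscal (k s) (T s x)) v H).
Qed.

Lemma sgint_norm (k : R -> R) (x : X) (v : R) : integrable k -> is_int (fun s => Rabs (k s)) v ->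
  vnorm (sgint k x) <= v * (K * vnorm x).
Proof.
  intros Hk Hv. assert (H := is_int_scal (V := R_NormedModule) _ (K * vnorm x) _ Hv).
  rewrite Rmult_comm.
  refine (is_int_norm_le (V := banach_CompleteNormedModule X) _ _ _ _ _ (is_int_sgint k x Hk) H).
  intros s Hs. change (vnorm (vscal (k s) (T s x)) <= K * vnorm x * Rabs (k s)).
  rewrite vnorm_scal, Rmult_comm. apply Rmult_le_compat_r; [apply Rabs_pos|]. apply HT; lra.
Qed.

Lemma sgint_linear (k : R -> R) : integrable k -> is_linear (sgint k).
Proof.
  intros Hk. split.
  - intros x y. apply sgint_unique.
    refine (is_int_ext _ _ _ _ (is_int_plus _ _ _ _ (is_int_sgint k x Hk) (is_int_sgint k y Hk))).
    intros s Hs. change (vadd (vscal (k s) (T s x)) (vscal (k s) (T s y)) = vscal (k s) (T s (vadd x y))).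
    rewrite sg_add by lra. vec.
  - intros a x. apply sgint_unique.
    refine (is_int_ext _ _ _ _ (is_int_scal _ a _ (is_int_sgint k x Hk))).
    intros s Hs. change (vscal a (vscal (k s) (T s x)) = vscal (k s) (T s (vscal a x))).
    rewrite sg_scal by lra. vec.
  - destruct Hk as [Hc [v Hv]].
    assert (0 <= v).
    { apply Rle_trans with (Rabs v); [apply Rabs_pos|].
      refine (is_int_norm_le (V := R_CompleteNormedModule) _ _ _ _ _ Hv Hv).
      intros s Hs. change (Rabs (Rabs (k s)) <= Rabs (k s)). rewrite Rabs_Rabsolu. lra. }
    exists (v * K + 1). split; [generalize (Rmult_le_pos v K); lra|]. intros x.
    eapply Rle_trans; [apply (sgint_norm k x v); [split; eauto|auto]|].
    change (v * (K * vnorm x) <= (v * K + 1) * vnorm x). generalize (vnorm_ge_0 x). lra.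
Qed.

Lemma commuting_sgint_comm (L : X -> X) (k : R -> R) (x : X) : commuting L -> integrable k ->
  L (sgint k x) = sgint k (L x).
Proof.
  intros [HL HLT] Hk. symmetry. apply sgint_unique.
  refine (is_int_ext _ _ _ _ (is_int_linear L _ _ HL (is_int_sgint k x Hk))).
  intros s Hs. rewrite linear_vscal, HLT by (auto; lra). reflexivity.
Qed.

Lemma commuting_sgint (k : R -> R) : integrable k -> commuting (sgint k).
Proof.
  intros Hk. split; [apply sgint_linear; auto|]. intros t x Ht. symmetry.
  apply commuting_sgint_comm; auto. apply commuting_sg; auto.
Qed.

Lemma sgint_ext (k g : R -> R) (x : X) : integrable k -> (forall s, 0 < s -> k s = g s) ->
  sgint k x = sgint g x.
Proof.
  intros Hk E. symmetry. apply sgint_unique. refine (is_int_ext _ _ _ _ (is_int_sgint k x Hk)).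
  intros s Hs. rewrite E by auto. reflexivity.
Qed.

Lemma sgint_plus (k g : R -> R) (x : X) : integrable k -> integrable g ->
  sgint (fun s => k s + g s) x = vadd (sgint k x) (sgint g x).
Proof.
  intros Hk Hg. apply sgint_unique.
  refine (is_int_ext _ _ _ _ (is_int_plus _ _ _ _ (is_int_sgint k x Hk) (is_int_sgint g x Hg))).
  intros s Hs. change (vadd (vscal (k s) (T s x)) (vscal (g s) (T s x)) = vscal (k s + g s) (T s x)). vec.
Qed.

Lemma sgint_scal (c : R) (k : R -> R) (x : X) : integrable k ->
  sgint (fun s => c * k s) x = vscal c (sgint k x).
Proof.
  intros Hk. apply sgint_unique.
  refine (is_int_ext _ _ _ _ (is_int_scal _ c _ (is_int_sgint k x Hk))).
  intros s Hs. change (vscal c (vscal (k s) (T s x)) = vscal (c * k s) (T s x)). vec.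
Qed.

Lemma sgint_by_parts (k k' : R -> R) (x y : X) : integrable k -> integrable k' -> vanishing k ->
  (forall s, 0 < s -> is_derive k s (k' s)) -> genA X T x y -> sgint k y = sgint k' x.
Proof.
  intros Hk Hk' Hv Hd Hg.
  destruct (vanishing_scal k (fun s => T s x) (K * vnorm x)) as [L0 L1]; auto.
  { intros s Hs. apply HT; lra. }
  assert (H : is_int (fun s => vsub (vscal (k' s) (T s x)) (vscal (k s) (T s y))) (minus zero zero)).
  { apply (is_int_FTC (V := banach_CompleteNormedModule X) (fun s => vscal (k s) (T s x))); auto.
    - intros s Hs. evar_last.
      + apply is_derive_vscal; [apply Hd; auto|apply (sg_derive x y); auto].
      + change (vadd (vscal (k' s) (T s x)) (vscal (k s) (vopp (T s y))) =
          vsub (vscal (k' s) (T s x)) (vscal (k s) (T s y))). vec.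
    - intros s Hs. apply (continuous_minus (fun s => vscal (k' s) (T s x)) (fun s => vscal (k s) (T s y)));
        apply continuous_scal_sg; auto; [apply Hk'|apply Hk]; auto. }
  assert (H2 := is_int_minus _ _ _ _ (is_int_sgint k' x Hk') (is_int_sgint k y Hk)).
  assert (E : vsub (sgint k' x) (sgint k y) = vsub vzero vzero).
  { exact (is_int_unique (V := banach_CompleteNormedModule X) _ _ _ H2 H). }
  transitivity (vsub (sgint k' x) (vsub (sgint k' x) (sgint k y))); [vec|]. rewrite E. vec.
Qed.

(** Here x is arbitrary. Averages of x lie in D(A), where integration by parts applies; they
    converge to x, and closedness of the generator passes to the limit. *)
Lemma genA_sgint (k k' : R -> R) (x : X) : integrable k -> integrable k' -> vanishing k ->
  (forall s, 0 < s -> is_derive k s (k' s)) -> genA X T (sgint k x) (sgint k' x).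
Proof.
  intros Hk Hk' Hv Hd. apply genA_closed. intros eps He.
  destruct (linear_norm _ (sgint_linear k Hk)) as (C & HC & HN).
  destruct (linear_norm _ (sgint_linear k' Hk')) as (C' & HC' & HN').
  destruct (avg_close x (eps / (C + C'))) as (d & Hd0 & H); [apply Rdiv_lt_0_compat; lra|].
  set (h := d / 2). specialize (H h ltac:(unfold h; lra) ltac:(unfold h; lra)).
  assert (Hh : 0 < h) by (unfold h; lra).
  exists (sgint k (avg h x)), (sgint k' (avg h x)). split; [|split].
  - rewrite <- (sgint_by_parts k k' (avg h x) (vscal (/ h) (vsub x (T h x)))) by (auto; apply genA_avg; auto).
    apply genA_commuting; [apply commuting_sgint; auto|apply genA_avg; auto].
  - rewrite <- (linear_vsub (sgint k)) by (apply sgint_linear; auto).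
    eapply Rle_trans; [apply HN|]. change (C * vnorm (vsub (avg h x) x) <= eps).
    apply Rle_trans with ((C + C') * (eps / (C + C'))); [|apply Req_le; field; lra].
    generalize (vnorm_ge_0 (vsub (avg h x) x)). intros.
    apply Rmult_le_compat; lra.
  - rewrite <- (linear_vsub (sgint k')) by (apply sgint_linear; auto).
    eapply Rle_trans; [apply HN'|]. change (C' * vnorm (vsub (avg h x) x) <= eps).
    apply Rle_trans with ((C + C') * (eps / (C + C'))); [|apply Req_le; field; lra].
    generalize (vnorm_ge_0 (vsub (avg h x) x)). intros.
    apply Rmult_le_compat; lra.
Qed.

Lemma Apow_sgint_rodrigues (c : R) (x : X) (q : nat) : forall j b, -1 < b ->
  Apow X T q (sgint (rodrigues c j (b + INR q)) x) (sgint (rodrigues c (j + q) b) x).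
Proof.
  induction q as [|q IH]; intros j b Hb.
  - simpl. rewrite Rplus_0_r, Nat.add_0_r. reflexivity.
  - assert (Hq := pos_INR q).
    exists (sgint (rodrigues c (S j) (b + INR q)) x). split.
    + replace (b + INR (S q)) with (b + INR q + 1) by (rewrite S_INR; ring).
      apply genA_sgint; [apply integrable_rodrigues; lra | apply integrable_rodrigues; lra
        | apply vanishing_rodrigues; lra | intros; apply is_derive_rodrigues; auto].
    + replace (j + S q)%nat with (S j + q)%nat by lia. apply IH; auto.
Qed.

(** The chain of kernels read backwards: [p] derivatives leave the kernel and become powers of A on
    x, which is what gains n^(-p/2) in the norm of the kernel. *)
Lemma sgint_rodrigues_shift (c : R) (p : nat) : forall j b x y, -1 < b -> Apow X T p x y ->
  sgint (rodrigues c (j + p) b) x = sgint (rodrigues c j (b + INR p)) y.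
Proof.
  induction p as [|p IH]; intros j b x y Hb H.
  - simpl in H. subst y. simpl. rewrite Rplus_0_r, Nat.add_0_r. reflexivity.
  - destruct H as (u & Hu & H). assert (Hp := pos_INR p).
    replace (j + S p)%nat with (S (j + p)) by lia.
    rewrite <- (sgint_by_parts (rodrigues c (j + p) (b + 1)) (rodrigues c (S (j + p)) b) x u).
    + rewrite (IH j (b + 1) u y) by (auto; lra). f_equal. f_equal. rewrite S_INR. ring.
    + apply integrable_rodrigues; lra.
    + apply integrable_rodrigues; lra.
    + apply vanishing_rodrigues; lra.
    + intros; apply is_derive_rodrigues; auto.
    + auto.
Qed.

(** * Laguerre coefficients and partial sums of an orbit *)

Definition lag_term (n : nat) (a : R) (x : X) : X := sgint (lag_kernel n a) x.

Lemma lag_term_rodrigues (n : nat) (a : R) (x : X) : -1 < a ->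
  sgint (rodrigues (/ Gam (INR n + a + 1)) n a) x = lag_term n a x.
Proof.
  intros Ha. apply sgint_ext; [apply integrable_rodrigues; auto|].
  intros; apply rodrigues_lag_kernel; auto.
Qed.

Lemma integrable_lag_kernel (n : nat) (a : R) : -1 < a -> integrable (lag_kernel n a).
Proof.
  intros Ha. apply integrable_ext with (rodrigues (/ Gam (INR n + a + 1)) n a).
  - intros; apply rodrigues_lag_kernel; auto.
  - apply integrable_rodrigues; auto.
Qed.

(** The norm h_n is kept unevaluated: in the series it cancels exactly against |L_n(t)| <= sqrt(C
    h_n), so its asymptotics enter only in the first estimate of the theorem. *)
Lemma lag_term_bound (n p : nat) (a : R) (x y : X) : -1 < a -> Apow X T p x y -> (p <= n)%nat ->
  vnorm (lag_term n a x) <=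
  K * ((1 + Gam (INR p + a + 1)) / 2) * sqrt (INR (fact (n - p)) / INR (fact n) / lag_norm n a) * vnorm y.
Proof.
  intros Ha H Hp. rewrite <- lag_term_rodrigues by auto.
  set (c := / Gam (INR n + a + 1)).
  replace n with ((n - p) + p)%nat at 1 by lia.
  rewrite (sgint_rodrigues_shift c p (n - p) a x y Ha H).
  assert (Hb : -1 < a + INR p) by (generalize (pos_INR p); lra).
  assert (HI := integrable_rodrigues c (n - p) (a + INR p) Hb).
  destruct (proj2 HI) as [v Hv].
  eapply Rle_trans; [apply (sgint_norm _ y v HI Hv)|].
  assert (Hle := is_int_rodrigues_abs_le n p a v Ha Hp Hv).
  replace (K * ((1 + Gam (INR p + a + 1)) / 2) * sqrt (INR (fact (n - p)) / INR (fact n) / lag_norm n a) * vnorm y)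
    with (((1 + Gam (INR p + a + 1)) / 2 * sqrt (INR (fact (n - p)) / INR (fact n) / lag_norm n a)) * (K * vnorm y)) by ring.
  apply Rmult_le_compat_r; auto. apply Rmult_le_pos; [lra|apply vnorm_ge_0].
Qed.

Lemma resolvent_lag_term (n : nat) (a : R) (x : X) : -1 < a ->
  exists w, resolvent_pow X T (INR n + a + 1) x w /\ Apow X T n w (lag_term n a x).
Proof.
  intros Ha. set (c := / Gam (INR n + a + 1)).
  assert (Hn := pos_INR n).
  exists (sgint (rodrigues c 0 (a + INR n)) x). split.
  - exists (Gam (INR n + a + 1)). split.
    + apply is_int_rint_0inf. apply (is_int_Gam (INR n + a + 1)). lra.
    + apply is_int_vint_0inf.
      refine (is_int_ext _ _ _ _ (is_int_sgint (rodrigues c 0 (a + INR n)) x _)).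
      * intros s Hs. rewrite <- rodrigues_resolvent. reflexivity.
      * apply integrable_rodrigues. lra.
  - rewrite <- lag_term_rodrigues by auto. exact (Apow_sgint_rodrigues c x n 0 a Ha).
Qed.

Definition lag_sum (m : nat) (a t : R) (x : X) : X :=
  vsum (fun n => vscal (Laguerre n a t) (lag_term n a x)) m.

Definition lag_sum_kernel (m : nat) (a t s : R) : R :=
  sum_f_R0 (fun n => Laguerre n a t * lag_kernel n a s) m.

Lemma integrable_lag_sum_kernel_mul (m : nat) (a t : R) (P : R -> R) : -1 < a -> poly_growth P ->
  integrable (fun s => lag_sum_kernel m a t s * P s).
Proof.
  intros Ha HP. unfold lag_sum_kernel. induction m as [|m IH]; cbn [sum_f_R0].
  - apply integrable_ext with (fun s => Laguerre 0 a t * (lag_kernel 0 a s * P s)); [intros; ring|].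
    apply integrable_scal, integrable_lag_kernel_mul; auto.
  - apply integrable_ext with (fun s => sum_f_R0 (fun n => Laguerre n a t * lag_kernel n a s) m * P s +
      Laguerre (S m) a t * (lag_kernel (S m) a s * P s)); [intros; ring|].
    apply integrable_plus; auto. apply integrable_scal, integrable_lag_kernel_mul; auto.
Qed.

Lemma integrable_lag_sum_kernel (m : nat) (a t : R) : -1 < a -> integrable (lag_sum_kernel m a t).
Proof.
  intros Ha. apply integrable_ext with (fun s => lag_sum_kernel m a t s * 1); [intros; ring|].
  apply integrable_lag_sum_kernel_mul; auto. apply poly_growth_const.
Qed.

Lemma is_int_lag_sum_kernel (m : nat) (a t : R) : -1 < a -> is_int (lag_sum_kernel m a t) 1.
Proof.
  intros Ha. unfold lag_sum_kernel. induction m as [|m IH]; cbn [sum_f_R0].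
  - refine (is_int_extR _ _ _ _ (is_int_lag_kernel 0 a Ha)). intros. rewrite Laguerre_0. ring.
  - assert (H := is_int_plus (V := R_NormedModule) _ _ _ _ IH
      (is_int_scal (V := R_NormedModule) _ (Laguerre (S m) a t) _ (is_int_lag_kernel (S m) a Ha))).
    replace 1 with (1 + Laguerre (S m) a t * 0) by ring.
    exact H.
Qed.

Lemma sgint_lag_sum_kernel (m : nat) (a t : R) (x : X) : -1 < a ->
  sgint (lag_sum_kernel m a t) x = lag_sum m a t x.
Proof.
  intros Ha. induction m as [|m IH].
  - unfold lag_sum. cbn [vsum]. unfold lag_term. rewrite <- sgint_scal by (apply integrable_lag_kernel; auto).
    reflexivity.
  - unfold lag_sum. cbn [vsum]. fold (lag_sum m a t x). rewrite <- IH. unfold lag_term.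
    rewrite <- sgint_scal by (apply integrable_lag_kernel; auto).
    rewrite <- sgint_plus; [reflexivity|apply integrable_lag_sum_kernel; auto|].
    apply integrable_scal, integrable_lag_kernel; auto.
Qed.

Lemma commuting_lag_sum (L : X -> X) (m : nat) (a t : R) (x : X) : -1 < a -> commuting L ->
  L (lag_sum m a t x) = lag_sum m a t (L x).
Proof.
  intros Ha HL. rewrite <- !sgint_lag_sum_kernel by auto.
  apply commuting_sgint_comm; auto. apply integrable_lag_sum_kernel; auto.
Qed.

End Semigroup.

(** * Convergence of the Laguerre series *)

Definition rescale {X : BanachSpace} (u : R) (T : R -> X -> X) : R -> X -> X := fun s => T (u * s).

Lemma rescale_C0 (X : BanachSpace) (T : R -> X -> X) (u : R) : 0 <= u ->
  C0_semigroup X T -> C0_semigroup X (rescale u T).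
Proof.
  intros Hu HC. unfold rescale. split; [|split; [|split]].
  - intros t Ht. apply HC. apply Rmult_le_pos; auto.
  - intros x. rewrite Rmult_0_r. apply HC.
  - intros t s x Ht Hs. rewrite Rmult_plus_distr_l. apply HC; apply Rmult_le_pos; auto.
  - intros x eps He. destruct (sg_small X T HC x eps He) as (d & Hd & H).
    exists (d / (u + 1)). split; [apply Rdiv_lt_0_compat; lra|]. intros h Hh Hhd. apply H.
    + apply Rmult_le_pos; lra.
    + apply Rle_lt_trans with ((u + 1) * h); [apply Rmult_le_compat_r; lra|].
      apply Rmult_lt_compat_l with (r := u + 1) in Hhd; [|lra].
      replace ((u + 1) * (d / (u + 1))) with d in Hhd by (field; lra). auto.
Qed.

Lemma rescale_bounded (X : BanachSpace) (T : R -> X -> X) (K u : R) : 0 <= u ->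
  unif_bounded X T K -> unif_bounded X (rescale u T) K.
Proof. intros Hu HT t x Ht. apply HT. apply Rmult_le_pos; auto. Qed.

Lemma genA_rescale (X : BanachSpace) (T : R -> X -> X) (u : R) (x y : X) : 0 <= u ->
  C0_semigroup X T -> genA X T x y -> genA X (rescale u T) x (vscal u y).
Proof.
  intros Hu HC Hg. apply genA_intro. intros eps He. unfold rescale.
  destruct (Req_dec u 0) as [->|Hu0].
  - exists 1. split; [lra|]. intros h Hh _. rewrite Rmult_0_l, (sg_zero X T HC).
    replace (vadd (vsub x x) (vscal h (vscal 0 y))) with (vzero : X) by vec.
    rewrite vnorm_zero. apply Rmult_le_pos; lra.
  - destruct (genA_increment X T x y Hg (eps / u)) as (d & Hd & H); [apply Rdiv_lt_0_compat; lra|].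
    exists (d / u). split; [apply Rdiv_lt_0_compat; lra|]. intros h Hh Hhd.
    apply Rmult_lt_compat_l with (r := u) in Hhd; [|lra].
    replace (u * (d / u)) with d in Hhd by (field; lra).
    replace (vscal h (vscal u y)) with (vscal (u * h) y) by vec.
    replace (eps * h) with (eps / u * (u * h)) by (field; lra).
    apply H; auto. apply Rmult_lt_0_compat; lra.
Qed.

Lemma commuting_vscal (X : BanachSpace) (T : R -> X -> X) (c : R) : C0_semigroup X T ->
  commuting X T (vscal c).
Proof.
  intros HC. split.
  - apply (is_linear_scal_r (V := banach_NormedModule X) c). intros; apply Rmult_comm.
  - intros t x Ht. symmetry. destruct HC as (H & _). apply (H t Ht).
Qed.

Lemma Apow_rescale (X : BanachSpace) (T : R -> X -> X) (u : R) (p : nat) : 0 <= u ->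
  C0_semigroup X T -> forall x y, Apow X T p x y -> Apow X (rescale u T) p x (vscal (u ^ p) y).
Proof.
  intros Hu HC. induction p as [|p IH]; intros x y H.
  - simpl in *. subst y. vec.
  - destruct H as (z & Hz & H). exists (vscal u z). split; [apply genA_rescale; auto|].
    replace (vscal (u ^ S p) y) with (vscal u (vscal (u ^ p) y)) by (vec; simpl; ring).
    apply (Apow_commuting X (rescale u T) (vscal u)); [apply commuting_vscal, rescale_C0; auto|auto].
Qed.

(** Over N equal steps the quadratic remainders add up to C/N. Since [C] is absent from the
    conclusion, it may depend on everything, in particular on the index of the partial sum. *)
Lemma mean_value_subdivision {X : BanachSpace} (f g : R -> X) (B C : R) :
  (forall u v, 0 <= u <= 1 -> 0 <= v <= 1 ->
     vnorm (vsub (vsub (f v) (f u)) (vscal (v - u) (g u))) <= C * ((v - u) * (v - u))) ->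
  (forall u, 0 <= u <= 1 -> vnorm (g u) <= B) ->
  vnorm (vsub (f 1) (f 0)) <= B.
Proof.
  intros Hf Hg. apply le_epsilon. intros eps He.
  destruct (nfloor_ex (Rabs C / eps)) as [N0 [_ HN0]].
  { apply Rdiv_le_0_compat; auto. apply Rabs_pos. }
  set (N := S N0). assert (HN : INR N = INR N0 + 1) by apply S_INR.
  assert (HNp : 0 < INR N) by (rewrite HN; generalize (pos_INR N0); lra).
  set (e := / INR N). assert (Hep : 0 < e) by (apply Rinv_0_lt_compat; auto).
  assert (HeN : INR N * e = 1) by (unfold e; field; lra).
  assert (Hi : forall i, (i <= N)%nat -> vnorm (vsub (f (INR i * e)) (f 0)) <= INR i * (B * e + C * (e * e))).
  { induction i as [|i IH]; intros Hi.
    - simpl. rewrite !Rmult_0_l, vsub_self, vnorm_zero. lra.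
    - specialize (IH ltac:(lia)). assert (Hi1 := Hi). apply le_INR in Hi1. rewrite S_INR in Hi1 |- *.
      assert (Hb : 0 <= INR i * e <= 1 /\ 0 <= (INR i + 1) * e <= 1).
      { generalize (pos_INR i). intros. rewrite <- HeN. repeat split; try apply Rmult_le_pos; try lra;
          apply Rmult_le_compat_r; lra. }
      destruct Hb as [Hb1 Hb2].
      replace (vsub (f ((INR i + 1) * e)) (f 0)) with
        (vadd (vsub (f (INR i * e)) (f 0))
          (vadd (vscal e (g (INR i * e)))
            (vsub (vsub (f ((INR i + 1) * e)) (f (INR i * e))) (vscal e (g (INR i * e)))))) by vec.
      replace ((INR i + 1) * (B * e + C * (e * e))) with
        (INR i * (B * e + C * (e * e)) + (B * e + C * (e * e))) by ring.
      apply vnorm_vadd_le; auto. apply vnorm_vadd_le.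
      + rewrite vnorm_scal, Rabs_pos_eq by lra. rewrite Rmult_comm. apply Rmult_le_compat_r; [lra|]. apply Hg; auto.
      + specialize (Hf (INR i * e) ((INR i + 1) * e) Hb1 Hb2).
        replace ((INR i + 1) * e - INR i * e) with e in Hf by ring. exact Hf. }
  specialize (Hi N (Nat.le_refl N)). rewrite HeN in Hi.
  eapply Rle_trans; [exact Hi|].
  replace (INR N * (B * e + C * (e * e))) with (INR N * e * (B + C * e)) by ring.
  rewrite HeN, Rmult_1_l. apply Rplus_le_compat_l.
  apply Rle_trans with (Rabs C * e); [apply Rmult_le_compat_r; [lra|apply Rle_abs]|].
  apply Rmult_le_reg_r with (INR N); auto. rewrite Rmult_assoc, (Rmult_comm e), HeN, Rmult_1_r.
  rewrite <- HN in HN0. apply Rmult_lt_compat_l with (r := eps) in HN0; auto.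
  replace (eps * (Rabs C / eps)) with (Rabs C) in HN0 by (field; lra). lra.
Qed.

Lemma mul_abs_sqrt_le (c L z q : R) : 0 <= c -> 0 <= z -> c * c * (L * L) * z <= q ->
  c * Rabs L * sqrt z <= sqrt q.
Proof.
  intros Hc Hz H. replace (c * Rabs L) with (sqrt (c * c * (L * L))).
  - rewrite <- sqrt_mult; auto; [apply sqrt_le_1_alt; auto|].
    apply Rmult_le_pos; [apply Rle_0_sqr|apply Rle_0_sqr].
  - replace (c * c * (L * L)) with (Rsqr (c * L)) by (unfold Rsqr; ring).
    rewrite sqrt_Rsqr_abs, Rabs_mult, (Rabs_pos_eq c) by auto. reflexivity.
Qed.

Lemma fact_ratio3_le (n : nat) : (3 <= n)%nat ->
  INR (fact (n - 3)) / INR (fact n) <= 27 / (INR n * INR n * INR n).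
Proof.
  intros Hn. generalize (fact_ratio_le n 3 Hn), (INR_fact_pos n). intros H Hf.
  assert (Hn0 : 0 < INR n) by (apply lt_0_INR; lia).
  apply Rmult_le_reg_r with (INR (fact n) * (INR n * INR n * INR n)).
  { repeat apply Rmult_lt_0_compat; auto. }
  replace (INR (fact (n - 3)) / INR (fact n) * (INR (fact n) * (INR n * INR n * INR n))) with
    (INR (fact (n - 3)) * INR n ^ 3) by (simpl pow; field; lra).
  replace (27 / (INR n * INR n * INR n) * (INR (fact n) * (INR n * INR n * INR n))) with (INR 3 ^ 3 * INR (fact n))
    by (simpl pow; simpl INR; field; lra).
  exact H.
Qed.

Lemma christoffel_darboux_terms (m : nat) (a C L0 L1 : R) : -1 < a -> 0 < C -> (3 <= m)%nat ->
  L0 * L0 <= C * lag_norm m a -> L1 * L1 <= C * lag_norm (S m) a ->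
  (INR m + 1 + a) * Rabs L0 * sqrt (INR (fact (S m - 3)) / INR (fact (S m)) / lag_norm (S m) a) <=
    sqrt (108 * (1 + Rabs a) * C / INR m) /\
  (INR m + 1) * Rabs L1 * sqrt (INR (fact (m - 3)) / INR (fact m) / lag_norm m a) <=
    sqrt (108 * (1 + Rabs a) * C / INR m).
Proof.
  intros Ha HC Hm H0 H1.
  assert (Hm3 : 3 <= INR m) by (replace 3 with (INR 3) by (simpl; ring); apply le_INR; auto).
  assert (F0 := fact_ratio3_le m Hm). assert (F1 := fact_ratio3_le (S m) ltac:(lia)).
  assert (P0 := lag_norm_pos m a Ha). assert (P1 := lag_norm_pos (S m) a Ha).
  assert (E := lag_norm_S m a Ha).
  set (x := INR m) in *. set (h0 := lag_norm m a) in *. set (h1 := lag_norm (S m) a) in *.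
  set (f0 := INR (fact (m - 3)) / INR (fact m)) in *.
  set (f1 := INR (fact (S m - 3)) / INR (fact (S m))) in *.
  assert (Q0 : 0 < f0) by (apply Rdiv_lt_0_compat; apply INR_fact_pos).
  assert (Q1 : 0 < f1) by (apply Rdiv_lt_0_compat; apply INR_fact_pos).
  rewrite S_INR in F1. fold x in F1.
  assert (Hax : x + 1 + a <= (1 + Rabs a) * (x + 1)) by (generalize (Rle_abs a), (Rabs_pos a); nra).
  assert (Ha1 : 0 < 1 + Rabs a) by (generalize (Rabs_pos a); lra).
  assert (I0 : 0 < / (x * x * x)) by (apply Rinv_0_lt_compat; repeat apply Rmult_lt_0_compat; lra).
  assert (Ix : 0 < / x) by (apply Rinv_0_lt_compat; lra).
  assert (F1' : f1 <= 27 / (x * x * x)).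
  { eapply Rle_trans; [exact F1|]. apply Rmult_le_compat_l; [lra|].
    apply Rinv_le_contravar; [repeat apply Rmult_lt_0_compat; lra|].
    apply Rmult_le_compat; [nra|lra|nra|lra]. }
  (* The ratio h_(m+1)/h_m = (m+1+a)/(m+1) brings both squared terms to the same product, so one
     estimate serves twice. Here 108 = 4 * 27, from (x+1)^2 <= 4 x^2 and [fact_ratio3_le]. *)
  assert (Hkey : forall f, 0 < f -> f <= 27 / (x * x * x) ->
    C * ((x + 1 + a) * (x + 1)) * f <= 108 * (1 + Rabs a) * C / x).
  { intros f Hf Hf2.
    apply Rle_trans with (C * ((1 + Rabs a) * (4 * (x * x))) * (27 / (x * x * x))).
    - apply Rmult_le_compat; try lra.
      + apply Rmult_le_pos; [lra|]. apply Rmult_le_pos; lra.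
      + apply Rmult_le_compat_l; [lra|].
        apply Rle_trans with ((1 + Rabs a) * (x + 1) * (x + 1)); [apply Rmult_le_compat_r; lra|].
        rewrite Rmult_assoc. apply Rmult_le_compat_l; [lra|]. nra.
    - apply Req_le. field. lra. }
  assert (S1 : 0 <= f1 / h1) by (apply Rlt_le, Rdiv_lt_0_compat; auto).
  assert (S0 : 0 <= f0 / h0) by (apply Rlt_le, Rdiv_lt_0_compat; auto).
  split; apply mul_abs_sqrt_le; auto; try lra.
  - apply Rle_trans with ((x + 1 + a) * (x + 1 + a) * (C * h0) * (f1 / h1)).
    + apply Rmult_le_compat_r; auto. apply Rmult_le_compat_l; [apply Rle_0_sqr|auto].
    + eapply Rle_trans; [|apply (Hkey f1); auto]. apply Req_le. rewrite E. field. lra.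
  - apply Rle_trans with ((x + 1) * (x + 1) * (C * h1) * (f0 / h0)).
    + apply Rmult_le_compat_r; auto. apply Rmult_le_compat_l; [apply Rle_0_sqr|auto].
    + eapply Rle_trans; [|apply (Hkey f0); auto]. apply Req_le. rewrite E. field. lra.
Qed.

(** * The path from the orbit to its partial sums, and the rates *)

Section Convergence.
Variables (X : BanachSpace) (T : R -> X -> X) (K a t : R).
Hypothesis HC0 : C0_semigroup X T.
Hypothesis HK : 0 < K.
Hypothesis HT : unif_bounded X T K.
Hypothesis Ha : -1 < a.
Hypothesis Ht : 0 < t.

(** The time t + u (s - t) is split as t (1 - u) + u s, both parts nonnegative: the first leaves the
    integral, and the rest is a kernel integral of the rescaled semigroup. *)
Definition interpolant (k : R -> R) (x : X) (u : R) : X := T (t * (1 - u)) (sgint X (rescale u T) k x).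

Lemma is_int_interpolant (k : R -> R) (x : X) (u : R) : integrable k -> 0 <= u <= 1 ->
  is_int (fun s => vscal (k s) (T (t + u * (s - t)) x)) (interpolant k x u).
Proof.
  intros Hk Hu. assert (Htu : 0 <= t * (1 - u)) by (apply Rmult_le_pos; lra).
  assert (HCu := rescale_C0 X T u (proj1 Hu) HC0). assert (HTu := rescale_bounded X T K u (proj1 Hu) HT).
  refine (is_int_ext _ _ _ _ (is_int_linear (T (t * (1 - u))) _ _ (sg_linear X T K HC0 HK HT _ Htu)
    (is_int_sgint X (rescale u T) K HCu HK HTu k x Hk))).
  intros s Hs. rewrite (sg_scal X T K HC0 HK HT) by auto. f_equal. unfold rescale.
  rewrite <- (sg_plus X T HC0) by (auto; apply Rmult_le_pos; lra). f_equal. ring.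
Qed.

(** Taylor's estimate is applied under the integral with time increment (v - u)(s - t), leaving the
    second moment of the kernel about [t]; its size in [m] is immaterial for
    [mean_value_subdivision]. *)
Lemma interpolant_taylor (m : nat) (x y y2 : X) : genA X T x y -> genA X T y y2 -> exists C,
  forall u v, 0 <= u <= 1 -> 0 <= v <= 1 ->
    vnorm (vsub (vsub (interpolant (lag_sum_kernel m a t) x v) (interpolant (lag_sum_kernel m a t) x u))
      (vscal (v - u) (interpolant (fun s => lag_sum_kernel m a t s * (t - s)) y u))) <= C * ((v - u) * (v - u)).
Proof.
  intros Hg Hg2. set (k := lag_sum_kernel m a t).
  assert (Hk : integrable k) by (apply integrable_lag_sum_kernel; auto).
  assert (Hp1 : poly_growth (fun s => t - s)).
  { apply poly_growth_ext with (fun s => t + (-1) * s); [intros; ring|].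
    apply (poly_growth_plus (fun _ => t) (fun s => (-1) * s)); [apply poly_growth_const|].
    apply poly_growth_mult; [apply poly_growth_const|apply poly_growth_id]. }
  assert (Hk1 : integrable (fun s => k s * (t - s))) by (apply integrable_lag_sum_kernel_mul; auto).
  assert (Hk2 : integrable (fun s => k s * ((t - s) * (t - s)))).
  { apply integrable_lag_sum_kernel_mul; auto. apply poly_growth_mult; auto. }
  destruct (proj2 Hk2) as [w Hw].
  exists (K * vnorm y2 * w). intros u v Hu Hv.
  assert (HI := is_int_minus _ _ _ _ (is_int_minus _ _ _ _ (is_int_interpolant k x v Hk Hv) (is_int_interpolant k x u Hk Hu))
    (is_int_scal _ (v - u) _ (is_int_interpolant (fun s => k s * (t - s)) y u Hk1 Hu))).
  assert (HJ := is_int_scal (V := R_NormedModule) _ (K * vnorm y2 * ((v - u) * (v - u))) _ Hw).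
  replace (K * vnorm y2 * w * ((v - u) * (v - u))) with (K * vnorm y2 * ((v - u) * (v - u)) * w) by ring.
  refine (is_int_norm_le (V := banach_CompleteNormedModule X) _ _ _ _ _ HI HJ).
  intros s Hs.
  change (vnorm (vsub (vsub (vscal (k s) (T (t + v * (s - t)) x)) (vscal (k s) (T (t + u * (s - t)) x)))
    (vscal (v - u) (vscal (k s * (t - s)) (T (t + u * (s - t)) y)))) <=
    K * vnorm y2 * ((v - u) * (v - u)) * Rabs (k s * ((t - s) * (t - s)))).
  set (p := t + u * (s - t)). set (q := t + v * (s - t)).
  assert (Hp : 0 <= p) by (unfold p; replace (t + u * (s - t)) with (t * (1 - u) + u * s) by ring;
    apply Rplus_le_le_0_compat; apply Rmult_le_pos; lra).
  assert (Hq : 0 <= q) by (unfold q; replace (t + v * (s - t)) with (t * (1 - v) + v * s) by ring;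
    apply Rplus_le_le_0_compat; apply Rmult_le_pos; lra).
  replace (vsub (vsub (vscal (k s) (T q x)) (vscal (k s) (T p x))) (vscal (v - u) (vscal (k s * (t - s)) (T p y)))) with
    (vscal (k s) (vadd (vsub (T q x) (T p x)) (vscal (q - p) (T p y)))) by (vec; unfold p, q; ring).
  rewrite vnorm_scal.
  apply Rle_trans with (Rabs (k s) * (K * vnorm y2 * (Rabs (q - p) * Rabs (q - p)))).
  - apply Rmult_le_compat_l; [apply Rabs_pos|]. apply (sg_taylor X T K); auto.
  - rewrite <- Rabs_mult. replace (q - p) with ((v - u) * (s - t)) by (unfold p, q; ring).
    replace ((v - u) * (s - t) * ((v - u) * (s - t))) with (((v - u) * (v - u)) * ((t - s) * (t - s))) by ring.
    apply Req_le. rewrite !Rabs_mult.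
    replace (Rabs (v - u) * Rabs (v - u)) with ((v - u) * (v - u)); [ring|].
    rewrite <- Rabs_mult, Rabs_pos_eq; auto. apply Rle_0_sqr.
Qed.

Lemma interpolant_1 (m : nat) (x : X) : interpolant (lag_sum_kernel m a t) x 1 = lag_sum X T m a t x.
Proof.
  unfold interpolant. rewrite Rminus_diag, Rmult_0_r, (sg_zero X T HC0).
  rewrite <- (sgint_lag_sum_kernel X T K) by auto. apply sgint_unique.
  refine (is_int_ext _ _ _ _ (is_int_sgint X T K HC0 HK HT _ x (integrable_lag_sum_kernel m a t Ha))).
  intros s Hs. unfold rescale. rewrite Rmult_1_l. reflexivity.
Qed.

Lemma interpolant_0 (m : nat) (x : X) : interpolant (lag_sum_kernel m a t) x 0 = T t x.
Proof.
  unfold interpolant. rewrite Rminus_0_r, Rmult_1_r. f_equal. apply sgint_unique.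
  assert (H := is_int_linear (U := R_NormedModule) (fun k : R => vscal k x) _ _ (is_linear_scal_l x)
    (is_int_lag_sum_kernel m a t Ha)).
  cbv beta in H. rewrite vscal_1 in H. refine (is_int_ext _ _ _ _ H).
  intros s Hs. unfold rescale. rewrite Rmult_0_l, (sg_zero X T HC0). reflexivity.
Qed.

(** By Christoffel-Darboux the moment kernel is a combination of the kernels of index m and m + 1.
    Rescaling multiplies A^3 y by u^3 <= 1, so the bound does not see u. *)
Lemma interpolant_deriv_bound : exists C, 0 <= C /\ forall m y z u, (3 <= m)%nat -> 0 <= u <= 1 ->
  Apow X T 3 y z ->
  vnorm (interpolant (fun s => lag_sum_kernel m a t s * (t - s)) y u) <= C * sqrt (/ INR m) * vnorm z.
Proof.
  destruct (Laguerre_pointwise_bound a t Ha Ht) as (CL & HCL & HL).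
  set (Q := K * ((1 + Gam (INR 3 + a + 1)) / 2)).
  assert (HQ : 0 < Q).
  { apply Rmult_lt_0_compat; auto. assert (0 < Gam (INR 3 + a + 1)) by (apply Gam_pos; simpl; lra). lra. }
  set (D := 108 * (1 + Rabs a) * CL).
  assert (HD : 0 <= D) by (apply Rmult_le_pos; [generalize (Rabs_pos a); lra|lra]).
  exists (K * (2 * (sqrt D * Q))). split.
  { apply Rmult_le_pos; [lra|]. apply Rmult_le_pos; [lra|]. apply Rmult_le_pos; [apply sqrt_pos|lra]. }
  intros m y z u Hm Hu HA. unfold interpolant.
  assert (HCu := rescale_C0 X T u (proj1 Hu) HC0). assert (HTu := rescale_bounded X T K u (proj1 Hu) HT).
  assert (HAu := Apow_rescale X T u 3 (proj1 Hu) HC0 y z HA).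
  assert (Hz : vnorm (vscal (u ^ 3) z) <= vnorm z).
  { rewrite vnorm_scal, Rabs_pos_eq by (apply pow_le; lra). rewrite <- (Rmult_1_l (vnorm z)) at 2.
    apply Rmult_le_compat_r; [apply vnorm_ge_0|]. rewrite <- (pow1 3). apply pow_incr. lra. }
  assert (Hm0 : 0 < INR m) by (apply lt_0_INR; lia).
  set (c1 := (INR m + 1 + a) * Laguerre m a t). set (c2 := (INR m + 1) * Laguerre (S m) a t).
  assert (E : sgint X (rescale u T) (fun s => lag_sum_kernel m a t s * (t - s)) y =
    vsub (vscal c1 (lag_term X (rescale u T) (S m) a y)) (vscal c2 (lag_term X (rescale u T) m a y))).
  { unfold lag_term.
    transitivity (vadd (vscal c1 (sgint X (rescale u T) (lag_kernel (S m) a) y))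
       (vscal (- c2) (sgint X (rescale u T) (lag_kernel m a) y))); [|vec].
    rewrite <- !(sgint_scal X (rescale u T) K HCu HK HTu) by (apply integrable_lag_kernel; auto).
    rewrite <- (sgint_plus X (rescale u T) K HCu HK HTu) by (apply integrable_scal, integrable_lag_kernel; auto).
    symmetry. apply (sgint_ext X (rescale u T) K HCu HK HTu).
    - apply integrable_plus; apply integrable_scal, integrable_lag_kernel; auto.
    - intros s Hs. rewrite (Rmult_comm _ (t - s)). unfold lag_sum_kernel. rewrite christoffel_darboux by auto.
      unfold c1, c2. ring. }
  rewrite E.
  destruct (christoffel_darboux_terms m a CL (Laguerre m a t) (Laguerre (S m) a t)) as [B1 B2]; auto.
  { apply HL; lia. } { apply HL; lia. }
  assert (Es : sqrt (108 * (1 + Rabs a) * CL / INR m) = sqrt D * sqrt (/ INR m)).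
  { fold D. unfold Rdiv. rewrite sqrt_mult; auto. apply Rlt_le, Rinv_0_lt_compat; auto. }
  rewrite Es in B1, B2. set (r := sqrt D * sqrt (/ INR m)) in *.
  assert (Hterm : forall n c, (3 <= n)%nat ->
    Rabs c * sqrt (INR (fact (n - 3)) / INR (fact n) / lag_norm n a) <= r ->
    vnorm (vscal c (lag_term X (rescale u T) n a y)) <= r * Q * vnorm z).
  { intros n c Hn Hc. rewrite vnorm_scal.
    assert (HB := lag_term_bound X (rescale u T) K HCu HK HTu n 3 a y _ Ha HAu Hn). fold Q in HB.
    set (q := sqrt (INR (fact (n - 3)) / INR (fact n) / lag_norm n a)) in *.
    assert (Hq : 0 <= q) by apply sqrt_pos.
    apply Rle_trans with (Rabs c * (Q * q * vnorm z)).
    - apply Rmult_le_compat_l; [apply Rabs_pos|]. eapply Rle_trans; [exact HB|].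
      apply Rmult_le_compat_l; auto. apply Rmult_le_pos; lra.
    - replace (Rabs c * (Q * q * vnorm z)) with ((Rabs c * q) * (Q * vnorm z)) by ring.
      rewrite (Rmult_assoc r Q). apply Rmult_le_compat_r; auto. apply Rmult_le_pos; [lra|apply vnorm_ge_0]. }
  apply Rle_trans with (K * (r * Q * vnorm z + r * Q * vnorm z)).
  2:{ apply Req_le. unfold r. ring. }
  apply (sg_bound X T K); auto; [apply Rmult_le_pos; lra|].
  apply vnorm_vsub_le; apply Hterm; auto.
  - unfold c1. rewrite Rabs_mult, (Rabs_pos_eq (INR m + 1 + a)) by lra. exact B1.
  - unfold c2. rewrite Rabs_mult, (Rabs_pos_eq (INR m + 1)) by lra. exact B2.
Qed.

(** One power of A is spent on the derivative of the path, three on the decay of its two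
    coefficients. *)
Lemma lag_sum_rate4 : exists C, 0 <= C /\ forall m x z, (3 <= m)%nat -> Apow X T 4 x z ->
  vnorm (vsub (lag_sum X T m a t x) (T t x)) <= C * sqrt (/ INR m) * vnorm z.
Proof.
  destruct interpolant_deriv_bound as (C & HC & H). exists C. split; auto.
  intros m x z Hm (y & Hy & HA). destruct HA as (y2 & Hy2 & HA2).
  destruct (interpolant_taylor m x y y2 Hy Hy2) as [C2 H2].
  rewrite <- (interpolant_1 m), <- (interpolant_0 m x).
  apply (mean_value_subdivision _ _ _ C2 H2).
  intros u Hu. apply H; auto. exists y2. auto.
Qed.

Lemma lag_sum_tail (p : nat) : (3 <= p)%nat -> exists C, 0 <= C /\
  forall m N x y, (1 <= m)%nat -> (m <= N)%nat -> (p <= m + 1)%nat -> Apow X T p x y ->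
    vnorm (vsub (lag_sum X T N a t x) (lag_sum X T m a t x)) <=
    C * vnorm y * (Rpower (INR m) (1 - INR p / 2) - Rpower (INR N) (1 - INR p / 2)).
Proof.
  intros Hp. destruct (Laguerre_pointwise_bound a t Ha Ht) as (CL & HCL & HL).
  set (Q := K * ((1 + Gam (INR p + a + 1)) / 2)).
  assert (Hp0 : 3 <= INR p) by (replace 3 with (INR 3) by (simpl; ring); apply le_INR; auto).
  assert (HQ : 0 < Q).
  { apply Rmult_lt_0_compat; auto. assert (0 < Gam (INR p + a + 1)) by (apply Gam_pos; lra). lra. }
  set (D := sqrt CL * sqrt (INR p ^ p) * Q).
  assert (HD : 0 <= D) by (apply Rmult_le_pos; [apply Rmult_le_pos; apply sqrt_pos|lra]).
  set (q := INR p / 2). assert (Hq : 1 < q) by (unfold q; lra).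
  assert (Hi : 0 < / (q - 1)) by (apply Rinv_0_lt_compat; lra).
  exists (D * / (q - 1)). split; [apply Rmult_le_pos; lra|].
  intros m N x y Hm HN Hpm HA.
  (* With h_n cancelled only (n-p)!/n! survives under the root, whence n^(-p/2). The condition p <=
     m + 1 makes this valid for every index added after [m]. *)
  assert (Hterm : forall n, (p <= n)%nat ->
    vnorm (vscal (Laguerre n a t) (lag_term X T n a x)) <= D * vnorm y * Rpower (INR n) (- q)).
  { intros n Hn. rewrite vnorm_scal.
    assert (HB := lag_term_bound X T K HC0 HK HT n p a x y Ha HA Hn). fold Q in HB.
    assert (Hh := lag_norm_pos n a Ha).
    assert (HF := fact_ratio_sqrt n p Hn ltac:(lia)). fold q in HF.
    set (f := INR (fact (n - p)) / INR (fact n)) in *.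
    assert (Hf : 0 < f) by (apply Rdiv_lt_0_compat; apply INR_fact_pos).
    assert (HLs : 1 * Rabs (Laguerre n a t) * sqrt (f / lag_norm n a) <= sqrt (CL * f)).
    { apply mul_abs_sqrt_le; [lra|apply Rlt_le, Rdiv_lt_0_compat; auto|].
      apply Rle_trans with (CL * lag_norm n a * (f / lag_norm n a)).
      - apply Rmult_le_compat_r; [apply Rlt_le, Rdiv_lt_0_compat; auto|].
        rewrite !Rmult_1_l. apply HL; lia.
      - apply Req_le. field. lra. }
    rewrite sqrt_mult in HLs by lra. rewrite Rmult_1_l in HLs.
    apply Rle_trans with (Rabs (Laguerre n a t) * (Q * sqrt (f / lag_norm n a) * vnorm y)).
    { apply Rmult_le_compat_l; [apply Rabs_pos|auto]. }
    replace (Rabs (Laguerre n a t) * (Q * sqrt (f / lag_norm n a) * vnorm y)) with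
      ((Rabs (Laguerre n a t) * sqrt (f / lag_norm n a)) * (Q * vnorm y)) by ring.
    apply Rle_trans with ((sqrt CL * (sqrt (INR p ^ p) * Rpower (INR n) (- q))) * (Q * vnorm y)).
    - apply Rmult_le_compat_r; [apply Rmult_le_pos; [lra|apply vnorm_ge_0]|].
      eapply Rle_trans; [exact HLs|]. apply Rmult_le_compat_l; [apply sqrt_pos|auto].
    - apply Req_le. unfold D. ring. }
  induction HN as [|N HN IH].
  - rewrite vsub_self, vnorm_zero, Rminus_diag, Rmult_0_r. lra.
  - replace (vsub (lag_sum X T (S N) a t x) (lag_sum X T m a t x)) with
      (vadd (vsub (lag_sum X T N a t x) (lag_sum X T m a t x)) (vscal (Laguerre (S N) a t) (lag_term X T (S N) a x))).
    2:{ unfold lag_sum at 3. cbn [vsum]. fold (lag_sum X T N a t x). vec. }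
    eapply Rle_trans; [apply vnorm_vadd_le; [exact IH|apply Hterm; lia]|].
    assert (HS := Rpower_tail_step q N Hq ltac:(lia)).
    apply Rmult_le_compat_l with (r := D * vnorm y) in HS; [|apply Rmult_le_pos; [auto|apply vnorm_ge_0]].
    lra.
Qed.

Lemma lag_sum_rate_smooth (p : nat) : (3 <= p)%nat -> exists C, 0 <= C /\
  forall m x y y', (1 <= m)%nat -> (p <= m + 1)%nat -> Apow X T p x y -> Apow X T (S p) x y' ->
    vnorm (vsub (T t x) (lag_sum X T m a t x)) <= C * vnorm y * Rpower (INR m) (1 - INR p / 2).
Proof.
  intros Hp. destruct (lag_sum_tail p Hp) as (C & HC & H). exists C. split; auto.
  intros m x y y' Hm Hpm HA HA'.
  destruct lag_sum_rate4 as (C4 & HC4 & H4).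
  (* For p = 3 the domain D(A^p) is one order short of the fourth power needed to identify the
     limit; the extra order makes up for it. *)
  replace (S p) with (4 + (p - 3))%nat in HA' by lia.
  destruct (Apow_split X T 4 (p - 3) x y' HA') as (z & Hz & _).
  apply le_epsilon. intros eps He.
  set (B := C4 * vnorm z). assert (HB : 0 <= B) by (apply Rmult_le_pos; auto; apply vnorm_ge_0).
  destruct (nfloor_ex (B * B / (eps * eps))) as [N0 [_ HN0]].
  { apply Rdiv_le_0_compat; [apply Rle_0_sqr|apply Rmult_lt_0_compat; auto]. }
  (* N exceeds B^2/eps^2, so that B/sqrt(N) <= eps, as well as [m] for the tail and 3 for the slow
     rate. *)
  set (N := (S N0 + m + 3)%nat).
  assert (HNp : 0 < INR N) by (apply lt_0_INR; unfold N; lia).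
  assert (HN1 : INR N0 + 1 <= INR N) by (rewrite <- S_INR; apply le_INR; unfold N; lia).
  assert (E4 : vnorm (vsub (T t x) (lag_sum X T N a t x)) <= eps).
  { rewrite vsub_anti. eapply Rle_trans; [apply (H4 N x z); auto; unfold N; lia|].
    replace (C4 * sqrt (/ INR N) * vnorm z) with (B * sqrt (/ INR N)) by (unfold B; ring).
    rewrite <- (sqrt_Rsqr eps) by lra. rewrite <- (sqrt_Rsqr B) by auto.
    rewrite <- sqrt_mult; [|apply Rle_0_sqr|apply Rlt_le, Rinv_0_lt_compat; auto].
    apply sqrt_le_1_alt. unfold Rsqr. apply Rmult_le_reg_r with (INR N); auto.
    rewrite Rmult_assoc, Rinv_l, Rmult_1_r by lra.
    assert (HN2 : B * B / (eps * eps) <= INR N) by lra.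
    apply Rmult_le_compat_l with (r := eps * eps) in HN2; [|apply Rle_0_sqr].
    replace (eps * eps * (B * B / (eps * eps))) with (B * B) in HN2 by (field; lra). exact HN2. }
  replace (vsub (T t x) (lag_sum X T m a t x)) with
    (vadd (vsub (lag_sum X T N a t x) (lag_sum X T m a t x)) (vsub (T t x) (lag_sum X T N a t x))) by vec.
  apply vnorm_vadd_le; auto.
  eapply Rle_trans; [apply (H m N x y); auto; unfold N; lia|].
  apply Rmult_le_compat_l; [apply Rmult_le_pos; auto; apply vnorm_ge_0|].
  assert (0 < Rpower (INR N) (1 - INR p / 2)) by apply exp_pos. lra.
Qed.

(** The average commutes with the error operator, so the error of the averaged vector is the
    averaged error. Its bound involves the average of A^p x, of norm at most K |A^p x| for every h,
    and h tends to 0. *)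
Lemma lag_sum_rate (p : nat) : (3 <= p)%nat -> exists C, 0 <= C /\
  forall m x y, (1 <= m)%nat -> (p <= m + 1)%nat -> Apow X T p x y ->
    vnorm (vsub (T t x) (lag_sum X T m a t x)) <= C * vnorm y * Rpower (INR m) (1 - INR p / 2).
Proof.
  intros Hp. destruct (lag_sum_rate_smooth p Hp) as (C & HC & H).
  exists (C * K). split; [apply Rmult_le_pos; lra|]. intros m x y Hm Hpm HA.
  set (D := vsub (T t x) (lag_sum X T m a t x)).
  apply le_epsilon. intros eps He.
  destruct (avg_close X T K HC0 HK HT D eps He) as (d & Hd & Hav).
  set (h := d / 2). assert (Hh : 0 < h) by (unfold h; lra).
  specialize (Hav h Hh ltac:(unfold h; lra)).
  assert (HJ := avg_commuting X T K HC0 HK HT h Hh).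
  assert (HA1 := Apow_commuting X T (avg X T h) p HJ x y HA).
  assert (HA2 := Apow_snoc X T p _ _ _ HA1 (genA_avg X T K HC0 HK HT h y Hh)).
  assert (HB := H m _ _ _ Hm Hpm HA1 HA2).
  assert (EJ : avg X T h D = vsub (T t (avg X T h x)) (lag_sum X T m a t (avg X T h x))).
  { unfold D. rewrite linear_vsub by apply HJ.
    rewrite (commuting_lag_sum X T K HC0 HK HT (avg X T h)) by auto.
    rewrite (proj2 HJ) by lra. reflexivity. }
  rewrite <- EJ in HB.
  replace D with (vsub (avg X T h D) (vsub (avg X T h D) D)) at 1 by vec.
  apply vnorm_vsub_le; auto. eapply Rle_trans; [exact HB|].
  apply Rmult_le_compat_r; [apply Rlt_le, exp_pos|]. rewrite Rmult_assoc.
  apply Rmult_le_compat_l; auto. apply (avg_bound X T K); auto.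
Qed.
End Convergence.

(** * Constants and assembly of the two estimates *)

Lemma unif_bounded_pos (X : BanachSpace) (T : R -> X -> X) (M : R) :
  unif_bounded X T M -> unif_bounded X T (Rabs M + 1).
Proof.
  intros H t x Ht. eapply Rle_trans; [apply H; auto|].
  apply Rmult_le_compat_r; [apply vnorm_ge_0|]. generalize (Rle_abs M). lra.
Qed.

Lemma lag_factor_bound (a : R) (p : nat) : -1 < a -> exists C, 0 < C /\ forall n, (p <= n)%nat -> (1 <= n)%nat ->
  sqrt (INR (fact (n - p)) / INR (fact n) / lag_norm n a) <= C / Rpower (INR n) ((a + INR p) / 2).
Proof.
  intros Ha. destruct (lag_norm_asymp a Ha) as (c & Hc & Has).
  exists (sqrt (INR p ^ p) * sqrt c + 1). split.
  { generalize (Rmult_le_pos _ _ (sqrt_pos (INR p ^ p)) (sqrt_pos c)). lra. }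
  intros n Hp Hn. assert (Hn0 : 0 < INR n) by (apply lt_0_INR; lia).
  assert (Hh := lag_norm_pos n a Ha).
  set (f := INR (fact (n - p)) / INR (fact n)).
  assert (Hf : 0 < f) by (apply Rdiv_lt_0_compat; apply INR_fact_pos).
  assert (HF := fact_ratio_sqrt n p Hp Hn). fold f in HF.
  unfold Rdiv at 1. rewrite sqrt_mult by (try apply Rlt_le, Rinv_0_lt_compat; lra).
  (* The norm contributes the remaining n^(-a/2) of the exponent. *)
  assert (HG : sqrt (/ lag_norm n a) <= sqrt c * Rpower (INR n) (- (a / 2))).
  { replace (- (a / 2)) with ((- a) / 2) by field. rewrite <- sqrt_Rpower by auto.
    rewrite <- sqrt_mult; [|lra|apply Rlt_le, exp_pos]. apply sqrt_le_1_alt. rewrite Rpower_Ropp.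
    assert (Hr : 0 < Rpower (INR n) a) by apply exp_pos.
    apply Rmult_le_reg_r with (lag_norm n a * Rpower (INR n) a); [apply Rmult_lt_0_compat; auto|].
    replace (/ lag_norm n a * (lag_norm n a * Rpower (INR n) a)) with (Rpower (INR n) a) by (field; lra).
    replace (c * / Rpower (INR n) a * (lag_norm n a * Rpower (INR n) a)) with (c * lag_norm n a) by (field; lra).
    apply Has; auto. }
  apply Rle_trans with ((sqrt (INR p ^ p) * Rpower (INR n) (- (INR p / 2))) * (sqrt c * Rpower (INR n) (- (a / 2)))).
  { apply Rmult_le_compat; auto; apply sqrt_pos. }
  assert (Ep : Rpower (INR n) (- (INR p / 2)) * Rpower (INR n) (- (a / 2)) = / Rpower (INR n) ((a + INR p) / 2)).
  { rewrite <- Rpower_plus, <- Rpower_Ropp. f_equal. field. }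
  replace (sqrt (INR p ^ p) * Rpower (INR n) (- (INR p / 2)) * (sqrt c * Rpower (INR n) (- (a / 2)))) with
    (sqrt (INR p ^ p) * sqrt c * (Rpower (INR n) (- (INR p / 2)) * Rpower (INR n) (- (a / 2)))) by ring.
  rewrite Ep. apply Rmult_le_compat_r; [|lra]. apply Rlt_le, Rinv_0_lt_compat, exp_pos.
Qed.

Theorem theorem4p3 :
  (* (i) *)
  (forall (alpha : R) (p : nat) (M : R), -1 < alpha ->
     exists C, 0 < C /\
       forall (X : BanachSpace) (T : R -> X -> X),
         C0_semigroup X T -> unif_bounded X T M ->
         forall (x y : X) (n : nat), Apow X T p x y -> (p <= n)%nat -> (1 <= n)%nat ->
           exists w z, resolvent_pow X T (INR n + alpha + 1) x w /\ Apow X T n w z /\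
             vnorm z <= C / Rpower (INR n) ((alpha + INR p) / 2) * vnorm y)
  /\
  (* (ii) *)
  (forall (X : BanachSpace) (T : R -> X -> X) (M alpha : R),
     C0_semigroup X T -> unif_bounded X T M -> -1 < alpha ->
     forall t, 0 < t ->
       exists m0 : nat, forall p : nat, exists C, 0 < C /\
         forall (m : nat) (x y : X), (m0 <= m)%nat -> (2 < p)%nat -> (p <= m + 1)%nat ->
           Apow X T p x y ->
           exists zs : nat -> X,
             (forall n, (n <= m)%nat ->
                exists w, resolvent_pow X T (INR n + alpha + 1) x w /\ Apow X T n w (zs n)) /\
             vnorm (vsub (T t x) (vsum (fun n => vscal (Laguerre n alpha t) (zs n)) m))
               <= C * vnorm y / Rpower (INR m) (INR p / 2 - 1)).
Proof.
  split.
  - intros a p M Ha. destruct (lag_factor_bound a p Ha) as (C & HC & H).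
    (* [M] is an arbitrary real; this enlargement is a positive bound, by which one may divide, and
       depends on [M] only. *)
    set (K := Rabs M + 1). assert (HK : 0 < K) by (unfold K; generalize (Rabs_pos M); lra).
    set (Q := K * ((1 + Gam (INR p + a + 1)) / 2)).
    assert (HQ : 0 < Q).
    { apply Rmult_lt_0_compat; auto.
      assert (0 < Gam (INR p + a + 1)) by (apply Gam_pos; generalize (pos_INR p); lra). lra. }
    exists (Q * C). split; [apply Rmult_lt_0_compat; auto|].
    intros X T HC0 HM x y n HA Hp Hn. apply unif_bounded_pos in HM. fold K in HM.
    destruct (resolvent_lag_term X T K HC0 HK HM n a x Ha) as (w & Hw1 & Hw2).
    exists w, (lag_term X T n a x). split; [|split]; auto.
    eapply Rle_trans; [apply (lag_term_bound X T K HC0 HK HM n p a x y Ha HA Hp)|]. fold Q.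
    apply Rmult_le_compat_r; [apply vnorm_ge_0|]. unfold Rdiv at 3. rewrite Rmult_assoc.
    apply Rmult_le_compat_l; [lra|]. apply H; auto.
  (* m0 = 1 serves every t and p, and keeps the base of [Rpower (INR m)] positive. *)
  - intros X T M a HC0 HM Ha t Ht. exists 1%nat. intros p.
    destruct (Nat.le_gt_cases 3 p) as [Hp|Hp].
    (* The constant is produced before 2 < p is known; for p <= 2 any positive value will do. *)
    2:{ exists 1. split; [lra|]. intros; lia. }
    apply unif_bounded_pos in HM. set (K := Rabs M + 1) in *.
    assert (HK : 0 < K) by (unfold K; generalize (Rabs_pos M); lra).
    destruct (lag_sum_rate X T K a t HC0 HK HM Ha Ht p Hp) as (C & HC & H).
    exists (C + 1). split; [lra|]. intros m x y Hm _ Hpm HA.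
    exists (fun n => lag_term X T n a x). split.
    + intros n _. apply (resolvent_lag_term X T K HC0 HK HM); auto.
    + eapply Rle_trans; [apply (H m x y Hm Hpm HA)|].
      replace (1 - INR p / 2) with (- (INR p / 2 - 1)) by ring. rewrite Rpower_Ropp.
      apply Rmult_le_compat_r; [apply Rlt_le, Rinv_0_lt_compat, exp_pos|].
      apply Rmult_le_compat_r; [apply vnorm_ge_0|lra].
Qed.
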